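(* Let $\delta>0$ and $\mu>0$. Let $X=(X_t:t\ge 0)$, $X'=(X'_t:t\ge 0)$ and $E_\mu$ be independent, where $X$ has law $\mathbb{Q}_0^{\delta}$ (a squared Bessel process of dimension $\delta$ without drift started at $0$), $X'$ has law $\mathbb{Q}_0^{4,\mu}$ (a squared Bessel process of dimension $4$ with drift $\mu$ started at $0$), and $E_\mu$ is an exponential random variable with rate $\frac12\mu^2$. Then the process $$\left(X_t+X'_{(t-E_\mu)^+}:t\ge 0\right)$$ has law $\mathbb{Q}_0^{\delta,\mu}$, i.e. it is equal in law, as a process, to a squared Bessel process of dimension $\delta$ with drift $\mu$ started at $0$.
   Context: Notation: $x^+=\max\{0,x\}$. An $\mathrm{Exp}(\lambda)$ random variable (rate $\lambda$) has density $\lambda e^{-\lambda t}\mathbf 1_{[0,\infty)}(t)$. Bessel processes with drift (Watanabe). For $\delta>0$ and $\mu>0$ define $h_{\delta,\mu}:[0,\infty)\to[1,\infty)$ by $h_{\delta,\mu}(0)=1$ and $$h_{\delta,\mu}(x)=\left(\frac{2}{\mu x}\right)^{\frac{\delta}{2}-1}\Gamma\!\left(\frac{\delta}{2}\right)I_{\frac{\delta}{2}-1}(\mu x),\quad x>0,$$ where $I_\nu$ is the modified Bessel function of the first kind. The Bessel process of dimension $\delta>0$ with drift $\mu>0$ is the diffusion on $[0,\infty)$ with generator $$L^{\delta,\mu}=\frac12\frac{d^2}{dx^2}+\left(\frac{\delta-1}{2x}+\frac{h_{\delta,\mu}'(x)}{h_{\delta,\mu}(x)}\right)\frac{d}{dx},$$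 where $0$ is a regular boundary with instantaneous reflection if $0<\delta<2$ and an entrance boundary if $\delta\ge 2$. When $\mu=0$ it is the usual Bessel process of dimension $\delta$ (with $0$ instantaneously reflecting if $0<\delta<2$). Its law started at $x\ge 0$, on the space of continuous functions from $[0,\infty)$ to $\mathbb{R}$ with coordinate process $X$ and canonical filtration $(\mathcal F_t)$, is denoted $\mathbb{P}_x^{\delta,\mu}$, with $\mathbb{P}_x^{\delta}=\mathbb{P}_x^{\delta,0}$. Equivalently, for each fixed $t\ge0$ and $\mu>0$, $d\mathbb{P}_x^{\delta,\mu}|_{\mathcal F_t}=e^{-\frac12\mu^2t}\frac{h_{\delta,\mu}(X_t)}{h_{\delta,\mu}(x)}\,d\mathbb{P}_x^{\delta}|_{\mathcal F_t}$. Squared Bessel processes with drift: $\mathbb{Q}_x^{\delta,\mu}$ denotes the law of $(X_t^2:t\ge0)$ when $X$ has law $\mathbb{P}_{\sqrt x}^{\delta,\mu}$, and $\mathbb{Q}_x^{\delta}=\mathbb{Q}_x^{\delta,0}$. *)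

(* Defs.v *)
From HB Require Import structures.
From mathcomp Require Import all_boot all_order all_algebra.
From mathcomp Require Import all_classical all_reals all_analysis.

Set Implicit Arguments.
Unset Strict Implicit.
Unset Printing Implicit Defensive.

Import Order.TTheory GRing.Theory Num.Theory.
Import numFieldNormedType.Exports.

Local Open Scope classical_set_scope.
Local Open Scope ring_scope.

Section special_functions.
Context {R : realType}.

Definition Gamma (a : R) : R :=
  \int[lebesgue_measure]_(t in `]0, +oo[) (t `^ (a - 1) * expR (- t)).

Definition besselI (nu x : R) : R :=
  limn (series (fun k : nat =>
    (x / 2) `^ (2 * k%:R + nu) / (k`!%:R * Gamma (nu + k%:R + 1)))).

(* [mu = 0] stands for "no drift", where the h-transform is trivial. *)
Definition bessel_h (delta mu x : R) : R :=
  if (mu == 0) || (x == 0) then 1 else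
  (2 / (mu * x)) `^ (delta / 2 - 1) * Gamma (delta / 2) *
  besselI (delta / 2 - 1) (mu * x).

Definition bessel_drift (delta mu x : R) : R :=
  (delta - 1) / (2 * x) + derive1 (bessel_h delta mu) x / bessel_h delta mu x.

End special_functions.

Section path_space.
Context {R : realType}.

(* Time is [0, +oo[: the values at negative times are junk, and neither the
   sigma-algebra nor the filtration below sees them. *)
Record cpath : Type := CPath {
  cpath_fun :> R -> R;
  cpath_continuous : {within `[0, +oo[, continuous cpath_fun} }.

Lemma cst0_within_continuous : {within `[0, +oo[, continuous (cst 0 : R -> R)}.
Proof. by apply: continuous_subspaceT => x; exact: cst_continuous. Qed.

HB.instance Definition _ := gen_eqMixin cpath.
HB.instance Definition _ := gen_choiceMixin cpath.
HB.instance Definition _ := isPointed.Build cpath (CPath cst0_within_continuous).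

Definition coordinates (I : set R) : set (set cpath) :=
  \bigcup_(t in I) preimage_set_system setT (fun w : cpath => w t) measurable.

HB.instance Definition _ :=
  Measurable.copy cpath (g_sigma_algebraType (coordinates `[0, +oo[)).

Definition canonical_filtration (t : R) : set (set cpath) :=
  <<s coordinates `[0, t] >>.

Lemma sqr_path_continuous (w : cpath) :
  {within `[0, +oo[, continuous (fun t => w t ^+ 2)}.
Proof.
apply: (@within_continuous_comp _ _ _ _ w (fun y => y ^+ 2)).
  by move=> y _; exact: exprn_continuous.
exact: cpath_continuous.
Qed.

Definition sqr_path (w : cpath) : cpath := CPath (@sqr_path_continuous w).

Lemma delayed_sum_continuous (w w' : cpath) (e : R) :
  {within `[0, +oo[, continuous (fun t => w t + w' (Num.max 0 (t - e)))}.
Proof.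
have /subspace_continuousP cw := @cpath_continuous w.
have /subspace_continuousP cw' := @cpath_continuous w'.
apply/subspace_continuousP => t t0; apply: cvgD; first exact: cw.
have u0 r : `[0, +oo[%classic (Num.max 0 (r - e)).
  by rewrite /= in_itv /= andbT le_max lexx.
have cm : {for t, continuous (cst 0 \max (fun r : R => r - e))}.
  apply: continuous_max; first exact: cst_continuous.
  by apply: continuousB; [exact: cvg_id|exact: cst_continuous].
have cw'u : w' (Num.max 0 (r - e)) @[r --> t] --> w' (Num.max 0 (t - e)).
  move=> B /(cw' _ (u0 t)) /cm H.
  suff : nbhs t (fun r : R => `[0, +oo[%classic (Num.max 0 (r - e)) ->
      B (w' (Num.max 0 (r - e)))).
    by apply: filterS => r; apply; exact: u0.
  exact: H.
exact: cvg_trans (cvg_fmap2 (cvg_within _)) cw'u.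
Qed.

Definition delayed_sum (w w' : cpath) (e : R) : cpath :=
  CPath (@delayed_sum_continuous w w' e).

End path_space.
Arguments cpath : clear implicits.

Section laws.
Context {R : realType}.

Definition has_law d d' (Omega : measurableType d) (T : measurableType d')
    (P : probability Omega R) (X : Omega -> T) (Q : set T -> \bar R) : Prop :=
  measurable_fun setT X /\ forall A, measurable A -> P (X @^-1` A) = Q A.

(* Taking some of A, B, C to be setT gives the product rule for pairs. *)
Definition independent3 d d1 d2 d3 (Omega : measurableType d)
    (T1 : measurableType d1) (T2 : measurableType d2) (T3 : measurableType d3)
    (P : probability Omega R)
    (X : Omega -> T1) (Y : Omega -> T2) (Z : Omega -> T3) : Prop :=
  forall A B C, measurable A -> measurable B -> measurable C ->
  P (X @^-1` A `&` Y @^-1` B `&` Z @^-1` C) =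
  (P (X @^-1` A) * P (Y @^-1` B) * P (Z @^-1` C))%E.

Definition martingale (P : probability (cpath R) R) (M : R -> cpath R -> R) :=
  [/\ forall t : R, 0 <= t -> P.-integrable setT (EFin \o M t),
      forall (t : R) (B : set R), 0 <= t -> measurable B ->
        canonical_filtration t (M t @^-1` B) &
      forall (s t : R) (A : set (cpath R)),
        0 <= s -> s <= t -> canonical_filtration s A ->
        (\int[P]_(w in A) (M t w)%:E = \int[P]_(w in A) (M s w)%:E)%E].

(* Compactly supported part of the graph {(f, L f)} of the generator L of the
   Bessel process of dimension delta with drift mu. Only the restrictions of f
   and g to [0, +oo[ matter. The scale density of L is x^(1 - delta) / h(x)^2
   and h(0) = 1, so the last clause says that the derivative of f with respect
   to the scale function vanishes at 0. This is the boundary condition of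
   instantaneous reflection if delta < 2, and that of an entrance boundary if
   2 <= delta, in which case it holds automatically. *)
Definition bessel_generator (delta mu : R) (f g : R -> R) : Prop :=
  [/\ continuous f /\ continuous g,
      exists K : R, forall x : R, K <= x -> f x = 0,
      forall x : R, 0 < x -> derivable f x 1 /\ derivable (derive1 f) x 1,
      forall x : R, 0 < x ->
        g x = derive1 (derive1 f) x / 2 + bessel_drift delta mu x * derive1 f x &
      x `^ (delta - 1) * derive1 f x @[x --> 0^'+] --> 0].

(* The law of the diffusion started at x, as solution of the (well-posed)
   martingale problem for the generator. *)
Definition bessel_law (delta mu x : R) (P : probability (cpath R) R) : Prop :=
  [/\ {ae P, forall w : cpath R, w 0 = x},
      {ae P, forall w : cpath R, forall t : R, 0 <= t -> 0 <= w t} &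
      forall f g, bessel_generator delta mu f g ->
        martingale P (fun t w =>
          f (w t) - f (w 0) - \int[lebesgue_measure]_(r in `[0, t]) g (w r))].

Definition sqbessel_law (delta mu x : R) (Q : probability (cpath R) R) : Prop :=
  exists2 P : probability (cpath R) R,
    bessel_law delta mu (Num.sqrt x) P & has_law P sqr_path Q.

End laws.

(* Main.v *)
Require Import Defs.
From HB Require Import structures.
From mathcomp Require Import all_boot all_order all_algebra.
From mathcomp Require Import all_classical all_reals all_analysis.
From mathcomp Require Import measurable_realfun interval_inference.
From mathcomp Require Import ring lra.

Set Implicit Arguments.
Unset Strict Implicit.
Unset Printing Implicit Defensive.

Import Order.TTheory GRing.Theory Num.Theory.
Import numFieldNormedType.Exports.

Local Open Scope classical_set_scope.
Local Open Scope ring_scope.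

(** Write x_t for the square of the position of a Bessel process at time t, nu = mu^2 / 2, and
    h(z) = 0F1(delta / 2; mu^2 z / 4) for the Doob function seen as a function of the squared
    position (bessel_hE). The process with drift is the h-transform of the process without
    drift, and the proof checks that the square root of the sum has this very density.

    - The laws are given as solutions of a martingale problem, so that everything is extracted
      from the martingale property, tested against bounded functionals of the past
      (martingale_multiplier). Applied to exp(- l x) / h(x), it gives the evolution in
      time of E[xi exp(- l x_r) / h(x_r)]; along the characteristics of this first order
      equation in (l, r) the expectation is constant up to explicit factors
      (one_step_laplace). Iterating over finitely many times,
      E[exp(- sum_i l_i x_{r_i}) / h(x_t)] = exp(- nu t) a^(- delta / 2), where (a, b) solves the
      linear system b' = 2 a with jumps a += l_i b at the times r_i (multi_step_laplace).
    - Replacing the last weight l by l + eta turns a into a + eta b. Hence all the moments of x_t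
      under exp(- sum_i l_i x_{r_i}) / h(x_t) are those of a gamma law, and the power series
      h can be integrated against it (gamma_moment_series). This yields the Laplace
      functional exp(- nu t) a^(- delta / 2) exp(nu b / (2 a)) of the process with drift
      (laplace_functional), and without the factor exp(- nu t) that of the drift-free process weighted by
      h(x_t) (laplace_functional_density).
    - For the sum, independence multiplies the drift-free functional a^(- delta / 2) by the
      average over the delay e of the functional of the 4-dimensional process at the times
      (r_i - e)^+, which involves the system (a_e, b_e) started at time e. The linear system has
      determinant 1, so that d/de (b_e / a_e) = - 2 / a_e^2, and in dimension 4 the functional
      carries precisely the factor a_e^(- 2): the average is the integral of an exact
      derivative, equal to exp(- nu t) exp(nu b / (2 a)) (integral_delay_density).
    - Thus the square root of the sum and the drift-free process weighted by
      exp(- nu t) h(x_t) have the same Laplace functionals up to time t. Laplace functionals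
      determine finite measures of nonnegative paths on the events up to time t
      (laplace_determines_density), which gives sum_law.
    - Finally, if (f, g) is in the generator with drift then (f h, (g + nu f) h) is in the
      drift-free generator (bessel_generator_mul). So exp(- nu r) E[1_A (f h)(Y_r)] has derivative
      exp(- nu r) E[1_A (g h)(Y_r)], that is, the martingale property holds for f and g under the
      new law (change_of_law_martingale). *)

(** * Derivatives at a point *)

Section pointwise_derivatives.
Context {R : realType}.
Implicit Types (f g : R -> R) (x a b c : R).

Lemma der_cst c x : is_derive x 1 (fun=> c : R) 0.
Proof. exact: is_derive_cst. Qed.

Lemma der_id x : is_derive x 1 (fun y : R => y) 1.
Proof. exact: is_derive_id. Qed.

Lemma derD f g x a b : is_derive x 1 f a -> is_derive x 1 g b ->
  is_derive x 1 (fun y => f y + g y) (a + b).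
Proof. by move=> fa gb; exact: is_deriveD. Qed.

Lemma derN f x a : is_derive x 1 f a -> is_derive x 1 (fun y => - f y) (- a).
Proof. by move=> fa; exact: is_deriveN. Qed.

Lemma derB f g x a b : is_derive x 1 f a -> is_derive x 1 g b ->
  is_derive x 1 (fun y => f y - g y) (a - b).
Proof. by move=> fa gb; exact: is_deriveB. Qed.

Lemma derM f g x a b : is_derive x 1 f a -> is_derive x 1 g b ->
  is_derive x 1 (fun y => f y * g y) (a * g x + f x * b).
Proof.
move=> fa gb; rewrite [X in is_derive _ _ X _](_ : _ = f * g)//.
by apply: (is_derive_eq (is_deriveM fa gb)); rewrite /GRing.scale/= addrC mulrC.
Qed.

Lemma derV f x a : is_derive x 1 f a -> f x != 0 ->
  is_derive x 1 (fun y => (f y)^-1) (- a / f x ^+ 2).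
Proof.
move=> fa fx; apply: (is_derive_eq (is_deriveV fx fa)).
by rewrite /GRing.scale/= mulNr mulNr mulrC.
Qed.

Lemma derX f x a n : is_derive x 1 f a ->
  is_derive x 1 (fun y => f y ^+ n.+1) (n.+1%:R * f x ^+ n * a).
Proof.
move=> fa; rewrite [X in is_derive _ _ X _](_ : _ = f ^+ n.+1).
  by apply: (is_derive_eq (is_deriveX n.+1 fa)); rewrite /GRing.scale.
by apply/funext => y; elim: n.+1 => [|m ih]; rewrite ?expr0// !exprS ih.
Qed.

Lemma der_comp f g x a b : is_derive (f x) 1 g b -> is_derive x 1 f a ->
  is_derive x 1 (fun y => g (f y)) (b * a).
Proof. by move=> gb fa; exact: (is_derive1_comp gb fa). Qed.

Lemma der_expR f x a : is_derive x 1 f a ->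
  is_derive x 1 (fun y => expR (f y)) (expR (f x) * a).
Proof. by move=> fa; exact: (der_comp (is_derive_expR (f x)) fa). Qed.

Lemma der_ln f x a : is_derive x 1 f a -> 0 < f x ->
  is_derive x 1 (fun y => ln (f y)) ((f x)^-1 * a).
Proof. by move=> fa fx; exact: (der_comp (is_derive1_ln fx) fa). Qed.

Lemma der_powR f x a p : is_derive x 1 f a -> 0 < f x ->
  is_derive x 1 (fun y => f y `^ p) (p * f x `^ (p - 1) * a).
Proof. by move=> fa fx; exact: (der_comp (is_derive1_powR p fx) fa). Qed.

Lemma der_continuous f x a : is_derive x 1 f a -> {for x, continuous f}.
Proof.
by move=> [fx _]; apply: differentiable_continuous; exact/derivable1_diffP.
Qed.

Lemma der_eq f x a b : is_derive x 1 f a -> a = b -> is_derive x 1 f b.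
Proof. by move=> fa <-. Qed.

Lemma der_near f g x a : (\forall y \near x, f y = g y) ->
  is_derive x 1 f a -> is_derive x 1 g a.
Proof.
move=> fg [df fa]; split; first exact: near_eq_derivable df.
by rewrite -fa; apply: near_eq_derive => //; near=> y; apply/esym; near: y.
Unshelve. all: by end_near. Qed.

End pointwise_derivatives.

(** * The series 0F1 *)

Section hypergeometric_0F1.
Context {R : realType}.
Implicit Types (nu z : R) (n : nat).

(** Coefficients of the series 0F1(nu; z), that is 1 / (n! nu (nu + 1) ... (nu + n - 1)). It is
    preferred to the Bessel function because it is entire in z and has no singularity at 0. *)
Fixpoint hyp01_coef nu n : R :=
  if n is m.+1 then hyp01_coef nu m / (m.+1%:R * (nu + m%:R)) else 1.

Definition hyp01 nu z := limn (pseries (hyp01_coef nu) z).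

Lemma hyp01_coef_gt0 nu n : 0 < nu -> 0 < hyp01_coef nu n.
Proof.
move=> nu0; elim: n => //= n ih.
by rewrite divr_gt0// mulr_gt0// ltr_wpDr.
Qed.

Lemma hyp01_coef_le nu n : 0 < nu -> hyp01_coef nu n <= nu^-1 ^+ n / n`!%:R.
Proof.
move=> nu0; elim: n => /= [|n ih]; first by rewrite fact0 expr0 divr1.
have n0 : 0 < n.+1%:R :> R by [].
rewrite exprSr factS natrM !invfM.
rewrite [leRHS](_ : _ = nu^-1 ^+ n / n`!%:R * (n.+1%:R^-1 * nu^-1)); last by ring.
rewrite ler_pM//.
- by rewrite ltW// hyp01_coef_gt0.
- by rewrite mulr_ge0// invr_ge0// addr_ge0// ltW.
- by rewrite ler_pM2l ?invr_gt0// lef_pV2 ?posrE ?lerDl// ltr_wpDr.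
Qed.

Lemma is_cvg_hyp01 nu z : 0 < nu -> cvgn (pseries (hyp01_coef nu) z).
Proof.
move=> nu0; apply: normed_cvg.
apply: (@series_le_cvg _ _ (exp_coeff (nu^-1 * `|z|))).
- by move=> n; exact: normr_ge0.
- by move=> n; rewrite exp_coeff_ge0// mulr_ge0// invr_ge0 ltW.
- move=> n; rewrite /exp_coeff/= normrM normrX exprMn -mulrA [_ / _]mulrC mulrA.
  rewrite ler_wpM2r// ?exprn_ge0// ger0_norm ?hyp01_coef_le//.
  by rewrite ltW// hyp01_coef_gt0.
- exact: is_cvg_series_exp_coeff.
Qed.

Lemma hyp01_coefS nu n : 0 < nu ->
  hyp01_coef (nu + 1) n = nu / (nu + n%:R) * hyp01_coef nu n.
Proof.
move=> nu0; elim: n => /= [|n ->]; first by rewrite addr0 divff ?mulr1// gt_eqF.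
have h1 : nu + n%:R != 0 by rewrite gt_eqF// ltr_wpDr.
have h2 : nu + 1 + n%:R != 0 by rewrite gt_eqF// ltr_wpDr// ltr_wpDr.
have h3 : nu + n.+1%:R != 0 by rewrite gt_eqF// ltr_wpDr.
have h4 : n.+1%:R != 0 :> R by [].
rewrite -natr1 in h3 h4 *.
by field; rewrite h1 h4 h3.
Qed.

Lemma pseries_diffs_hyp01 nu : 0 < nu ->
  pseries_diffs (hyp01_coef nu) = nu^-1 *: hyp01_coef (nu + 1).
Proof.
move=> nu0; apply/funext => n; rewrite /pseries_diffs [in RHS]/GRing.scale/=.
rewrite /= hyp01_coefS//.
have h1 : nu + n%:R != 0 by rewrite gt_eqF// ltr_wpDr.
have h4 : n.+1%:R != 0 :> R by [].
rewrite -natr1 in h4 *.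
by rewrite /GRing.scale/=; field; rewrite h1 h4 gt_eqF.
Qed.

Lemma pseriesZ (c : R) (f : nat -> R) z : pseries (c *: f) z = c *: pseries f z.
Proof.
apply/funext => n; rewrite /pseries /series/=.
transitivity (c * \sum_(0 <= i < n) f i * z ^+ i) => //.
by rewrite mulr_sumr; apply: eq_bigr => i _; rewrite mulrA.
Qed.

Lemma is_derive_hyp01 nu z : 0 < nu ->
  is_derive z 1 (hyp01 nu) (hyp01 (nu + 1) z / nu).
Proof.
move=> nu0; have nu10 : 0 < nu + 1 by rewrite addr_gt0.
have K : `|z| < `| (`|z| + 1)| by rewrite [ltRHS]ger0_norm ?addr_ge0// ltrDl.
have -> : hyp01 (nu + 1) z / nu = limn (pseries (pseries_diffs (hyp01_coef nu)) z).
  rewrite pseries_diffs_hyp01// pseriesZ limZl_tmp; last exact: is_cvg_hyp01.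
  by rewrite /hyp01 mulrC.
apply: (@pseries_snd_diffs _ _ (`|z| + 1)) => //.
- exact: is_cvg_hyp01.
- rewrite pseries_diffs_hyp01// pseriesZ.
  by apply: is_cvgZl_tmp; exact: is_cvg_hyp01.
- rewrite pseries_diffs_hyp01//.
  have -> : pseries_diffs (nu^-1 *: hyp01_coef (nu + 1)) =
      nu^-1 *: pseries_diffs (hyp01_coef (nu + 1)).
    apply/funext => n; rewrite /pseries_diffs/= /GRing.scale/= /GRing.scale/=.
    by ring.
  rewrite pseriesZ pseries_diffs_hyp01// pseriesZ.
  by apply: is_cvgZl_tmp; apply: is_cvgZl_tmp; apply: is_cvg_hyp01; rewrite addr_gt0.
Qed.

Lemma hyp01_0 nu : hyp01 nu 0 = 1.
Proof.
apply: lim_near_cst => //; near=> m.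
have m0 : (0 < m)%N by near: m; exists 1%N.
rewrite /pseries /series/= big_ltn// big_nat big1/= ?expr0 ?mulr1 ?addr0//.
by move=> i /andP[i0 _]; rewrite expr0n gtn_eqF// mulr0.
Unshelve. all: by end_near. Qed.

Lemma hyp01_ge1 nu z : 0 < nu -> 0 <= z -> 1 <= hyp01 nu z.
Proof.
move=> nu0 z0; apply: limr_ge; first exact: is_cvg_hyp01.
near=> m; have m0 : (0 < m)%N by near: m; exists 1%N.
rewrite /pseries /series/= big_ltn//= expr0 mulr1 lerDl.
by apply: sumr_ge0 => i _; rewrite mulr_ge0 ?exprn_ge0// ltW// hyp01_coef_gt0.
Unshelve. all: by end_near. Qed.

(** The hypergeometric equation z F'' + nu F' = F, with F' and F'' already expressed through F
    at nu + 1 and nu + 2; it amounts to the recurrence of the coefficients. *)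
Lemma hyp01_contiguity nu z : 0 < nu ->
  z * (hyp01 (nu + 1 + 1) z / (nu + 1) / nu) + nu * (hyp01 (nu + 1) z / nu) =
  hyp01 nu z.
Proof.
move=> nu0; have nu1 : 0 < nu + 1 by rewrite addr_gt0.
have nu2 : 0 < nu + 1 + 1 by rewrite addr_gt0.
pose u := pseries (hyp01_coef nu) z.
pose v := fun n : nat => z * (pseries (hyp01_coef (nu + 1 + 1)) z n / (nu + 1) / nu) +
  pseries (hyp01_coef (nu + 1)) z n.+1.
have cv : v @ \oo --> z * (hyp01 (nu + 1 + 1) z / (nu + 1) / nu) + hyp01 (nu + 1) z.
  apply: cvgD; last by rewrite (cvg_shiftS (pseries (hyp01_coef (nu + 1)) z)); exact: is_cvg_hyp01.
  have c2 : pseries (hyp01_coef (nu + 1 + 1)) z @ \oo --> hyp01 (nu + 1 + 1) z.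
    exact: is_cvg_hyp01.
  exact: cvgM (cvg_cst _) (cvgM (cvgM c2 (cvg_cst _)) (cvg_cst _)).
have cu : [sequence u n.+1]_n @ \oo --> hyp01 nu z.
  by rewrite (cvg_shiftS u); exact: is_cvg_hyp01.
have vu : v = [sequence u n.+1]_n.
  apply/funext => n; rewrite /v /u /pseries /series/= big_nat_recl//= big_nat_recl//=.
  rewrite addrCA; congr (_ + _).
  rewrite !mulr_suml mulr_sumr -big_split/=; apply: eq_bigr => i _.
  rewrite !hyp01_coefS// exprS.
  have h1 : nu + i%:R != 0 by rewrite gt_eqF// ltr_wpDr.
  have h2 : nu + 1 + i%:R != 0 by rewrite gt_eqF// ltr_wpDr.
  have h4 : i.+1%:R != 0 :> R by [].
  rewrite -natr1 in h4 *.
  rewrite -addrA [1 + _]addrC in h2.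
  by field; rewrite h1 h4 !gt_eqF//= ?ltr_wpDr// ?addr_gt0.
rewrite [nu * _]mulrC divfK ?gt_eqF//.
by move: cv; rewrite vu => /(cvg_lim (@Rhausdorff R)) <-; exact/cvg_lim.
Qed.

End hypergeometric_0F1.

(** * The recurrence of the Gamma function *)

Section gamma_function.
Context {R : realType}.
Notation leb := (@lebesgue_measure R).

(** The integrand may be singular at 0, so that the half-line is exhausted by the intervals
    starting at 1 / (n + 1). *)
Lemma ge0_integral_oy_FTC (f F : R -> R) (a l : R) :
    (forall x : R, 0 < x -> 0 <= f x) ->
    (forall x : R, 0 < x -> {for x, continuous f}) ->
    (forall x : R, 0 < x -> is_derive x 1 F (f x)) ->
    F x @[x --> 0^'+] --> a -> F x @[x --> +oo%R] --> l ->
  (\int[leb]_(x in `]0%R, +oo[) (f x)%:E = (l - a)%:E)%E.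
Proof.
move=> f0 cf dF Fa Fl.
pose D n := `[(n.+1%:R^-1 : R), +oo[%classic.
have DU : `]0%R, +oo[%classic = \bigcup_n D n.
  apply/seteqP; split => x /=; rewrite in_itv/= andbT.
    move=> x0; exists (Num.truncn x^-1) => //; rewrite /D/= in_itv/= andbT.
    rewrite -[leRHS]invrK lef_pV2 ?posrE ?invr_gt0//.
    by rewrite ltW// truncnS_gt.
  by move=> [n _]; rewrite /D/= in_itv/= andbT; apply: lt_le_trans; rewrite invr_gt0.
have Dpos n x : D n x -> 0 < x.
  by rewrite /D/= in_itv/= andbT; apply: lt_le_trans; rewrite invr_gt0.
have mf n : measurable_fun (D n) f.
  have D0 : measurable (`]0%R, +oo[%classic : set R) by [].
  apply: (measurable_funS D0).
    by rewrite DU => x Dx; exists n.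
  apply: open_continuous_measurable_fun; first exact: interval_open.
  by move=> x; rewrite inE/= in_itv/= andbT; exact: cf.
have H : (\int[leb]_(x in D n) (f x)%:E @[n --> \oo] -->
    \int[leb]_(x in `]0%R, +oo[) (f x)%:E)%E.
  rewrite DU; apply: ge0_nondecreasing_set_cvg_integral => //.
  - apply/nondecreasing_seqP => n; apply/subsetPset => x; rewrite /D/= !in_itv/= !andbT.
    by apply: le_trans; rewrite lef_pV2 ?posrE// ler_nat.
  - by move=> n; exact: measurable_itv.
  - move=> n.
    by have /measurable_EFinP := mf n.
  - by move=> n x /Dpos x0; rewrite lee_fin f0.
have DE n : (\int[leb]_(x in D n) (f x)%:E = (l - F n.+1%:R^-1)%:E)%E.
  rewrite (@ge0_continuous_FTC2y _ f F _ l)//.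
  - by move=> x nx; rewrite f0// (lt_le_trans _ nx)// invr_gt0.
  - apply/subspace_continuousP => x nx.
    by apply: cvg_within_filter; exact: (cf _ (Dpos _ _ nx)).
  - by move=> x nx; have [] := dF _ (lt_trans (_ : 0 < n.+1%:R^-1) nx).
  - apply: cvg_at_right_filter; apply: differentiable_continuous.
    by apply/derivable1_diffP; have [] := dF n.+1%:R^-1.
  - move=> x; rewrite in_itv/= andbT => nx.
    have x0 : 0 < x by rewrite (lt_trans _ nx).
    by rewrite derive1E; have [_ ->] := dF _ x0.
suff G : (\int[leb]_(x in D n) (f x)%:E @[n --> \oo] --> (l - a)%:E)%E.
  exact: (cvg_unique _ H G).
under eq_cvg do rewrite DE.
apply: cvg_EFin; first exact: nearW.
rewrite /comp/=; apply: cvgB; first exact: cvg_cst.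
move/cvg_at_rightP : Fa; apply; split => [n|]; first by rewrite invr_gt0.
exact: cvg_harmonic.
Qed.

Lemma powR_expR_bounded (p : R) :
  exists2 C, 0 < C & forall t, 0 <= t -> (1 + t) `^ p * expR (- t) <= C.
Proof.
pose n := Num.truncn p; exists (n.+1`!%:R * expR 1) => [|t t0].
  by rewrite mulr_gt0 ?expR_gt0// ltr0n fact_gt0.
have t1 : 0 <= 1 + t by rewrite addr_ge0.
rewrite expRN ler_pdivrMr ?expR_gt0// -mulrA -expRD.
rewrite (@le_trans _ _ ((1 + t) ^+ n.+1))//.
  by rewrite -powR_mulrn// ler_powR ?lerDl// ltW// truncnS_gt.
rewrite mulrC -ler_pdivrMr ?ltr0n ?fact_gt0//.
by rewrite (le_trans _ (expR_ge1Dxn n t1))// lerDr.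
Qed.

Definition gamma_pdf (a t : R) := t `^ (a - 1) * expR (- t).

(** A density with an elementary primitive and with the singularity at 0 of the Gamma
    integrand: it dominates that integrand up to a constant. *)
Definition beta_prime_pdf (a t : R) := a * t `^ (a - 1) * (1 + t) `^ (- (a + 1)).

Lemma is_derive_beta_prime (a t : R) : 0 < t ->
  is_derive t 1 (fun x => (x / (1 + x)) `^ a) (beta_prime_pdf a t).
Proof.
move=> t0; have t1 : 0 < 1 + t by rewrite addr_gt0.
have h : is_derive t 1 (fun x => x / (1 + x)) ((1 + t) ^- 2).
  apply: der_eq (derM (der_id t) (derV (derD (der_cst 1 t) (der_id t)) (lt0r_neq0 t1))) _.
  by field; rewrite gt_eqF.
have ttt : 0 < t / (1 + t) by rewrite divr_gt0.
apply: (der_eq (der_powR a h ttt)).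
rewrite /beta_prime_pdf powRM ?invr_ge0 ?ltW//.
rewrite -powR_inv1 ?ltW// -powRrM mulN1r -!mulrA; congr (_ * (_ * _)).
rewrite -powR_invn ?ltW// -powRD; last by rewrite (gt_eqF t1) implybT.
by congr (_ `^ _); ring.
Qed.

Lemma beta_prime_cvg0 (a : R) : 0 < a -> (x / (1 + x)) `^ a @[x --> 0^'+] --> (0 : R).
Proof.
move=> a0; apply: (@squeeze_cvgr _ _ _ _ (cst 0) (fun x => x `^ a)).
- near=> x; have x0 : 0 < x by near: x; exact: nbhs_right_gt.
  rewrite powR_ge0/= ge0_ler_powR ?nnegrE ?divr_ge0 ?addr_ge0 ?(ltW x0) ?(ltW a0)//.
  by rewrite ler_pdivrMr ?addr_gt0// ler_peMr ?(ltW x0)// lerDl ltW.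
- exact: cvg_cst.
- exact: powR_cvg0.
Unshelve. all: by end_near. Qed.

Lemma cvg_inv_addl : (1 + x)^-1 @[x --> +oo%R] --> (0 : R).
Proof.
apply/gtr0_cvgV0; last exact: cvg_addrl.
by near=> x; rewrite ltr_wpDr//; near: x; exact: nbhs_pinfty_ge.
Unshelve. all: by end_near. Qed.

Lemma beta_prime_cvgy (a : R) : (x / (1 + x)) `^ a @[x --> +oo%R] --> (1 : R).
Proof.
have H : (1 - (1 + x)^-1) `^ a @[x --> +oo%R] --> (1 : R).
  have c0 : 1 - (1 + x)^-1 @[x --> +oo%R] --> (1 - 0 : R).
    by apply: cvgB; [exact: cvg_cst|exact: cvg_inv_addl].
  have /continuous_cvg cp : {for (1 - 0 : R), continuous (fun x => x `^ a)}.
    by apply: (der_continuous (der_powR a (der_id _) _)); rewrite subr0.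
  have E : (1 : R) = (1 - 0) `^ a by rewrite subr0 powR1.
  by rewrite [X in _ --> X]E; apply: cp.
apply: cvg_trans H; apply: near_eq_cvg; near=> x.
have x0 : 0 < x by near: x; exact: nbhs_pinfty_gt.
by congr (_ `^ _); field; rewrite gt_eqF// addr_gt0.
Unshelve. all: by end_near. Qed.

Lemma beta_prime_pdf_ge0 (a t : R) : 0 < a -> 0 <= beta_prime_pdf a t.
Proof. by move=> a0; rewrite !mulr_ge0 ?powR_ge0// ltW. Qed.

Lemma beta_prime_pdf_continuous (a x : R) : 0 < x ->
  {for x, continuous (beta_prime_pdf a)}.
Proof.
move=> x0; have x1 : 0 < 1 + x by rewrite addr_gt0.
exact: (der_continuous (derM (derM (der_cst a x) (der_powR (a - 1) (der_id x) x0))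
  (der_powR (- (a + 1)) (derD (der_cst 1 x) (der_id x)) x1))).
Qed.

Lemma integral_beta_prime (a : R) : 0 < a ->
  (\int[leb]_(x in `]0%R, +oo[) (beta_prime_pdf a x)%:E = 1)%E.
Proof.
move=> a0; rewrite -[RHS]/(1%:E) -[1 in RHS]subr0.
apply: (@ge0_integral_oy_FTC _ (fun x => (x / (1 + x)) `^ a) 0 1).
- by move=> x _; exact: beta_prime_pdf_ge0.
- by move=> x; exact: beta_prime_pdf_continuous.
- by move=> x x0; exact: is_derive_beta_prime.
- exact: beta_prime_cvg0.
- exact: beta_prime_cvgy.
Qed.

Lemma gamma_pdf_ge0 (a t : R) : 0 <= gamma_pdf a t.
Proof. by rewrite mulr_ge0 ?powR_ge0 ?expR_ge0. Qed.

Lemma der_expRN (x : R) : is_derive x 1 (fun t : R => expR (- t)) (expR (- x) * - 1).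
Proof. exact: (der_expR (derN (der_id x))). Qed.

Lemma gamma_pdf_continuous (a x : R) : 0 < x -> {for x, continuous (gamma_pdf a)}.
Proof.
move=> x0.
exact: (der_continuous (derM (der_powR (a - 1) (der_id x) x0) (der_expRN x))).
Qed.

Lemma measurable_oy (f : R -> R) : (forall x : R, 0 < x -> {for x, continuous f}) ->
  measurable_fun (`]0, +oo[%classic : set R) (EFin \o f).
Proof.
move=> cf; apply/measurable_EFinP.
apply: open_continuous_measurable_fun; first exact: interval_open.
by move=> x; rewrite inE/= in_itv/= andbT; exact: cf.
Qed.

Lemma gamma_pdf_le (a : R) : 0 < a -> exists2 C, 0 < C & forall t, 0 < t ->
  gamma_pdf a t <= C * beta_prime_pdf a t /\
  gamma_pdf (a + 1) t <= C * beta_prime_pdf a t.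
Proof.
move=> a0; have [C C0 HC] := powR_expR_bounded (a + 2).
exists (C / a); first by rewrite divr_gt0.
move=> t t0; have t1 : 0 < 1 + t by rewrite addr_gt0.
have key : (1 + t) * expR (- t) <= C * (1 + t) `^ (- (a + 1)).
  rewrite powRN ler_pdivlMr ?powR_gt0// mulrAC -{1}[1 + t](powRr1 (ltW t1)).
  rewrite -powRD; last by rewrite (gt_eqF t1) implybT.
  by rewrite (_ : 1 + (a + 1) = a + 2); [exact: HC (ltW t0)|ring].
rewrite /beta_prime_pdf -!mulrA [a^-1 * _]mulrA [X in C * X]mulrA.
rewrite (mulVf (lt0r_neq0 a0)) mul1r mulrCA; split.
  rewrite ler_pM2l ?powR_gt0// (le_trans _ key)// ler_peMl ?expR_ge0//.
  by rewrite lerDl ltW.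
rewrite /gamma_pdf addrK -(mulr_powRB1 (ltW t0) a0) [t * _]mulrC -mulrA.
rewrite ler_pM2l ?powR_gt0// (le_trans _ key)//.
by rewrite ler_pM2r ?expR_gt0// lerDr.
Qed.

Lemma integral_gamma_pdf_fin (a : R) : 0 < a ->
  (\int[leb]_(x in `]0%R, +oo[) (gamma_pdf a x)%:E)%E \is a fin_num.
Proof.
move=> a0; have [C C0 HC] := gamma_pdf_le a0.
rewrite ge0_fin_numE; last by apply: integral_ge0 => x _; rewrite lee_fin gamma_pdf_ge0.
apply: (@le_lt_trans _ _ (C%:E * \int[leb]_(x in `]0%R, +oo[) (beta_prime_pdf a x)%:E)%E).
  rewrite -ge0_integralZl_EFin//.
  - apply: ge0_le_integral => //.
    + by move=> x _; rewrite lee_fin gamma_pdf_ge0.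
    + by apply: measurable_oy => x; exact: gamma_pdf_continuous.
    + have -> : (fun x => C%:E * (beta_prime_pdf a x)%:E)%E = EFin \o (fun x => C * beta_prime_pdf a x) by [].
      by apply: measurable_oy => x x0; apply: cvgM; [exact: cvg_cst|exact: beta_prime_pdf_continuous].
    + by move=> x /=; rewrite in_itv/= andbT -EFinM lee_fin => /HC[].
  - by move=> x _; rewrite lee_fin beta_prime_pdf_ge0.
  - by apply: measurable_oy => x; exact: beta_prime_pdf_continuous.
  - exact: ltW.
by rewrite integral_beta_prime// mule1 ltry.
Qed.

Lemma Gamma_gt0 (a : R) : 0 < a -> 0 < Gamma a.
Proof.
move=> a0; apply: fine_gt0; apply/andP; split; last first.
  rewrite -ge0_fin_numE; first exact: integral_gamma_pdf_fin.
  by apply: integral_ge0 => x _; rewrite lee_fin gamma_pdf_ge0.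
pose c : R := expR (- 2) / 2.
have c0 : 0 < c by rewrite divr_gt0 ?expR_gt0.
have s12 : (`[1, 2]%classic : set R) `<=` `]0%R, +oo[%classic.
  by move=> x/=; rewrite !in_itv/= andbT => /andP[x1 _]; exact: lt_le_trans x1.
apply: (@lt_le_trans _ _ (\int[leb]_(x in `[1%R, 2%R]) c%:E)%E).
  rewrite integral_cst//= lebesgue_measure_itv/= lte_fin ltr1n.
  by rewrite -EFinB -EFinM lte_fin mulr_gt0//; lra.
apply: (@le_trans _ _ (\int[leb]_(x in `[1%R, 2%R]) (gamma_pdf a x)%:E)%E).
  apply: ge0_le_integral => //.
  - by move=> x _; rewrite lee_fin ltW.
  - apply: (measurable_funS _ s12) => //.
    by apply: measurable_oy => x; exact: gamma_pdf_continuous.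
  - move=> x /=; rewrite in_itv/= => /andP[x1 x2]; rewrite lee_fin /c mulrC.
    apply: ler_pM; rewrite ?expR_ge0 ?invr_ge0//; last by rewrite ler_expR lerN2.
    have x0 : 0 < x by exact: lt_le_trans x1.
    rewrite -(ler_pM2l x0) (mulr_powRB1 (ltW x0) a0) (@le_trans _ _ 1)//; first by lra.
    by rewrite -(powRr0 x) ler_powR// ltW.
apply: ge0_subset_integral => //.
- by apply: measurable_oy => x; exact: gamma_pdf_continuous.
- by move=> x _; rewrite lee_fin gamma_pdf_ge0.
Qed.

(** Integration by parts: t^a exp(- t) has derivative a t^(a - 1) exp(- t) - t^a exp(- t) and
    vanishes at both ends. Adding a large multiple of the dominating density makes the
    integrand nonnegative. *)
Lemma GammaS (a : R) : 0 < a -> Gamma (a + 1) = a * Gamma a.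
Proof.
move=> a0; have [K K0 HK] := gamma_pdf_le a0.
pose f t := a * gamma_pdf a t - gamma_pdf (a + 1) t + K * beta_prime_pdf a t.
pose F t := t `^ a * expR (- t) + K * (t / (1 + t)) `^ a.
have f0 x : 0 < x -> 0 <= f x.
  move=> x0; rewrite /f -addrA addr_ge0//.
    by rewrite mulr_ge0 ?(ltW a0)//; exact: gamma_pdf_ge0.
  by rewrite addrC subr_ge0; have [_] := HK _ x0.
have cf x : 0 < x -> {for x, continuous f}.
  move=> x0; apply: cvgD; last by apply: cvgM; [exact: cvg_cst|exact: beta_prime_pdf_continuous].
  apply: cvgB; last exact: gamma_pdf_continuous.
  by apply: cvgM; [exact: cvg_cst|exact: gamma_pdf_continuous].
have If : (\int[leb]_(x in `]0%R, +oo[) (f x)%:E = K%:E)%E.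
  rewrite -[K in RHS]subr0; apply: (@ge0_integral_oy_FTC f F) => //.
  - move=> x x0; apply: der_eq (derD (derM (der_powR a (der_id x) x0) (der_expRN x))
      (derM (der_cst K x) (is_derive_beta_prime a x0))) _.
    by rewrite /f /gamma_pdf addrK mulr1 mul0r add0r mulrN1 mulrN -mulrA.
  - rewrite -[X in _ --> X]addr0 -[X in _ --> X + _](mul0r (expR (- 0))) -[X in _ --> _ + X](mulr0 K).
    apply: cvgD; apply: cvgM.
    + exact: powR_cvg0.
    + by apply: cvg_at_right_filter; exact: (der_continuous (der_expRN 0)).
    + exact: cvg_cst.
    + exact: beta_prime_cvg0.
  - rewrite -[X in _ --> X]add0r -[X in _ --> _ + X](mulr1 K); apply: cvgD; last first.
      by apply: cvgM; [exact: cvg_cst|exact: beta_prime_cvgy].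
    have [C C0 HC] := powR_expR_bounded (a + 1).
    apply: (@squeeze_cvgr _ _ _ _ (cst 0) (fun x => C * (1 + x)^-1)).
    + near=> x; have x0 : 0 < x by near: x; exact: nbhs_pinfty_gt.
      rewrite mulr_ge0 ?powR_ge0 ?expR_ge0//= ler_pdivlMr ?addr_gt0//.
      apply: le_trans (HC _ (ltW x0)).
      rewrite mulrAC ler_pM2r ?expR_gt0// powRD ?powRr1; last 2 first.
        by rewrite addr_ge0 ?ltW.
        by rewrite gt_eqF ?implybT// addr_gt0.
      rewrite ler_pM2r ?addr_gt0// ge0_ler_powR ?nnegrE ?addr_ge0 ?(ltW x0) ?(ltW a0)//.
      by rewrite lerDr.
    + exact: cvg_cst.
    + by rewrite -[X in _ --> X](mulr0 C); apply: cvgM; [exact: cvg_cst|exact: cvg_inv_addl].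
have mg b : measurable_fun (`]0, +oo[%classic : set R) (EFin \o gamma_pdf b).
  by apply: measurable_oy => x; exact: gamma_pdf_continuous.
have E : (\int[leb]_(x in `]0%R, +oo[) (f x)%:E + \int[leb]_(x in `]0%R, +oo[) (gamma_pdf (a + 1) x)%:E =
   a%:E * \int[leb]_(x in `]0%R, +oo[) (gamma_pdf a x)%:E + K%:E * \int[leb]_(x in `]0%R, +oo[) (beta_prime_pdf a x)%:E)%E.
  have mb : measurable_fun (`]0, +oo[%classic : set R) (EFin \o beta_prime_pdf a).
    by apply: measurable_oy => x; exact: beta_prime_pdf_continuous.
  rewrite -ge0_integralD//; first last.
  - exact: mg.
  - by move=> x _; rewrite lee_fin gamma_pdf_ge0.
  - exact: measurable_oy.
  - by move=> x /=; rewrite in_itv/= andbT lee_fin; exact: f0.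
  rewrite -!ge0_integralZl_EFin//; first last.
  all: try exact: ltW.
  all: try exact: mg.
  all: try exact: mb.
  all: try by move=> x _; rewrite lee_fin gamma_pdf_ge0.
  all: try by move=> x _; rewrite lee_fin beta_prime_pdf_ge0.
  rewrite -ge0_integralD//; first last.
  - exact: (measurable_funeM K%:E mb).
  - by move=> x _; rewrite -EFinM lee_fin mulr_ge0 ?(ltW K0)// beta_prime_pdf_ge0.
  - exact: (measurable_funeM a%:E (mg a)).
  - by move=> x _; rewrite -EFinM lee_fin mulr_ge0 ?(ltW a0)// gamma_pdf_ge0.
  by apply: eq_integral => x _; rewrite -!EFinM -!EFinD; congr EFin; rewrite /f; ring.
move: E; rewrite If integral_beta_prime// mule1.
have a1 : 0 < a + 1 by rewrite addr_gt0.
rewrite -(fineK (integral_gamma_pdf_fin a0)) -(fineK (integral_gamma_pdf_fin a1)).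
by rewrite -EFinM -!EFinD => -[] /eqP; rewrite addrC (inj_eq (addIr _)) => /eqP.
Unshelve. all: by end_near. Qed.

End gamma_function.

(** * The Doob transform and the generator *)

Lemma cvg_toE {R : realType} {T : Type} (F : set_system T) (f : T -> R) (a b : R) :
  f @ F --> a -> a = b -> f @ F --> b.
Proof. by move=> fa <-. Qed.

Section doob_transform.
Context {R : realType}.
Implicit Types (delta mu lam eps nu x y z : R).

Lemma hyp01_coef_Gamma nu k : 0 < nu ->
  hyp01_coef nu k = Gamma nu / (k`!%:R * Gamma (nu + k%:R)).
Proof.
move=> nu0; have G0 : Gamma nu != 0 by rewrite gt_eqF// Gamma_gt0.
elim: k => [|k ih]; first by rewrite /= fact0 mul1r addr0 divff.
have nuk : 0 < nu + k%:R by rewrite ltr_wpDr.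
have Gk : Gamma (nu + k%:R) != 0 by rewrite gt_eqF// Gamma_gt0.
have kf : k`!%:R != 0 :> R by rewrite pnatr_eq0 -lt0n fact_gt0.
have k1 : k.+1%:R != 0 :> R by [].
rewrite /= ih -[k.+1%:R in RHS]natr1 addrA GammaS// factS natrM.
move: (k.+1%:R) (k`!%:R) (nu + _) (Gamma (nu + _)) (Gamma nu) k1 kf Gk nuk => a b e u w a0 b0 u0 /lt0r_neq0 e0.
by field; rewrite a0 b0 u0 e0.
Qed.

Definition sq_bessel_h delta mu z := hyp01 (delta / 2) (mu ^+ 2 / 4 * z).

(** Substituting the series of the Bessel function, the powers of x / 2 cancel and the
    recurrence of Gamma turns the coefficients into those of 0F1. *)
Lemma bessel_hE delta mu x : 0 < delta -> 0 <= mu -> 0 <= x ->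
  bessel_h delta mu x = sq_bessel_h delta mu (x ^+ 2).
Proof.
move=> d0; rewrite le_eqVlt => /predU1P[<- _|mu0].
  by rewrite /bessel_h eqxx/= /sq_bessel_h expr0n/= !mul0r hyp01_0.
rewrite le_eqVlt => /predU1P[<-|x0].
  by rewrite /bessel_h eqxx orbT /sq_bessel_h expr0n/= mulr0 hyp01_0.
have nu0 : 0 < delta / 2 by rewrite divr_gt0.
have z0 : 0 < mu * x / 2 by rewrite divr_gt0// mulr_gt0.
rewrite /bessel_h (gt_eqF mu0) (gt_eqF x0)/= /besselI /sq_bessel_h /hyp01.
set c := _ * Gamma _.
have cvg := @is_cvg_hyp01 _ _ (mu ^+ 2 / 4 * x ^+ 2) nu0.
have -> : (fun k : nat => (mu * x / 2) `^ (2 * k%:R + (delta / 2 - 1)) /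
     (k`!%:R * Gamma (delta / 2 - 1 + k%:R + 1))) =
   c^-1 *: (fun k => hyp01_coef (delta / 2) k * (mu ^+ 2 / 4 * x ^+ 2) ^+ k).
  apply/funext => k.
  rewrite [RHS]/GRing.scale/= hyp01_coef_Gamma//.
  have -> : delta / 2 - 1 + k%:R + 1 = delta / 2 + k%:R by ring.
  rewrite powRD; last by rewrite (gt_eqF z0) implybT.
  have -> : (mu * x / 2) `^ (2 * k%:R) = (mu ^+ 2 / 4 * x ^+ 2) ^+ k.
    rewrite powRrM powR_mulrn ?ltW// ?powR_gt0// powR_mulrn ?ltW//.
    by congr (_ ^+ _); field.
  have -> : (mu * x / 2) `^ (delta / 2 - 1) = ((2 / (mu * x)) `^ (delta / 2 - 1))^-1.
    rewrite -[mu * x / 2]invrK -powR_inv1 ?invr_ge0 ?ltW//.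
    by rewrite -powRrM mulN1r powRN; congr (_ `^ _)^-1; field; rewrite !gt_eqF.
  have nuk : 0 < delta / 2 + k%:R by rewrite ltr_wpDr.
  have kf : k`!%:R != 0 :> R by rewrite pnatr_eq0 -lt0n fact_gt0.
  have p0 : 0 < (2 / (mu * x)) `^ (delta / 2 - 1) by rewrite powR_gt0 ?divr_gt0 ?mulr_gt0.
  rewrite /GRing.scale/= /c.
  move: p0 (Gamma_gt0 nu0) (Gamma_gt0 nuk) kf => /lt0r_neq0 + /lt0r_neq0 + /lt0r_neq0.
  move: (_ ^+ k) (_ `^ _) (Gamma _) (Gamma _) (k`!%:R) => a b e u w b0 e0 u0 w0.
  by field; rewrite b0 e0 u0 w0.
rewrite (_ : series _ = c^-1 *: pseries (hyp01_coef (delta / 2)) (mu ^+ 2 / 4 * x ^+ 2)).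
  rewrite limZl_tmp// /GRing.scale/= mulrA divff ?mul1r//.
  by rewrite gt_eqF// mulr_gt0 ?Gamma_gt0 ?powR_gt0 ?divr_gt0 ?mulr_gt0.
by rewrite -pseriesZ /pseries; congr series; apply/funext => k; exact: mulrA.
Qed.

(** First and second derivatives of [sq_bessel_h]. *)
Definition sqh1 delta mu z := hyp01 (delta / 2 + 1) (mu ^+ 2 / 4 * z) / (delta / 2) * (mu ^+ 2 / 4).
Definition sqh2 delta mu z := hyp01 (delta / 2 + 1 + 1) (mu ^+ 2 / 4 * z) /
  (delta / 2 + 1) * (mu ^+ 2 / 4) / (delta / 2) * (mu ^+ 2 / 4).

Lemma der_linear (c z : R) : is_derive z 1 (fun y => c * y) c.
Proof. by apply: (der_eq (derM (der_cst c z) (der_id z))); ring. Qed.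

Lemma der_sq_bessel_h delta mu z : 0 < delta ->
  is_derive z 1 (sq_bessel_h delta mu) (sqh1 delta mu z).
Proof.
move=> d0; apply: (der_comp (is_derive_hyp01 _ _) (der_linear _ z)).
by rewrite divr_gt0.
Qed.

Lemma der_sqh1 delta mu z : 0 < delta ->
  is_derive z 1 (sqh1 delta mu) (sqh2 delta mu z).
Proof.
move=> d0; have nu0 : 0 < delta / 2 + 1 by rewrite addr_gt0// divr_gt0.
apply: (der_eq (derM (derM (der_comp (is_derive_hyp01 _ nu0) (der_linear _ z))
  (der_cst (delta / 2)^-1 z)) (der_cst _ z))).
by rewrite /sqh2; ring.
Qed.

Lemma sq_bessel_h_ode delta mu z : 0 < delta ->
  2 * z * sqh2 delta mu z + delta * sqh1 delta mu z = mu ^+ 2 / 2 * sq_bessel_h delta mu z.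
Proof.
move=> d0; have nu0 : 0 < delta / 2 by rewrite divr_gt0.
rewrite /sq_bessel_h -(hyp01_contiguity _ nu0) /sqh1 /sqh2.
field; rewrite (gt_eqF d0)/= gt_eqF//; lra.
Qed.

Lemma sq_bessel_h_ge1 delta mu z : 0 < delta -> 0 <= z -> 1 <= sq_bessel_h delta mu z.
Proof.
by move=> d0 z0; rewrite hyp01_ge1 ?divr_gt0// mulr_ge0// divr_ge0// sqr_ge0.
Qed.

Lemma sq_bessel_h_gt0 delta mu z : 0 < delta -> 0 <= z -> 0 < sq_bessel_h delta mu z.
Proof. by move=> d0 z0; rewrite (lt_le_trans ltr01)// sq_bessel_h_ge1. Qed.

Lemma sq_bessel_h_continuous delta mu : 0 < delta -> continuous (sq_bessel_h delta mu).
Proof. by move=> d0 z; exact: der_continuous (der_sq_bessel_h mu z d0). Qed.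

Lemma sq_bessel_h0 delta mu : sq_bessel_h delta mu 0 = 1.
Proof. by rewrite /sq_bessel_h mulr0 hyp01_0. Qed.

Lemma sq_bessel_h_nodrift delta z : sq_bessel_h delta 0 z = 1.
Proof. by rewrite /sq_bessel_h expr0n/= !mul0r hyp01_0. Qed.

Lemma der_sqr x : is_derive x 1 (fun y : R => y ^+ 2) (2 * x).
Proof. by apply: (der_eq (derX 1 (der_id x))); rewrite expr1 mulr1. Qed.

Lemma der_of_sqr (q : R -> R) (x a : R) : is_derive (x ^+ 2) 1 q a ->
  is_derive x 1 (fun y => q (y ^+ 2)) (a * (2 * x)).
Proof. by move=> qa; exact: (der_comp (f := fun y => y ^+ 2) qa (der_sqr x)). Qed.

Lemma near_gt0 x : 0 < x -> \forall y \near x, 0 < y.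
Proof. by move=> x0; exact: lt_nbhsr. Qed.

Lemma bessel_driftE delta mu x : 0 < delta -> 0 <= mu -> 0 < x ->
  bessel_drift delta mu x = (delta - 1) / (2 * x) +
    sqh1 delta mu (x ^+ 2) * (2 * x) / sq_bessel_h delta mu (x ^+ 2).
Proof.
move=> d0 mu0 x0; rewrite /bessel_drift bessel_hE ?(ltW x0)//; congr (_ + _ / _).
rewrite derive1E.
have [_ <-] : is_derive x 1 (bessel_h delta mu) (sqh1 delta mu (x ^+ 2) * (2 * x)).
  apply: der_near (der_of_sqr (der_sq_bessel_h mu (x ^+ 2) d0)).
  near=> y; rewrite bessel_hE// ltW//; near: y; exact: near_gt0.
by [].
Unshelve. all: by end_near. Qed.

Lemma der_derive1 (f : R -> R) (x a : R) : is_derive x 1 f a -> derive1 f x = a.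
Proof. by move=> [_ <-]; rewrite derive1E. Qed.

Lemma derivable_der (f : R -> R) x : derivable f x 1 -> is_derive x 1 f (derive1 f x).
Proof. by move=> fx; apply: DeriveDef => //; rewrite derive1E. Qed.

(** A smooth function of the squared position satisfies the boundary condition at 0: its
    derivative is of order x, and x^(delta - 1) x tends to 0 since delta > 0. *)
Lemma bessel_generator_sqr delta mu (q q1 q2 G : R -> R) : 0 < delta -> 0 <= mu ->
  (forall z : R, 0 <= z -> {for z, continuous q}) ->
  (forall z : R, 0 <= z -> {for z, continuous G}) ->
  (exists K : R, forall z, K <= z -> q z = 0) ->
  (forall z : R, 0 < z -> is_derive z 1 q (q1 z)) ->
  (forall z : R, 0 < z -> is_derive z 1 q1 (q2 z)) ->
  (exists B : R, forall z, 0 < z -> z < 1 -> `|q1 z| <= B) ->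
  (forall z : R, 0 < z -> G z = 2 * z * q2 z + delta * q1 z +
     4 * z * (sqh1 delta mu z / sq_bessel_h delta mu z) * q1 z) ->
  bessel_generator delta mu (fun y => q (y ^+ 2)) (fun y => G (y ^+ 2)).
Proof.
move=> d0 mu0 cq cG [K qK] dq dq1 [B q1B] GE.
have csqr (f : R -> R) : (forall z : R, 0 <= z -> {for z, continuous f}) ->
    continuous (fun y => f (y ^+ 2)).
  move=> cf y; apply: (@continuous_comp _ _ _ (fun y => y ^+ 2) f).
    exact: exprn_continuous.
  by apply: cf; exact: sqr_ge0.
have d1 x : 0 < x -> is_derive x 1 (fun y => q (y ^+ 2)) (q1 (x ^+ 2) * (2 * x)).
  by move=> x0; apply: der_of_sqr; apply: dq; rewrite exprn_gt0.
have d1E x : 0 < x -> derive1 (fun y => q (y ^+ 2)) x = q1 (x ^+ 2) * (2 * x).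
  by move=> x0; exact: der_derive1 (d1 _ x0).
have d2 x : 0 < x -> is_derive x 1 (derive1 (fun y => q (y ^+ 2)))
    (q2 (x ^+ 2) * (2 * x) * (2 * x) + q1 (x ^+ 2) * 2).
  move=> x0; have x20 : 0 < x ^+ 2 by rewrite exprn_gt0.
  apply: der_near (derM (der_of_sqr (dq1 _ x20)) (der_linear 2 x)).
  by near=> y; rewrite d1E//; near: y; exact: near_gt0.
split.
- by split; exact: csqr.
- exists (Num.max 1 K) => x; rewrite ge_max => /andP[x1 Kx]; apply: qK.
  by rewrite (le_trans Kx)// ler_eXnr.
- by move=> x x0; split; [have [] := d1 _ x0|have [] := d2 _ x0].
- move=> x x0; have x20 : 0 < x ^+ 2 by rewrite exprn_gt0.
  rewrite GE// (der_derive1 (d2 _ x0)) d1E// bessel_driftE//.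
  field; rewrite (gt_eqF x0)/=.
  by rewrite gt_eqF// sq_bessel_h_gt0// ltW.
- apply: (@cvg_trans _ ((2 * x `^ delta) * q1 (x ^+ 2) @[x --> 0^'+])).
    apply: near_eq_cvg; near=> x.
    have x0 : 0 < x by near: x; exact: nbhs_right_gt.
    by rewrite d1E// -(mulr_powRB1 (ltW x0) d0); ring.
  apply/norm_cvg0P.
  apply: (@squeeze_cvgr _ _ _ _ (cst 0) (fun x => 2 * x `^ delta * B)).
  + near=> x; have x0 : 0 < x by near: x; exact: nbhs_right_gt.
    have x1 : x < 1 by near: x; exact: nbhs_right_lt.
    rewrite normr_ge0/= normrM ger0_norm ?mulr_ge0 ?powR_ge0//.
    by rewrite ler_wpM2l ?mulr_ge0 ?powR_ge0// q1B ?exprn_gt0// expr_lt1// ltW.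
  + exact: cvg_cst.
  + apply: cvg_toE.
      by apply: cvgM; [apply: cvgM; [exact: cvg_cst|exact: powR_cvg0]|exact: cvg_cst].
    by rewrite mulr0 mul0r.
Unshelve. all: by end_near. Qed.

(** Doob transform: as L h = (mu^2 / 2) h for the drift-free operator L, the operator with drift
    is f |-> (L (f h) - (mu^2 / 2) f h) / h. *)
Lemma bessel_generator_div delta mu (F F1 F2 : R -> R) : 0 < delta -> 0 <= mu ->
  continuous F -> continuous F1 -> continuous F2 ->
  (exists K : R, forall z, K <= z -> F z = 0) ->
  (forall z : R, is_derive z 1 F (F1 z)) ->
  (forall z : R, is_derive z 1 F1 (F2 z)) ->
  bessel_generator delta mu
    (fun y => F (y ^+ 2) / sq_bessel_h delta mu (y ^+ 2))
    (fun y => (2 * y ^+ 2 * F2 (y ^+ 2) + delta * F1 (y ^+ 2)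
       - mu ^+ 2 / 2 * F (y ^+ 2)) / sq_bessel_h delta mu (y ^+ 2)).
Proof.
move=> d0 mu0 cF cF1 cF2 [K FK] dF dF1.
set k := sq_bessel_h delta mu.
have kn0 z : 0 <= z -> k z != 0 by move=> z0; rewrite gt_eqF// sq_bessel_h_gt0.
have ck z : {for z, continuous k} by exact: sq_bessel_h_continuous.
have ckV z : 0 <= z -> {for z, continuous (fun z => (k z)^-1)}.
  by move=> z0; apply: cvgV; [exact: kn0|exact: ck].
pose q z := F z / k z.
pose q1 z := F1 z / k z - F z * sqh1 delta mu z / k z ^+ 2.
have ck1 z : {for z, continuous (sqh1 delta mu)} by exact: der_continuous (der_sqh1 mu z d0).
have cq1 z : 0 <= z -> {for z, continuous q1}.
  move=> z0; apply: cvgB; first by apply: cvgM; [exact: cF1|exact: ckV].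
  apply: cvgM; first by apply: cvgM; [exact: cF|exact: ck1].
  apply: cvgV; first by rewrite expf_neq0// kn0.
  by apply: (@cvg_comp _ _ _ k (fun x => x ^+ 2) _ _ _ (ck z)); exact: exprn_continuous.
apply: (@bessel_generator_sqr delta mu q q1 (fun z =>
    F2 z / k z - 2 * F1 z * sqh1 delta mu z / k z ^+ 2
    - F z * sqh2 delta mu z / k z ^+ 2 + 2 * F z * sqh1 delta mu z ^+ 2 / k z ^+ 3)
  (fun z => (2 * z * F2 z + delta * F1 z - mu ^+ 2 / 2 * F z) / k z)) => //.
- by move=> z z0; apply: cvgM; [exact: cF|exact: ckV].
- move=> z z0; apply: cvgM; last exact: ckV.
  apply: cvgB; last by apply: cvgM; [exact: cvg_cst|exact: cF].
  apply: cvgD; last by apply: cvgM; [exact: cvg_cst|exact: cF1].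
  by apply: cvgM; [apply: cvgM; [exact: cvg_cst|exact: cvg_id]|exact: cF2].
- by exists K => z /FK Fz; rewrite /q Fz mul0r.
- move=> z z0; apply: (der_eq (derM (dF z) (derV (der_sq_bessel_h mu z d0) (kn0 _ (ltW z0))))).
  by rewrite /q1 -/k; field; rewrite kn0// ltW.
- move=> z z0; have kz := kn0 _ (ltW z0).
  have dk := der_sq_bessel_h mu z d0.
  have kz2 : k z ^+ 2 != 0 by rewrite expf_neq0.
  apply: (der_eq (derB (derM (dF1 z) (derV dk kz))
     (derM (derM (dF z) (der_sqh1 mu z d0)) (derV (derX 1 dk) kz2)))).
  by rewrite -/k; field.
- have c1 : {within `[0, 1], continuous q1}.
    apply/subspace_continuousP => z; rewrite /= in_itv/= => /andP[z0 _].
    by apply: cvg_within_filter; exact: cq1.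
  have := @continuous_compact _ _ q1 _ c1 (@segment_compact _ 0 1).
  move=> /compact_bounded [M [_ HM]].
  exists (M + 1) => z z0 z1; apply: (HM (M + 1)); first by rewrite ltrDl.
  by exists z => //=; rewrite in_itv/= !ltW.
- move=> z z0; have kz := kn0 _ (ltW z0).
  have ode := sq_bessel_h_ode mu z d0.
  have {}ode : mu ^+ 2 / 2 = (2 * z * sqh2 delta mu z + delta * sqh1 delta mu z) / k z.
    by rewrite ode mulfK.
  by rewrite /= ode /q1 -/k; field.
Qed.

(** The inverse transform. Here f is only known to be regular away from 0, and its boundary
    condition is inherited because h is smooth and h(0) = 1. *)
Lemma bessel_generator_mul delta mu (f g : R -> R) : 0 < delta -> 0 <= mu ->
  bessel_generator delta mu f g ->
  bessel_generator delta 0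
    (fun y => f y * sq_bessel_h delta mu (y ^+ 2))
    (fun y => (g y + mu ^+ 2 / 2 * f y) * sq_bessel_h delta mu (y ^+ 2)).
Proof.
move=> d0 mu0 [[cf cg] [K fK] df gE f0].
pose k := sq_bessel_h delta mu.
pose h y := k (y ^+ 2).
have dh x : is_derive x 1 h (sqh1 delta mu (x ^+ 2) * (2 * x)).
  exact: der_of_sqr (der_sq_bessel_h mu (x ^+ 2) d0).
have dh1 x : is_derive x 1 (fun x => sqh1 delta mu (x ^+ 2) * (2 * x))
    (sqh2 delta mu (x ^+ 2) * (2 * x) * (2 * x) + sqh1 delta mu (x ^+ 2) * 2).
  exact: derM (der_of_sqr (der_sqh1 mu (x ^+ 2) d0)) (der_linear 2 x).
have ch : continuous h by move=> x; exact: der_continuous (dh x).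
have df1 x : 0 < x -> is_derive x 1 f (derive1 f x).
  by move=> /df[fx _]; exact: derivable_der.
have df2 x : 0 < x -> is_derive x 1 (derive1 f) (derive1 (derive1 f) x).
  by move=> /df[_ fx]; exact: derivable_der.
have dfh x : 0 < x -> is_derive x 1 (fun y => f y * h y)
    (derive1 f x * h x + f x * (sqh1 delta mu (x ^+ 2) * (2 * x))).
  by move=> x0; exact: derM (df1 _ x0) (dh x).
have dfhE x : 0 < x -> derive1 (fun y => f y * h y) x =
    derive1 f x * h x + f x * (sqh1 delta mu (x ^+ 2) * (2 * x)).
  by move=> x0; exact: der_derive1 (dfh _ x0).
have dfh2 x : 0 < x -> is_derive x 1 (derive1 (fun y => f y * h y))
    ((derive1 (derive1 f) x * h x + derive1 f x * (sqh1 delta mu (x ^+ 2) * (2 * x))) +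
     (derive1 f x * (sqh1 delta mu (x ^+ 2) * (2 * x)) +
      f x * (sqh2 delta mu (x ^+ 2) * (2 * x) * (2 * x) + sqh1 delta mu (x ^+ 2) * 2))).
  move=> x0; apply: der_near (derD (derM (df2 _ x0) (dh x)) (derM (df1 _ x0) (dh1 x))).
  by near=> y; rewrite dfhE//; near: y; exact: near_gt0.
split.
- split=> x; apply: cvgM; [exact: cf|exact: ch| |exact: ch].
  by apply: cvgD; [exact: cg|apply: cvgM; [exact: cvg_cst|exact: cf]].
- by exists K => x /fK ->; rewrite mul0r.
- by move=> x x0; split; [have [] := dfh _ x0|have [] := dfh2 _ x0].
- move=> x x0; rewrite gE// (der_derive1 (dfh2 _ x0)) dfhE//.
  rewrite bessel_driftE// [bessel_drift _ _ _]bessel_driftE//.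
  have x20 : 0 <= x ^+ 2 by rewrite sqr_ge0.
  have kz : k (x ^+ 2) != 0 by rewrite gt_eqF// sq_bessel_h_gt0.
  have s0 : sqh1 delta 0 (x ^+ 2) = 0 by rewrite /sqh1 expr0n/= !mul0r mulr0.
  have ode := sq_bessel_h_ode mu (x ^+ 2) d0.
  rewrite mulrDl -[X in _ + X]mulrA [f x * _]mulrC [_ / 2 * _]mulrA -ode s0 sq_bessel_h_nodrift.
  rewrite /h -/k.
  by field; rewrite (gt_eqF x0).
- apply: (@cvg_trans _ ((x `^ (delta - 1) * derive1 f x * h x +
      x `^ delta * (f x * (sqh1 delta mu (x ^+ 2) * 2))) @[x --> 0^'+])).
    apply: near_eq_cvg; near=> x.
    have x0 : 0 < x by near: x; exact: nbhs_right_gt.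
    by rewrite dfhE// -(mulr_powRB1 (ltW x0) d0); ring.
  apply: cvg_toE.
    apply: cvgD.
      by apply: cvgM; [exact: f0|apply: cvg_at_right_filter; exact: ch].
    apply: cvgM; first exact: powR_cvg0.
    apply: cvg_at_right_filter; apply: cvgM; first exact: cf.
    apply: cvgM; last exact: cvg_cst.
    exact: der_continuous (der_of_sqr (der_sqh1 mu (0 ^+ 2) d0)).
  by rewrite !mul0r addr0.
Unshelve. all: by end_near. Qed.

End doob_transform.

(** * Exponentials truncated to compact support *)

Section truncated_exponentials.
Context {R : realType}.
Implicit Types (delta mu lam eps z : R).

Lemma continuous_pospart : continuous (fun u : R => Num.max 0 u).
Proof.
by move=> u; apply: (@continuous_max _ _ (cst 0) id); [exact: cvg_cst|exact: cvg_id].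
Qed.

Lemma der_pospart n (u : R) :
  is_derive u 1 (fun u : R => Num.max 0 u ^+ n.+2) (n.+2%:R * Num.max 0 u ^+ n.+1).
Proof.
have [u0|u0|<-] := ltgtP 0 u.
- apply: (@der_near _ (fun v => v ^+ n.+2)).
    near=> v; rewrite max_r// ltW//; near: v; exact: lt_nbhsr.
  by apply: (der_eq (derX n.+1 (der_id u))); rewrite mulr1.
- apply: (@der_near _ (fun=> 0)).
    near=> v; rewrite max_l ?expr0n// ltW//; near: v; exact: lt_nbhsl.
  by apply: (der_eq (der_cst 0 u)); rewrite expr0n/= mulr0.
- apply/is_derive1_caratheodory; exists (fun u => Num.max 0 u ^+ n.+1); split.
  + move=> z; rewrite maxxx subr0 [0 ^+ _]expr0n/= subr0.
    by case: leP => _; [exact: exprSr|rewrite !expr0n/= mul0r].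
  + apply: (@continuous_comp _ _ _ (fun u : R => Num.max 0 u) (fun u => u ^+ n.+1)).
      exact: continuous_pospart.
    exact: exprn_continuous.
  + by rewrite maxxx !expr0n/= mulr0.
Unshelve. all: by end_near. Qed.

Let r eps z := Num.max 0 (1 - eps * z).

(** The generator only contains functions with compact support: the exponential is multiplied
    by the cube of (1 - eps z)^+, which is twice continuously differentiable. *)
Definition trunc_exp lam eps z := expR (- (lam * z)) * r eps z ^+ 3.
Definition trunc_exp1 lam eps z := expR (- (lam * z)) *
  (- lam * r eps z ^+ 3 - 3 * eps * r eps z ^+ 2).
Definition trunc_exp2 lam eps z := expR (- (lam * z)) *
  (lam ^+ 2 * r eps z ^+ 3 + 6 * lam * eps * r eps z ^+ 2 + 6 * eps ^+ 2 * r eps z).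

Let der_affine eps z : is_derive z 1 (fun z => 1 - eps * z) (- eps).
Proof. by apply: (der_eq (derB (der_cst 1 z) (der_linear eps z))); rewrite sub0r. Qed.

Let der_r n eps z : is_derive z 1 (fun z => r eps z ^+ n.+2)
  (n.+2%:R * r eps z ^+ n.+1 * - eps).
Proof.
exact: (der_comp (f := fun z => 1 - eps * z) (der_pospart n _) (der_affine eps z)).
Qed.

Lemma der_expM lam z : is_derive z 1 (fun z => expR (- (lam * z)))
  (expR (- (lam * z)) * - lam).
Proof. exact: der_expR (derN (der_linear lam z)). Qed.

Lemma der_trunc_exp lam eps z :
  is_derive z 1 (trunc_exp lam eps) (trunc_exp1 lam eps z).
Proof.
apply: (der_eq (derM (der_expM lam z) (der_r 1 eps z))).
by rewrite /trunc_exp1; ring.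
Qed.

Lemma der_trunc_exp1 lam eps z :
  is_derive z 1 (trunc_exp1 lam eps) (trunc_exp2 lam eps z).
Proof.
apply: (der_eq (derM (der_expM lam z)
  (derB (derM (der_cst (- lam) z) (der_r 1 eps z))
        (derM (der_cst (3 * eps) z) (der_r 0 eps z))))).
by rewrite /trunc_exp2 expr1; ring.
Qed.

Let continuous_r eps : continuous (r eps).
Proof.
move=> z; apply: (@continuous_comp _ _ _ (fun z => 1 - eps * z) (fun u : R => Num.max 0 u)).
  exact: der_continuous (der_affine eps z).
exact: continuous_pospart.
Qed.

Lemma continuous_trunc_exp2 lam eps : continuous (trunc_exp2 lam eps).
Proof.
move=> z; apply: cvgM; first exact: der_continuous (der_expM lam z).
have cX n : (r eps y ^+ n.+2) @[y --> z] --> r eps z ^+ n.+2.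
  exact: der_continuous (der_r n eps z).
apply: cvgD; last by apply: cvgM; [exact: cvg_cst|exact: continuous_r].
by apply: cvgD; (apply: cvgM; [exact: cvg_cst|exact: cX]).
Qed.

Let r01 eps z : 0 <= eps -> 0 <= z -> 0 <= r eps z <= 1.
Proof.
move=> e0 z0; rewrite /r le_max lexx/= ge_max ler01/=.
by rewrite gerBl mulr_ge0.
Qed.

Lemma mul_expN_le lam z : 0 < lam -> 0 <= z -> z * expR (- (lam * z)) <= lam^-1.
Proof.
move=> l0 z0; rewrite expRN ler_pdivrMr ?expR_gt0//.
rewrite -(ler_pM2l l0) mulrA divff ?mul1r ?gt_eqF//.
by rewrite (le_trans _ (expR_ge1Dx _))// lerDr.
Qed.

(** Image of exp(- lam z) under 2 z d^2/dz^2 + delta d/dz - mu^2 / 2, the drift-free operator in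
    the variable z = x^2, shifted by mu^2 / 2. *)
Definition gen_exp delta mu lam z :=
  (2 * lam ^+ 2 * z - delta * lam - mu ^+ 2 / 2) * expR (- (lam * z)).

Definition gen_trunc_exp delta mu lam eps z :=
  2 * z * trunc_exp2 lam eps z + delta * trunc_exp1 lam eps z
  - mu ^+ 2 / 2 * trunc_exp lam eps z.

Lemma trunc_exp_bound lam eps z : 0 < lam -> 0 <= eps -> 0 <= z ->
  0 <= trunc_exp lam eps z <= 1.
Proof.
move=> l0 e0 z0; have /andP[r0 r1] := r01 e0 z0.
rewrite mulr_ge0 ?expR_ge0 ?exprn_ge0//= mulr_ile1 ?expR_ge0 ?exprn_ge0//.
  by rewrite expR_le1 oppr_le0 mulr_ge0// ltW.
by rewrite exprn_ile1.
Qed.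

(** The factor z in front of the second derivative is absorbed by the exponential, so that the
    bound is uniform in eps: it allows dominated convergence as eps tends to 0. *)
Lemma gen_trunc_exp_bound delta mu lam eps z : 0 <= delta -> 0 < lam ->
  0 <= eps <= 1 -> 0 <= z ->
  `|gen_trunc_exp delta mu lam eps z| <=
  2 * (lam ^+ 2 + 6 * lam + 6) / lam + delta * (lam + 3) + mu ^+ 2 / 2.
Proof.
move=> d0 l0 /andP[e0 e1] z0; have /andP[r0 r1] := r01 e0 z0.
have ex0 := expR_ge0 (- (lam * z)).
have ex1 : expR (- (lam * z)) <= 1 by rewrite expR_le1 oppr_le0 mulr_ge0// ltW.
have ez := mul_expN_le l0 z0.
have r2 : 0 <= r eps z ^+ 2 <= 1 by rewrite exprn_ge0//= exprn_ile1.
have r3 : 0 <= r eps z ^+ 3 <= 1 by rewrite exprn_ge0//= exprn_ile1.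
have er : 0 <= eps * r eps z <= 1 by rewrite mulr_ge0//= mulr_ile1.
have er2 : 0 <= eps * r eps z ^+ 2 <= 1.
  by case/andP: r2 => a b; rewrite mulr_ge0//= mulr_ile1.
have eer : 0 <= eps ^+ 2 * r eps z <= 1.
  by rewrite mulr_ge0 ?exprn_ge0//= mulr_ile1 ?exprn_ge0// exprn_ile1.
have m2 : 0 <= mu ^+ 2 / 2 by rewrite divr_ge0 ?sqr_ge0.
have tb := trunc_exp_bound l0 e0 z0.
rewrite /gen_trunc_exp (le_trans (ler_normB _ _))// lerD//; last first.
  case/andP: tb => t0 t1.
  by rewrite (ger0_norm (mulr_ge0 m2 t0)) ler_piMr.
rewrite (le_trans (ler_normD _ _))// lerD//.
  rewrite (_ : 2 * z * trunc_exp2 lam eps z = (z * expR (- (lam * z))) * (2 *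
    (lam ^+ 2 * r eps z ^+ 3 + 6 * lam * (eps * r eps z ^+ 2) + 6 * (eps ^+ 2 * r eps z)))); last by rewrite /trunc_exp2; ring.
  move: r3 er2 eer => /andP[a0 a1] /andP[b0 b1] /andP[c0 c1].
  have h0 : 0 <= lam ^+ 2 * r eps z ^+ 3 + 6 * lam * (eps * r eps z ^+ 2) + 6 * (eps ^+ 2 * r eps z).
    by rewrite !addr_ge0// ?mulr_ge0// ?exprn_ge0// ltW.
  rewrite ger0_norm ?mulr_ge0// [leRHS]mulrC ler_pM ?mulr_ge0//.
  rewrite ler_pM2l// lerD// ?lerD//.
  - by rewrite ler_piMr// exprn_ge0// ltW.
  - by rewrite ler_piMr// mulr_ge0// ltW.
  - by rewrite ler_piMr.
rewrite normrM (ger0_norm d0) ler_wpM2l// /trunc_exp1 normrM (ger0_norm ex0).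
rewrite (le_trans (ler_piMl (normr_ge0 _) ex1))// (le_trans (ler_normB _ _))//.
case/andP: r3 => a0 a1; case/andP: er2 => b0 b1.
have t3 : 0 <= 3 :> R by [].
rewrite mulNr normrN -mulrA (ger0_norm (mulr_ge0 (ltW l0) a0)) (ger0_norm (mulr_ge0 t3 b0)).
by rewrite lerD// ler_piMr// ltW.
Qed.

Lemma cvg_gen_trunc_exp delta mu lam z :
  gen_trunc_exp delta mu lam n.+1%:R^-1 z @[n --> \oo] --> gen_exp delta mu lam z
  /\ trunc_exp lam n.+1%:R^-1 z @[n --> \oo] --> expR (- (lam * z)).
Proof.
have e0 : n.+1%:R^-1 @[n --> \oo] --> (0 : R) by exact: cvg_harmonic.
have e2 : n.+1%:R^-1 ^+ 2 @[n --> \oo] --> (0 : R).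
  under eq_fun do rewrite expr2.
  exact: cvg_toE (cvgM e0 e0) (mulr0 0).
have rc : r n.+1%:R^-1 z @[n --> \oo] --> (1 : R).
  have /continuous_cvg cp : {for (1 - 0 * z), continuous (fun u : R => Num.max 0 u)}.
    exact: continuous_pospart.
  apply: cvg_toE; first apply: cp.
    by apply: cvgB; [exact: cvg_cst|apply: cvgM; [exact: e0|exact: cvg_cst]].
  by rewrite mul0r subr0 max_r.
have rX k : r n.+1%:R^-1 z ^+ k @[n --> \oo] --> (1 : R).
  elim: k => [|k ih]; first by under eq_fun do rewrite expr0; exact: cvg_cst.
  under eq_fun do rewrite exprS.
  by apply: cvg_toE; [exact: cvgM rc ih|rewrite mulr1].
have c0 : trunc_exp lam n.+1%:R^-1 z @[n --> \oo] --> expR (- (lam * z)).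
  by apply: cvg_toE; [apply: cvgM; [exact: cvg_cst|exact: rX]|rewrite mulr1].
split => //; apply: cvg_toE.
  apply: cvgB; last by apply: cvgM; [exact: cvg_cst|exact: c0].
  apply: cvgD.
    apply: cvgM; first exact: cvg_cst.
    apply: cvgM; first exact: cvg_cst.
    apply: cvgD; last first.
      apply: cvgM rc; apply: cvgM; first exact: cvg_cst.
      exact: e2.
    apply: cvgD; first by apply: cvgM; [exact: cvg_cst|exact: rX].
    by apply: cvgM; [apply: cvgM; [exact: cvg_cst|exact: e0]|exact: rX].
  apply: cvgM; first exact: cvg_cst.
  apply: cvgM; first exact: cvg_cst.
  apply: cvgB; first by apply: cvgM; [exact: cvg_cst|exact: rX].
  by apply: cvgM; [apply: cvgM; [exact: cvg_cst|exact: e0]|exact: rX].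
by rewrite /gen_exp; ring.
Qed.

Lemma bessel_generator_trunc delta mu lam eps : 0 < delta -> 0 <= mu -> 0 < eps ->
  bessel_generator delta mu
    (fun y => trunc_exp lam eps (y ^+ 2) / sq_bessel_h delta mu (y ^+ 2))
    (fun y => gen_trunc_exp delta mu lam eps (y ^+ 2) / sq_bessel_h delta mu (y ^+ 2)).
Proof.
move=> d0 mu0 e0; rewrite /gen_trunc_exp.
have c0 : continuous (trunc_exp lam eps).
  by move=> z; exact: der_continuous (der_trunc_exp lam eps z).
have c1 : continuous (trunc_exp1 lam eps).
  by move=> z; exact: der_continuous (der_trunc_exp1 lam eps z).
have K0 : exists K : R, forall z, K <= z -> trunc_exp lam eps z = 0.
  exists eps^-1 => z ez; rewrite /trunc_exp /r max_l ?expr0n ?mulr0//.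
  by rewrite subr_le0 -(mulfV (lt0r_neq0 e0)) ler_pM2l.
have H := bessel_generator_div d0 mu0 c0 c1 (@continuous_trunc_exp2 lam eps) K0.
have H1 := H (der_trunc_exp lam eps).
have H2 := H1 (der_trunc_exp1 lam eps).
exact H2.
Qed.

End truncated_exponentials.

(** * Integration of bounded functions *)

Section bounded_integration.
Context {R : realType}.

Lemma bounded_on (T : Type) (D : set T) (f : T -> R) (M : R) :
  (forall x, D x -> `|f x| <= M) -> [bounded f x | x in D].
Proof.
move=> fM; exists M; split; first exact: num_real.
by move=> K MK x Dx /=; rewrite (le_trans (fM _ Dx))// ltW.
Qed.

Lemma bounded_integrable d (T : measurableType d) (m : {measure set T -> \bar R})
    (D : set T) (f : T -> R) (M : R) :
  measurable D -> (m D < +oo)%E -> measurable_fun D f ->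
  (forall x, D x -> `|f x| <= M) -> m.-integrable D (EFin \o f).
Proof.
by move=> mD mfin mf fM; apply: measurable_bounded_integrable => //; exact: bounded_on fM.
Qed.

Lemma integrable_boundedM d (T : measurableType d) (m : {measure set T -> \bar R})
    (D : set T) (h f : T -> R) (M : R) :
  measurable D -> measurable_fun D h -> (forall x, D x -> `|h x| <= M) ->
  m.-integrable D (EFin \o f) -> m.-integrable D (EFin \o (fun x => h x * f x)).
Proof.
move=> mD mh hM fi; rewrite (_ : _ \o _ = ((EFin \o h) \* (EFin \o f))%E)//.
by apply: integrableMr => //; exact: bounded_on hM.
Qed.

Lemma integrableRD d (T : measurableType d) (m : {measure set T -> \bar R})
    (D : set T) (f g : T -> R) : measurable D ->
  m.-integrable D (EFin \o f) -> m.-integrable D (EFin \o g) ->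
  m.-integrable D (EFin \o (fun x => f x + g x)).
Proof. by move=> mD fi gi; have := integrableD mD fi gi. Qed.

Lemma integrableRM d (T : measurableType d) (m : {measure set T -> \bar R})
    (D : set T) (c : R) (f : T -> R) : measurable D ->
  m.-integrable D (EFin \o f) -> m.-integrable D (EFin \o (fun x => c * f x)).
Proof.
by move=> mD fi; exact: (@integrable_boundedM _ _ _ _ (cst c) _ `|c|).
Qed.

Lemma integrableRB d (T : measurableType d) (m : {measure set T -> \bar R})
    (D : set T) (f g : T -> R) : measurable D ->
  m.-integrable D (EFin \o f) -> m.-integrable D (EFin \o g) ->
  m.-integrable D (EFin \o (fun x => f x - g x)).
Proof. by move=> mD fi gi; have := integrableB mD fi gi. Qed.

Lemma dominated_cvg_Rintegral d (T : measurableType d) (m : {measure set T -> \bar R})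
    (D : set T) (f_ : nat -> T -> R) (f g : T -> R) :
  measurable D -> (forall n, measurable_fun D (f_ n)) ->
  m.-integrable D (EFin \o g) ->
  (forall n x, D x -> `|f_ n x| <= g x) ->
  (forall x, D x -> f_ n x @[n --> \oo] --> f x) ->
  \int[m]_(x in D) f_ n x @[n --> \oo] --> \int[m]_(x in D) f x.
Proof.
move=> mD mf ig fg cf.
have mlim : measurable_fun D f by exact: measurable_fun_cvg cf.
have fg' x : D x -> `|f x| <= g x.
  move=> Dx; have c : `|f_ n x| @[n --> \oo] --> `|f x| by apply: cvg_norm; exact: cf.
  by rewrite -(cvg_lim (@Rhausdorff R) c); apply: limr_le;
    [exact: cvgP c|apply: nearW => n; exact: fg].
apply: fine_cvg; rewrite fineK; last first.
  apply: integrable_fin_num => //; apply: le_integrable ig => //.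
    exact/measurable_EFinP.
  by move=> x Dx /=; rewrite lee_fin (le_trans (fg' _ Dx))// ler_norm.
apply: (@dominated_cvg _ _ _ _ _ _ (fun n => EFin \o f_ n) (EFin \o f) (EFin \o g)) => //.
- by move=> n; exact/measurable_EFinP.
- by move=> x Dx; apply: cvg_EFin; [exact: nearW|exact: cf].
Qed.

Lemma bounded_cvg_Rintegral d (T : measurableType d) (m : {measure set T -> \bar R})
    (D : set T) (f_ : nat -> T -> R) (f : T -> R) (M : R) :
  measurable D -> (m D < +oo)%E -> (forall n, measurable_fun D (f_ n)) ->
  (forall n x, D x -> `|f_ n x| <= M) ->
  (forall x, D x -> f_ n x @[n --> \oo] --> f x) ->
  \int[m]_(x in D) f_ n x @[n --> \oo] --> \int[m]_(x in D) f x.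
Proof.
move=> mD mfin mf fM cf; apply: (@dominated_cvg_Rintegral _ _ _ _ _ _ (cst M)) => //.
exact: (@bounded_integrable _ _ _ _ (cst M) `|M|).
Qed.

(** The number of the levels k + 1 lying below z, out of enough levels. *)
Lemma sum_nat_le (z : R) n : 0 <= z -> z <= n%:R ->
  (\sum_(k < n) ((k.+1%:R <= z)%R : nat))%N = Num.truncn z.
Proof.
move=> z0 zn; have tn : (Num.truncn z <= n)%N.
  by rewrite -(ler_nat R) (le_trans _ zn)//; have /andP[] := truncn_itv z0.
transitivity (\sum_(k < n) (k < Num.truncn z : nat))%N.
  by apply: eq_bigr => k _; rewrite truncn_ge_nat.
move: (Num.truncn z) tn => m mn; rewrite -(big_mkord xpredT (fun k => (k < m : nat)))%N.
rewrite (@big_cat_nat _ _ _ m)//=.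
have -> : (\sum_(0 <= k < m) (k < m : nat) = m)%N.
  rewrite (eq_big_nat _ _ (F2 := fun=> 1%N)); first by rewrite sum_nat_const_nat subn0 muln1.
  by move=> k /andP[_ ->].
have -> : (\sum_(m <= k < n) (k < m : nat) = 0)%N.
  by rewrite big_nat big1// => k /andP[mk _]; rewrite ltnNge mk.
by rewrite addn0.
Qed.

(** A function whose integral vanishes over every set of a sub-sigma-algebra is
    orthogonal to every bounded function measurable for it: layer-cake sums
    approximate the bounded function uniformly. *)
Lemma bounded_multiplier d d' (T : measurableType d) (T' : measurableType d')
    (P : probability T R) (phi : T -> T') (D : T -> R) (xi : T' -> R) (M : R) :
  measurable_fun setT phi -> P.-integrable setT (EFin \o D) ->
  (forall A, measurable A -> \int[P]_(w in phi @^-1` A) D w = 0) ->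
  measurable_fun setT xi -> (forall x, `|xi x| <= M) ->
  \int[P]_w (xi (phi w) * D w) = 0.
Proof.
move=> mphi iD D0 mxi xiM.
pose K : R := `|M| + 1; have K0 : 0 < K by rewrite ltr_wpDl.
have xiK x : `|xi x| <= K by rewrite (le_trans (xiM x))// (le_trans (ler_norm _))// lerDl.
pose y x := (xi x + K) / (2 * K).
have y01 x : 0 <= y x <= 1.
  have := xiK x; rewrite ler_norml => /andP[a b].
  rewrite /y divr_ge0 ?mulr_ge0 ?(ltW K0)//=; last by rewrite -lerBlDr sub0r.
  rewrite ler_pdivrMr ?mulr_gt0// mul1r; lra.
have my : measurable_fun setT y.
  by apply: measurable_funM => //; apply: measurable_funD.
pose A (n k : nat) := [set x | k.+1%:R <= n.+1%:R * y x].
have mA n k : measurable (A n k).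
  rewrite [A n k](_ : _ = [set: T'] `&` [set x | (k.+1%:R : R) <= n.+1%:R * y x]); last first.
    by rewrite setTI.
  apply: (@measurable_fun_ler _ _ _ _ (cst k.+1%:R) (fun x => n.+1%:R * y x)
     _ _ measurableT [set true]) => //.
  exact: measurable_funM.
pose b (n k : nat) x : R := \1_(A n k) x.
have mb n k : measurable_fun setT (b n k) by exact: measurable_indic.
have b1 n k x : `|b n k x| <= 1.
  by rewrite /b indicE; case: (_ \in _); rewrite ?normr1 ?normr0.
have ib n k : P.-integrable setT (EFin \o (fun w => b n k (phi w) * D w)).
  apply: (@integrable_boundedM _ _ _ _ (b n k \o phi) D 1) => //.
  - exact: measurableT_comp.
  - by move=> x _; exact: b1.
have b0 n k : \int[P]_w (b n k (phi w) * D w) = 0.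
  transitivity (\int[P]_(w in phi @^-1` A n k) D w); last exact: D0.
  rewrite [RHS]Rintegral_mkcond; apply: eq_Rintegral => w _.
  rewrite patchE /b indicE (_ : (w \in phi @^-1` A n k) = (phi w \in A n k)).
    by case: ifPn; rewrite ?mul1r ?mul0r.
  by apply/idP/idP; rewrite !inE.
have S0 n j : P.-integrable setT (EFin \o (fun w => (\sum_(k < j) b n k (phi w)) * D w)) /\
    \int[P]_w ((\sum_(k < j) b n k (phi w)) * D w) = 0.
  elim: j => [|j [ih1 ih2]].
    under eq_fun do rewrite big_ord0 mul0r.
    by split; [exact: integrable0|rewrite Rintegral_cst ?mul0r].
  have E : (fun w => (\sum_(k < j.+1) b n k (phi w)) * D w) =
     (fun w => (\sum_(k < j) b n k (phi w)) * D w + b n j (phi w) * D w).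
    by apply/funext => w; rewrite big_ord_recr/= mulrDl.
  rewrite E; split.
    exact: integrableRD.
  by rewrite RintegralD// ih2 b0 addr0.
pose s n x : R := n.+1%:R^-1 * \sum_(k < n.+1) b n k x.
have sE n x : s n x = n.+1%:R^-1 * (Num.truncn (n.+1%:R * y x))%:R.
  congr (_ * _); have /andP[y0 y1] := y01 x.
  have zn : n.+1%:R * y x <= n.+1%:R by rewrite ler_piMr.
  rewrite -(sum_nat_le (mulr_ge0 (ler0n R n.+1) y0) zn).
  rewrite natr_sum; apply: eq_bigr => k _; rewrite /b indicE; congr (_%:R).
  by congr nat_of_bool; apply/idP/idP; rewrite inE.
have sy n x : 0 <= y x - s n x <= n.+1%:R^-1.
  have /andP[y0 y1] := y01 x.
  have /andP[t0 t1] := truncn_itv (mulr_ge0 (ler0n R n.+1) y0).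
  rewrite sE subr_ge0 ler_pdivrMl// t0/= lerBlDr -[X in X + _]mulr1 -mulrDr.
  by rewrite ler_pdivlMl// addrC natr1 ltW.
have cs x : s n x @[n --> \oo] --> y x.
  apply: cvg_zero; apply/norm_cvg0P.
  apply: (@squeeze_cvgr _ _ _ _ (cst 0) (fun n => n.+1%:R^-1)).
  - near=> n; rewrite normr_ge0/= distrC ger0_norm; first by case/andP: (sy n x).
    by case/andP: (sy n x).
  - exact: cvg_cst.
  - exact: cvg_harmonic.
have s01 n x : 0 <= s n x <= 1.
  have /andP[y0 y1] := y01 x; have /andP[h0 _] := sy n x.
  apply/andP; split; last by rewrite (le_trans _ y1)// -subr_ge0.
  by apply: mulr_ge0 => //; apply: sumr_ge0 => k _; rewrite /b indicE.
have c : \int[P]_w (s n (phi w) * D w) @[n --> \oo] --> \int[P]_w (y (phi w) * D w).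
  apply: (@dominated_cvg_Rintegral _ _ _ _ _ _ (fun w => `|D w|)) => //.
  - move=> n; apply: measurable_funM; last by have /integrableP[/measurable_EFinP] := iD.
    apply: measurableT_comp => //; apply: measurable_funM => //.
    exact: measurable_sum.
  - exact: integrable_norm.
  - move=> n w _; rewrite normrM ler_piMl//.
    by have /andP[h0 h1] := s01 n (phi w); rewrite ger0_norm.
  - by move=> w _; apply: cvgM; [exact: cs|exact: cvg_cst].
have y0 : \int[P]_w (y (phi w) * D w) = 0.
  rewrite -(cvg_lim (@Rhausdorff R) c); apply: lim_near_cst => //; apply: nearW => n.
  rewrite /s; under eq_Rintegral do rewrite -mulrA.
  by rewrite RintegralZl// ?(S0 n n.+1).2 ?mulr0//; exact: (S0 n n.+1).1.
have iy : P.-integrable setT (EFin \o (fun w => y (phi w) * D w)).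
  apply: (@integrable_boundedM _ _ _ _ (y \o phi) D 1) => //.
  - exact: measurableT_comp.
  by move=> x _ /=; have /andP[h0 h1] := y01 (phi x); rewrite ger0_norm.
have -> : (fun w => xi (phi w) * D w) = (fun w => 2 * K * (y (phi w) * D w) - K * D w).
  by apply/funext => w; rewrite /y; field; rewrite gt_eqF.
rewrite RintegralB//; last 2 first.
- exact: integrableRM.
- exact: integrableRM.
rewrite !RintegralZl// y0 mulr0 sub0r.
have := D0 setT measurableT; rewrite preimage_setT => ->.
by rewrite mulr0 oppr0.
Unshelve. all: by end_near. Qed.

Lemma measurable_expR_comp d (T : measurableType d) (f : T -> R) :
  measurable_fun setT f -> measurable_fun setT (fun x => expR (f x)).
Proof. by move=> mf; apply: (@measurableT_comp _ _ _ _ _ _ (@expR R)); first exact: measurable_expR. Qed.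

End bounded_integration.

(** * Continuous processes at random times *)

Section measurable_evaluation.
Context {R : realType}.

Lemma cvg_truncn_grid (r : R) : 0 <= r ->
  (Num.truncn (n.+1%:R * r))%:R / n.+1%:R @[n --> \oo] --> r.
Proof.
move=> r0; pose u n : R := (Num.truncn (n.+1%:R * r))%:R / n.+1%:R.
have u_le n : u n <= r /\ r <= u n + n.+1%:R^-1.
  have /andP[t0 t1] := truncn_itv (mulr_ge0 (ler0n R n.+1) r0).
  rewrite /u; split; first by rewrite ler_pdivrMr// [leRHS]mulrC.
  rewrite -[X in _ + X]mul1r -mulrDl ler_pdivlMr// [leLHS]mulrC natr1.
  exact: ltW.
apply: cvg_zero; apply/norm_cvg0P.
apply: (@squeeze_cvgr _ _ _ _ (cst 0) (fun n => n.+1%:R^-1)).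
- near=> n; have [a b] := u_le n.
  by rewrite normr_ge0/= distrC ger0_norm ?subr_ge0// lerBlDr addrC.
- exact: cvg_cst.
- exact: cvg_harmonic.
Unshelve. all: by end_near. Qed.

(** Continuity lets the random time u be replaced with its rounding to multiples of 1 / (n + 1),
    which takes countably many values. The set I of admissible times is a parameter because
    it is [0, t] for the filtration at time t. *)
Lemma measurable_eval d (T : measurableType d) (W : T -> R -> R) (u : T -> R) (I : set R) :
  (forall x, continuous (W x)) -> (forall r, I r -> measurable_fun setT (W ^~ r)) ->
  (forall x, I (u x) /\ 0 <= u x) -> (forall r s, I s -> 0 <= r -> r <= s -> I r) ->
  measurable_fun setT u -> measurable_fun setT (fun x => W x (u x)).
Proof.
move=> cW mW Iu Idown mu.
pose un n x : R := (Num.truncn (n.+1%:R * u x))%:R / n.+1%:R.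
have cun x : un n x @[n --> \oo] --> u x by apply: cvg_truncn_grid; exact: (Iu x).2.
apply: (@measurable_fun_cvg _ _ _ _ (fun n x => W x (un n x))); last first.
  move=> x _; have /continuous_cvg cp : {for (u x), continuous (W x)} by exact: cW.
  by apply: cp; exact: cun.
move=> n.
pose E k := [set x | Num.truncn (n.+1%:R * u x) = k].
have mnu : measurable_fun setT (fun x => n.+1%:R * u x) by exact: measurable_funM.
have mE k : measurable (E k).
  rewrite (_ : E k = ([set: T] `&` [set x | (k%:R : R) <= n.+1%:R * u x]) `&`
     ([set: T] `&` [set x | n.+1%:R * u x < k.+1%:R])).
    apply: measurableI.
      by apply: (@measurable_fun_ler _ _ _ _ (cst k%:R) _ _ _ measurableT [set true]).
    by apply: (@measurable_fun_ltr _ _ _ _ _ (cst k.+1%:R) _ _ measurableT [set true]).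
  apply/seteqP; split => x /=.
    move=> <-; have /andP[a b] := truncn_itv (mulr_ge0 (ler0n R n.+1) (Iu x).2).
    by split.
  by move=> [[_ a] [_ b]]; apply: truncn_def; rewrite a b.
have -> : [set: T] = \bigcup_k E k.
  by apply/seteqP; split => x // _; exists (Num.truncn (n.+1%:R * u x)).
apply/measurable_fun_bigcup => // k.
have [[x0 Ex0]|E0] := pselect (exists x, E k x); last first.
  have -> : E k = set0 by apply/seteqP; split => x // Ex; apply: E0; exists x.
  exact: measurable_fun_set0.
apply: (@eq_measurable_fun _ _ _ _ _ (W ^~ (k%:R / n.+1%:R))).
  by move=> x; rewrite inE => Ex; rewrite /un Ex.
apply: (@measurable_funS _ _ _ _ setT) => //; apply: mW.
have a : (k%:R : R) / n.+1%:R <= u x0.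
  have /andP[a _] := truncn_itv (mulr_ge0 (ler0n R n.+1) (Iu x0).2).
  by rewrite Ex0 in a; rewrite ler_pdivrMr// [leRHS]mulrC.
by apply: Idown (Iu x0).1 _ a; rewrite divr_ge0.
Qed.

Lemma Fubini_bounded d (T : measurableType d) (P : probability T R)
    (H : T -> R -> R) (s t M : R) :
  measurable_fun setT (fun z : T * R => H z.1 z.2) ->
  (forall w r, `|H w r| <= M) ->
  \int[P]_w \int[lebesgue_measure]_(r in `[s, t]) H w r =
  \int[lebesgue_measure]_(r in `[s, t]) \int[P]_w H w r.
Proof.
move=> mH HM.
have mI : measurable (`[s, t]%classic : set R) by [].
have fI : (lebesgue_measure (`[s, t]%classic : set R) < +oo)%E.
  by rewrite lebesgue_measure_itv/=; case: ifP => _; rewrite ?ltry// -EFinB ltry.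
pose h (z : T * R) : R := H z.1 z.2 * \1_(`[s, t]%classic) z.2.
have mh : measurable_fun setT h.
  apply: measurable_funM => //.
  exact: (@measurableT_comp _ _ _ _ _ _ (\1_`[s, t]%classic : R -> R) _ snd).
have mH1 w : measurable_fun setT (H w).
  exact: (@measurableT_comp _ _ _ _ _ _ (fun z : T * R => H z.1 z.2) _ (pair w)).
have mH2 r : measurable_fun setT (H ^~ r).
  exact: (@measurableT_comp _ _ _ _ _ _ (fun z : T * R => H z.1 z.2) _ (pair^~ r)).
have iH1 w : lebesgue_measure.-integrable `[s, t] (EFin \o H w).
  by apply: (@bounded_integrable _ _ _ _ _ _ M) => //; apply: (measurable_funS _ _ (mH1 w)).
have P1 : (P setT < +oo)%E by rewrite probability_setT ltry.
have iH2 r : P.-integrable setT (EFin \o H^~ r).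
  exact: (@bounded_integrable _ _ _ _ _ _ M).
have E1 w : (\int[lebesgue_measure]_r (h (w, r))%:E = (\int[lebesgue_measure]_(r in `[s, t]) H w r)%:E)%E.
  rewrite fineK; last by apply: integrable_fin_num; [exact: mI|exact: iH1].
  rewrite [RHS]integral_mkcond; apply: eq_integral => r _.
  by rewrite patchE /h/= indicE; case: ifPn => _; rewrite ?mulr1 ?mulr0.
have E2 r : (\int[P]_w (h (w, r))%:E = ((fun r => \int[P]_w H w r) \_ `[s, t] r)%:E)%E.
  rewrite patchE /h/= indicE; case: ifPn => _.
    under eq_integral do rewrite mulr1.
    by rewrite fineK//; apply: integrable_fin_num; [exact: measurableT|exact: iH2].
  by under eq_integral do rewrite mulr0; rewrite integral0.
have ih : (P \x lebesgue_measure)%E.-integrable setT (EFin \o h).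
  apply/integrable12ltyP; first exact/measurable_EFinP.
  apply: (@le_lt_trans _ _ (\int[P]_w (M * fine (lebesgue_measure (`[s, t]%classic : set R)))%:E)%E); last first.
    rewrite integral_cst; last exact: measurableT.
    by rewrite [X in (_ * X)%E](_ : _ = 1%E) ?mule1 ?ltry//; exact: probability_setT.
  apply: ge0_le_integral => //.
  - by move=> w _; exact: integral_ge0.
  - have mabs : measurable_fun setT (fun z : T * R => `|(h z)%:E|%E).
      by apply: measurableT_comp => //; exact/measurable_EFinP.
    have K := @measurable_fun_fubini_tonelli_F _ _ _ _ R lebesgue_measure
      (fun z => `|(h z)%:E|%E) mabs (fun z => abse_ge0 _).
    exact: K.
  - move=> w _; rewrite EFinM fineK ?ge0_fin_numE// -integral_cst//.
    rewrite [leRHS]integral_mkcond; apply: ge0_le_integral => //.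
    + by apply: measurableT_comp => //; apply/measurable_EFinP; exact: (measurableT_comp mh).
    + by apply/measurable_restrict => //.
    + move=> r _; rewrite patchE /h/= indicE; case: ifPn => _; rewrite ?mulr1 ?mulr0 ?normr0//.
      by rewrite lee_fin.
have := Fubini ih; rewrite /comp/=.
under eq_integral do rewrite E1.
under [X in _ = X]eq_integral do rewrite E2.
move=> F; rewrite /Rintegral F [in RHS]integral_mkcond.
by congr fine; apply: eq_integral => r _; rewrite !patchE; case: ifP.
Qed.

End measurable_evaluation.

(** * Filtered path space *)

Section path_filtration.
Context {R : realType}.
Implicit Types (w : cpath R) (r s t : R).

(** Freezing a path at its initial value for negative times makes it continuous on the whole
    line. *)
Definition pval w r := w (Num.max 0 r).

Lemma pvalE w r : 0 <= r -> pval w r = w r.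
Proof. by move=> r0; rewrite /pval max_r. Qed.

Lemma continuous_pval w : continuous (pval w).
Proof.
have /subspace_continuousP cw := @cpath_continuous R w => t.
have u0 r : `[0, +oo[%classic (Num.max 0 r) by rewrite /= in_itv/= andbT le_max lexx.
have cm : {for t, continuous (fun r : R => Num.max 0 r)} by exact: continuous_pospart.
move=> B /(cw _ (u0 t)) /cm H.
suff : nbhs t (fun r : R => `[0, +oo[%classic (Num.max 0 r) -> B (w (Num.max 0 r))).
  by apply: filterS => r; apply; exact: u0.
exact: H.
Qed.

(** The path space with the events up to time t as its measurable sets: functionals known at
    time t are the measurable functions on this type. *)
Definition filt t := g_sigma_algebraType (@coordinates R `[0, t]).

Lemma coordinates_sub (I J : set R) : I `<=` J -> coordinates I `<=` coordinates J.
Proof. by move=> IJ A [t It tA]; exists t => //; exact: IJ. Qed.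

Lemma canonical_filtration_le s t : s <= t ->
  canonical_filtration s `<=` @canonical_filtration R t.
Proof.
move=> st; apply: sub_sigma_algebra2; apply: coordinates_sub.
by apply: subset_itvl; rewrite bnd_simp.
Qed.

Lemma canonical_filtration_measurable t (A : set (cpath R)) :
  canonical_filtration t A -> measurable A.
Proof.
by apply: sub_sigma_algebra2; apply: coordinates_sub; apply: subset_itvl.
Qed.

Lemma measurable_filt_id t : measurable_fun setT (idfun : cpath R -> filt t).
Proof. by move=> _ A mA; rewrite setTI; exact: canonical_filtration_measurable mA. Qed.

Lemma measurable_coord_filt t r : 0 <= r -> r <= t ->
  measurable_fun setT (fun w : filt t => (w : cpath R) r).
Proof.
move=> r0 rt _ B mB; apply: sub_sigma_algebra; exists r => /=.
  by rewrite in_itv/= r0.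
by exists B.
Qed.

Lemma measurable_pval_filt t r : 0 <= t -> r <= t ->
  measurable_fun setT (fun w : filt t => pval w r).
Proof.
by move=> t0 rt; apply: measurable_coord_filt; rewrite ?le_max ?lexx// ge_max t0.
Qed.

Lemma measurable_filtW t (f : cpath R -> R) :
  measurable_fun setT (f : filt t -> R) -> measurable_fun setT f.
Proof.
move=> mf _ A mA; have := mf measurableT A mA; rewrite !setTI.
exact: canonical_filtration_measurable.
Qed.

Lemma measurable_filt_leW s t (f : cpath R -> R) : s <= t ->
  measurable_fun setT (f : filt s -> R) -> measurable_fun setT (f : filt t -> R).
Proof.
move=> st mf _ A mA; have := mf measurableT A mA; rewrite !setTI.
exact: canonical_filtration_le.
Qed.

Lemma measurable_pval r : measurable_fun setT (fun w : cpath R => pval w r).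
Proof.
apply: (@measurable_filtW (Num.max 0 r)); apply: measurable_pval_filt.
  by rewrite le_max lexx.
by rewrite le_max lexx orbT.
Qed.

Lemma measurable_filt_joint t : 0 <= t ->
  measurable_fun setT (fun z : filt t * R => pval z.1 (Num.min z.2 t)).
Proof.
move=> t0.
rewrite (_ : (fun z : filt t * R => _) =
    (fun z : filt t * R => pval z.1 (Num.max 0 (Num.min z.2 t)))); last first.
  apply/funext => z; rewrite /pval; congr (cpath_fun _ _).
  by rewrite maxA maxxx.
apply: (@measurable_eval _ _ _ (fun z : filt t * R => pval z.1)
    (fun z => Num.max 0 (Num.min z.2 t)) `[0, t]).
- by move=> z; exact: continuous_pval.
- move=> r /=; rewrite in_itv/= => /andP[r0 rt].
  exact: (measurableT_comp (measurable_pval_filt t0 rt) measurable_fst).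
- move=> z; rewrite /= in_itv/= le_max lexx/= ge_max t0/= ge_min lexx orbT.
  by [].
- by move=> r s /=; rewrite !in_itv/= => /andP[_ st] r0 rs; rewrite r0 (le_trans rs).
- apply: measurable_maxr => //; apply: measurable_minr => //.
Qed.

Lemma measurable_joint : measurable_fun setT (fun z : cpath R * R => pval z.1 z.2).
Proof.
rewrite (_ : (fun z : cpath R * R => _) =
    (fun z : cpath R * R => pval z.1 (Num.max 0 z.2))); last first.
  by apply/funext => z; rewrite /pval maxA maxxx.
apply: (@measurable_eval _ _ _ (fun z : cpath R * R => pval z.1)
    (fun z => Num.max 0 z.2) setT).
- by move=> z; exact: continuous_pval.
- by move=> r _; exact: (measurableT_comp (measurable_pval r) measurable_fst).
- by move=> z; split => //; rewrite le_max lexx.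
- by [].
- exact: measurable_maxr.
Qed.

Lemma measurable_time_integral t (g : R -> R) : 0 <= t -> continuous g ->
  measurable_fun setT (fun w : filt t => \int[lebesgue_measure]_(r in `[0, t]) g ((w : cpath R) r)).
Proof.
move=> t0 cg.
pose h (z : filt t * R) : R := g (pval z.1 (Num.min z.2 t)) * \1_(`[0, t]%classic) z.2.
have mh : measurable_fun setT (EFin \o h).
  apply/measurable_EFinP; apply: measurable_funM.
    apply: (@measurableT_comp _ _ _ _ _ _ g); first exact: continuous_measurable_fun.
    exact: measurable_filt_joint.
  exact: (@measurableT_comp _ _ _ _ _ _ (\1_`[0, t]%classic : R -> R) _ snd).
have E w : \int[lebesgue_measure]_(r in `[0, t]) g ((w : cpath R) r) =
    fine (\int[lebesgue_measure]_r (EFin \o h)^\+ (w, r) -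
          \int[lebesgue_measure]_r (EFin \o h)^\- (w, r))%E.
  rewrite /Rintegral integral_mkcond integralE; congr (fine (_ - _)%E);
    apply: eq_integral => r _; rewrite ?funeposE ?funenegE patchE /h/= indicE.
  - case: ifPn => [|_]; last by rewrite mulr0.
    by rewrite inE/= in_itv/= => /andP[r0 rt]; rewrite mulr1 min_l// pvalE.
  - case: ifPn => [|_]; last by rewrite mulr0.
    by rewrite inE/= in_itv/= => /andP[r0 rt]; rewrite mulr1 min_l// pvalE.
rewrite (funext E); apply: measurableT_comp => //; apply: emeasurable_funB.
- have K := @measurable_fun_fubini_tonelli_F _ _ _ _ R lebesgue_measure
      (EFin \o h)^\+%E (measurable_funepos mh) (funepos_ge0 _).
  exact: K.
- have K := @measurable_fun_fubini_tonelli_F _ _ _ _ R lebesgue_measure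
      (EFin \o h)^\-%E (measurable_funeneg mh) (funeneg_ge0 _).
  exact: K.
Qed.

End path_filtration.

(** * The martingale problem tested against past functionals *)

Section diagonal_chain_rule.
Context {R : realType}.

(** Chain rule for r |-> b(l(r), r) when b has a derivative in r only at the point considered.
    The increment in the first variable is treated by the mean value theorem, and the
    continuity of the partial derivative b1 along sequences suffices. *)
Lemma der_diag (b b1 : R -> R -> R) (l : R -> R) (r0 gam dl : R) :
  (forall x r : R, is_derive x 1 (b^~ r) (b1 x r)) ->
  is_derive r0 1 (b (l r0)) gam ->
  is_derive r0 1 l dl ->
  (forall (x_ r_ : nat -> R), x_ n @[n --> \oo] --> l r0 -> r_ n @[n --> \oo] --> r0 ->
     b1 (x_ n) (r_ n) @[n --> \oo] --> b1 (l r0) r0) ->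
  is_derive r0 1 (fun r => b (l r) r) (dl * b1 (l r0) r0 + gam).
Proof.
move=> db dr dll cb1.
have [q [ql cq qr0]] : exists q : R -> R, [/\ (forall z, l z - l r0 = q z * (z - r0)),
    {for r0, continuous q} & q r0 = dl].
  by move/is_derive1_caratheodory : dll => [q [h1 h2 h3]]; exists q.
have mvt r : exists x, b (l r) r - b (l r0) r = b1 x r * (l r - l r0) /\
    `|x - l r0| <= `|l r - l r0|.
  have [h|h|h] := ltgtP (l r) (l r0).
  - have [|x xI E] := @MVT _ (b^~ r) (b1^~ r) _ _ h (fun x _ => db x r).
      by apply: derivable_within_continuous => x _; have [] := db x r.
    move: xI; rewrite in_itv/= => /andP[a c]; exists x; split.
      by rewrite -opprB E -mulrN opprB.
    by rewrite !ltr0_norm ?subr_lt0// lerN2 lerD2r ltW.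
  - have [|x xI E] := @MVT _ (b^~ r) (b1^~ r) _ _ h (fun x _ => db x r).
      by apply: derivable_within_continuous => x _; have [] := db x r.
    move: xI; rewrite in_itv/= => /andP[a c]; exists x; split => //.
    by rewrite !gtr0_norm ?subr_gt0// lerD2r ltW.
  - by exists (l r0); rewrite h !subrr mulr0 normr0.
have [x_ hx] := choice mvt.
have dE : is_derive r0 1 (fun r => b (l r) r - b (l r0) r) (dl * b1 (l r0) r0).
  apply/is_derive1_caratheodory; exists (fun r => q r * b1 (x_ r) r); split.
  - move=> z; have [E _] := hx z; rewrite E ql subrr subr0; ring.
  - apply: cvgM; first exact: cq.
    have x0 : x_ r0 = l r0.
      have [_] := hx r0; rewrite subrr normr0 normr_le0 subr_eq0.
      by move/eqP.
    apply/(@cvg_nbhsP _ R^o) => u ur0.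
    rewrite x0; apply: cb1 => //.
    apply: cvg_zero; apply/norm_cvg0P.
    have lu : `|l (u n) - l r0| @[n --> \oo] --> (0 : R).
      have /continuous_cvg cl : {for r0, continuous l} by exact: der_continuous dll.
      apply: cvg_toE.
        by apply: cvg_norm; apply: cvgB; [apply: cl; exact: ur0|exact: cvg_cst].
      by rewrite subrr normr0.
    apply: (@squeeze_cvgr _ _ _ _ (cst 0) _ _ _ _ _ lu); last exact: cvg_cst.
    by near=> n; rewrite normr_ge0/=; have [_ h] := hx (u n); exact: h.
  - rewrite qr0 (_ : x_ r0 = l r0)//.
    have [_] := hx r0; rewrite subrr normr0 normr_le0 subr_eq0.
    by move/eqP.
rewrite (_ : (fun r => b (l r) r) = (fun r => (b (l r) r - b (l r0) r) + b (l r0) r)).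
  exact: derD dE dr.
by apply/funext => r; rewrite subrK.
Unshelve. all: by end_near. Qed.

Lemma der0_cst (f : R -> R) (s t : R) : s <= t ->
  (forall v : R, s <= v <= t -> {for v, continuous f}) ->
  (forall v : R, s < v < t -> is_derive v 1 f 0) -> f s = f t.
Proof.
move=> st cf df; apply/esym/eqP; rewrite -subr_eq0; apply/eqP.
have dI (v : R) : v \in `]s, t[ -> is_derive v 1 f 0 by rewrite in_itv/=; exact: df.
have cI : {within `[s, t], continuous f}.
  apply/subspace_continuousP => v; rewrite /= in_itv/= => /cf h.
  exact: cvg_within_filter.
by have [x _ ->] := MVT_segment st dI cI; rewrite mul0r.
Qed.

End diagonal_chain_rule.

Section martingale_to_laplace.
Context {R : realType}.
Notation leb := (@lebesgue_measure R).

Lemma prob_fin d (T : measurableType d) (P : probability T R) : (P setT < +oo)%E.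
Proof. by rewrite probability_setT ltry. Qed.

Lemma itv_fin (s t : R) : (leb (`[s, t]%classic : set R) < +oo)%E.
Proof. by rewrite lebesgue_measure_itv/=; case: ifP => _; rewrite ?ltry// -EFinB ltry. Qed.

Variables (P : probability (cpath R) R) (xi : cpath R -> R) (Mx : R).
Hypothesis xiM : forall w, `|xi w| <= Mx.
Hypothesis mxi : measurable_fun setT xi.

Lemma Mx_ge0 : 0 <= Mx.
Proof. exact: le_trans (normr_ge0 _) (xiM point). Qed.

Lemma measurable_xi_psi (psi : R -> R) r : continuous psi ->
  measurable_fun setT (fun w => xi w * psi (pval w r)).
Proof.
move=> cpsi; apply: measurable_funM => //.
apply: (@measurableT_comp _ _ _ _ _ _ psi); first exact: continuous_measurable_fun.
exact: measurable_pval.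
Qed.

Lemma xi_psi_bound (psi : R -> R) M r w : (forall y, `|psi y| <= M) ->
  `|xi w * psi (pval w r)| <= Mx * M.
Proof. by move=> pM; rewrite normrM ler_pM. Qed.

Lemma integrable_xi_psi (psi : R -> R) M r : continuous psi -> (forall y, `|psi y| <= M) ->
  P.-integrable setT (EFin \o (fun w => xi w * psi (pval w r))).
Proof.
move=> cpsi pM; apply: (@bounded_integrable _ _ _ _ _ _ (Mx * M)) => //.
- exact: prob_fin.
- exact: measurable_xi_psi.
- by move=> w _; exact: xi_psi_bound.
Qed.

Lemma continuous_expect (psi : R -> R) M : continuous psi -> (forall y, `|psi y| <= M) ->
  continuous (fun r => \int[P]_w (xi w * psi (pval w r))).
Proof.
move=> cpsi pM r0; apply/(@cvg_nbhsP _ R^o) => u ur0.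
apply: (@bounded_cvg_Rintegral _ _ _ _ _ _ _ (Mx * M)) => //.
- exact: prob_fin.
- by move=> n; exact: measurable_xi_psi.
- by move=> n w _; exact: xi_psi_bound.
- move=> w _; apply: cvgM; first exact: cvg_cst.
  have /continuous_cvg c1 : {for (pval w r0), continuous psi} by exact: cpsi.
  have /continuous_cvg c2 : {for r0, continuous (pval w)} by exact: continuous_pval.
  by apply: c1; apply: c2.
Qed.

(** The martingale property only speaks of events; [bounded_multiplier] extends it to bounded
    functionals xi known at time s, and Fubini exchanges time and expectation. *)
Lemma martingale_multiplier delta mu x0 (f g : R -> R) (Mf Mg s t : R) :
  bessel_law delta mu x0 P -> bessel_generator delta mu f g ->
  (forall y, `|f y| <= Mf) -> (forall y, `|g y| <= Mg) -> 0 <= s -> s <= t ->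
  measurable_fun setT (xi : filt s -> R) ->
  \int[P]_w (xi w * f (pval w t)) - \int[P]_w (xi w * f (pval w s)) =
  \int[leb]_(r in `[s, t]) \int[P]_w (xi w * g (pval w r)).
Proof.
move=> [_ _ lawP] gen fM gM s0 st mxis.
have [Mi _ Mart] := lawP _ _ gen.
have [[cf cg] _ _ _ _] := gen.
have t0 : 0 <= t by exact: le_trans st.
pose M (t : R) (w : cpath R) : R :=
  f (w t) - f (w 0) - \int[leb]_(r in `[0, t]) g (w r).
have {}Mi u : 0 <= u -> P.-integrable setT (EFin \o M u) by exact: Mi.
have {}Mart A : canonical_filtration s A ->
    (\int[P]_(w in A) (M t w)%:E = \int[P]_(w in A) (M s w)%:E)%E by exact: Mart.
pose D w := M t w - M s w.
have iD : P.-integrable setT (EFin \o D) by apply: integrableRB => //; exact: Mi.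
have key : \int[P]_w (xi w * D w) = 0.
  apply: (@bounded_multiplier _ _ _ _ (filt s) P idfun D xi Mx) => //.
    exact: measurable_filt_id.
  move=> A mA; have mA' : measurable (A : set (cpath R)).
    exact: canonical_filtration_measurable mA.
  rewrite preimage_id RintegralB//; last 2 first.
    by apply: integrableS (Mi _ t0).
    by apply: integrableS (Mi _ s0).
  have E : \int[P]_(w in A) M t w = \int[P]_(w in A) M s w := congr1 fine (Mart A mA).
  by rewrite E subrr.
have cgw w : continuous (fun r => g (pval w r)).
  move=> r; apply: (@continuous_comp _ _ _ (pval w) g); last exact: cg.
  exact: continuous_pval.
have mgw w : measurable_fun setT (fun r => g (pval w r)).
  exact: continuous_measurable_fun.
have igw w a b : leb.-integrable `[a, b] (EFin \o (fun r => g (pval w r))).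
  apply: (@bounded_integrable _ _ _ _ _ _ Mg) => //; first exact: itv_fin.
  exact: (measurable_funS measurableT _ (mgw w)).
have gE (w : cpath R) u : \int[leb]_(r in `[0, u]) g (w r) = \int[leb]_(r in `[0, u]) g (pval w r).
  by apply: eq_Rintegral => r; rewrite inE/= in_itv/= => /andP[r0 _]; rewrite pvalE.
have DE w : D w = f (pval w t) - f (pval w s) - \int[leb]_(r in `[s, t]) g (pval w r).
  rewrite /D /M !gE !(pvalE _ s0, pvalE _ t0).
  have := @Rintegral_itvB R (fun r => g (pval w r)) (BLeft 0) (BRight t) s (igw _ _ _).
  rewrite !bnd_simp => /(_ s0 st).
  rewrite Rintegral_itv_obnd_cbnd; first by move=> <-; ring.
  apply: integrableS (igw w s t) => //.
  by apply: subset_itvr; rewrite bnd_simp.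
have E w : \int[leb]_(r in `[s, t]) (xi w * g (pval w r)) =
    xi w * f (pval w t) - xi w * f (pval w s) - xi w * D w.
  by rewrite RintegralZl// DE; ring.
rewrite -(@Fubini_bounded _ _ _ P (fun w r => xi w * g (pval w r)) s t (Mx * Mg)); last 2 first.
- apply: measurable_funM.
    exact: (@measurableT_comp _ _ _ _ _ _ xi _ fst).
  apply: (@measurableT_comp _ _ _ _ _ _ g); first exact: continuous_measurable_fun.
  exact: measurable_joint.
- by move=> w r; exact: xi_psi_bound.
under [RHS]eq_Rintegral do rewrite E.
have i1 u := integrable_xi_psi u cf fM.
rewrite RintegralB//; last 2 first.
- exact: integrableRB.
- by apply: (@integrable_boundedM _ _ _ _ _ _ _ Mx).
by rewrite RintegralB// key subr0.
Qed.

End martingale_to_laplace.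

(** * One-step Laplace transform *)

Lemma Rintegral_prob_cst {R : realType} d (T : measurableType d) (P : probability T R) (c : R) :
  \int[P]_x (cst c x) = c.
Proof.
have := @Rintegral_cst _ _ _ P _ measurableT c; rewrite /cst => ->.
by rewrite (_ : fine _ = 1) ?mulr1//; exact: (congr1 fine (probability_setT P)).
Qed.

Section one_step_laplace.
Context {R : realType}.
Notation leb := (@lebesgue_measure R).
Variables (P : probability (cpath R) R) (xi : cpath R -> R) (Mx : R).
Hypothesis xiM : forall w, `|xi w| <= Mx.
Hypothesis mxi : measurable_fun setT xi.
Variables (delta mu x0 : R).
Hypothesis d0 : 0 < delta.
Hypothesis mu0 : 0 <= mu.
Hypothesis lawP : bessel_law delta mu x0 P.

Let k y := sq_bessel_h delta mu (y ^+ 2).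

Let k_ge1 y : 1 <= k y. Proof. by rewrite sq_bessel_h_ge1// sqr_ge0. Qed.

Let k_gt0 y : 0 < k y. Proof. exact: lt_le_trans (k_ge1 y). Qed.

Let k_cont : continuous k.
Proof. by move=> y; exact: der_continuous (der_of_sqr (der_sq_bessel_h mu _ d0)). Qed.

Let div_k_le (u M : R) y : `|u| <= M -> `|u / k y| <= M.
Proof.
move=> uM; rewrite normrM normfV (gtr0_norm (k_gt0 y)) ler_pdivrMr//.
by rewrite (le_trans uM)// ler_peMr// (le_trans _ uM).
Qed.

(** The exponential divided by h is not compactly supported: it is reached from
    [bessel_generator_trunc] by letting the truncation tend to 0. *)
Lemma exp_multiplier lam s t : 0 < lam -> 0 <= s -> s <= t ->
  measurable_fun setT (xi : filt s -> R) ->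
  \int[P]_w (xi w * (expR (- (lam * pval w t ^+ 2)) / k (pval w t))) -
  \int[P]_w (xi w * (expR (- (lam * pval w s ^+ 2)) / k (pval w s))) =
  \int[leb]_(r in `[s, t])
    \int[P]_w (xi w * (gen_exp delta mu lam (pval w r ^+ 2) / k (pval w r))).
Proof.
move=> l0 s0 st mxis.
pose e n : R := n.+1%:R^-1.
have e0 n : 0 < e n by rewrite invr_gt0.
have e1 n : 0 <= e n <= 1 by rewrite ltW//= invf_le1// ler1n.
pose f n y := trunc_exp lam (e n) (y ^+ 2) / k y.
pose g n y := gen_trunc_exp delta mu lam (e n) (y ^+ 2) / k y.
have gen n : bessel_generator delta mu (f n) (g n) by exact: bessel_generator_trunc.
pose Mg := 2 * (lam ^+ 2 + 6 * lam + 6) / lam + delta * (lam + 3) + mu ^+ 2 / 2.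
have fM n y : `|f n y| <= 1.
  apply: div_k_le; have /andP[a b] := trunc_exp_bound l0 (ltW (e0 n)) (sqr_ge0 y).
  by rewrite ger0_norm.
have gM n y : `|g n y| <= Mg.
  by apply: div_k_le; apply: gen_trunc_exp_bound; rewrite ?sqr_ge0// ltW.
have [cf cg] : (forall n, continuous (f n)) /\ (forall n, continuous (g n)).
  by split=> n; have [[]] := gen n.
have step n := martingale_multiplier xiM mxi lawP (gen n) (fM n) (gM n) s0 st mxis.
have cvgf r : \int[P]_w (xi w * f n (pval w r)) @[n --> \oo] -->
    \int[P]_w (xi w * (expR (- (lam * pval w r ^+ 2)) / k (pval w r))).
  apply: (@bounded_cvg_Rintegral _ _ _ _ _ _ _ (Mx * 1)) => //.
  - exact: prob_fin.
  - by move=> n; exact: measurable_xi_psi.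
  - by move=> n w _; exact: xi_psi_bound.
  - move=> w _; apply: cvgM; first exact: cvg_cst.
    apply: cvgM; last exact: cvg_cst.
    exact: (cvg_gen_trunc_exp delta mu lam (pval w r ^+ 2)).2.
have cvgg r : \int[P]_w (xi w * g n (pval w r)) @[n --> \oo] -->
    \int[P]_w (xi w * (gen_exp delta mu lam (pval w r ^+ 2) / k (pval w r))).
  apply: (@bounded_cvg_Rintegral _ _ _ _ _ _ _ (Mx * Mg)) => //.
  - exact: prob_fin.
  - by move=> n; exact: measurable_xi_psi.
  - by move=> n w _; exact: xi_psi_bound.
  - move=> w _; apply: cvgM; first exact: cvg_cst.
    apply: cvgM; last exact: cvg_cst.
    exact: (cvg_gen_trunc_exp delta mu lam (pval w r ^+ 2)).1.
have cL : (\int[P]_w (xi w * f n (pval w t)) - \int[P]_w (xi w * f n (pval w s))) @[n --> \oo] -->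
    \int[P]_w (xi w * (expR (- (lam * pval w t ^+ 2)) / k (pval w t))) -
    \int[P]_w (xi w * (expR (- (lam * pval w s ^+ 2)) / k (pval w s))).
  by apply: cvgB; exact: cvgf.
have cR : \int[leb]_(r in `[s, t]) \int[P]_w (xi w * g n (pval w r)) @[n --> \oo] -->
    \int[leb]_(r in `[s, t])
    \int[P]_w (xi w * (gen_exp delta mu lam (pval w r ^+ 2) / k (pval w r))).
  have mg n : measurable_fun setT (fun r : R => \int[P]_w (xi w * g n (pval w r))).
    apply: continuous_measurable_fun.
    exact: (continuous_expect xiM mxi (cg n) (gM n)).
  apply: (@bounded_cvg_Rintegral _ _ _ _ _ _ _ (Mx * Mg)).
  - exact: measurable_itv.
  - exact: itv_fin.
  - by move=> n; apply: (measurable_funS measurableT _ (mg n)).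
  - move=> n r _; have ig := integrable_xi_psi P xiM mxi r (cg n) (gM n).
    rewrite (le_trans (le_normr_Rintegral measurableT ig))//.
    have ci : P.-integrable setT (EFin \o cst (Mx * Mg)).
      by apply: (@bounded_integrable _ _ _ _ _ _ `|Mx * Mg|) => //; exact: prob_fin.
    have h w : setT w -> `|xi w * g n (pval w r)| <= Mx * Mg.
      by move=> _; exact: xi_psi_bound.
    rewrite (le_trans (le_Rintegral measurableT (integrable_norm ig) ci h))//.
    by rewrite Rintegral_prob_cst.
  - by move=> r _; exact: cvgg.
rewrite (funext step) in cL.
exact: (cvg_unique _ cL cR).
Qed.

(** The rate of the exponential is written expR l, so that the derivative [phi1] in l stays
    bounded by 1 (as u exp(- u) <= 1) uniformly in the position. *)
Let phi (l y : R) : R := expR (- (expR l * y ^+ 2)) / k y.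
Let phi1 (l y : R) : R := - (expR l * y ^+ 2) * expR (- (expR l * y ^+ 2)) / k y.

Let phi_le1 l y : `|phi l y| <= 1.
Proof.
apply: div_k_le; rewrite ger0_norm ?expR_ge0// expR_le1 oppr_le0.
by rewrite mulr_ge0 ?expR_ge0 ?sqr_ge0.
Qed.

Let phi1_le1 l y : `|phi1 l y| <= 1.
Proof.
have u0 : 0 <= expR l * y ^+ 2 by rewrite mulr_ge0 ?expR_ge0 ?sqr_ge0.
apply: div_k_le; rewrite mulNr normrN (ger0_norm (mulr_ge0 u0 (expR_ge0 _))).
by have := mul_expN_le ltr01 u0; rewrite mul1r invr1.
Qed.

Let der_phi (l y : R) : is_derive l 1 (phi^~ y) (phi1 l y).
Proof.
have h : is_derive l 1 (fun l => - (expR l * y ^+ 2)) (- (expR l * 1 * y ^+ 2)).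
  apply: derN; apply: (der_eq (derM (der_expR (der_id l)) (der_cst (y ^+ 2) l))).
  by rewrite mulr0 addr0.
apply: (der_eq (derM (der_expR h) (der_cst (k y)^-1 l))).
by rewrite /phi1; ring.
Qed.

Let phi_joint (l_ y_ : nat -> R) l y : l_ n @[n --> \oo] --> l -> y_ n @[n --> \oo] --> y ->
  phi (l_ n) (y_ n) @[n --> \oo] --> phi l y /\
  phi1 (l_ n) (y_ n) @[n --> \oo] --> phi1 l y.
Proof.
move=> cl cy.
have /continuous_cvg ce : {for l, continuous (@expR R)} by exact: continuous_expR.
have y2 : y_ n ^+ 2 @[n --> \oo] --> y ^+ 2.
  have /continuous_cvg c2 : {for y, continuous (fun y : R => y ^+ 2)} by exact: exprn_continuous.
  exact: c2.
have cu : expR (l_ n) * y_ n ^+ 2 @[n --> \oo] --> expR l * y ^+ 2.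
  by apply: cvgM; [exact: ce|].
have cuN : - (expR (l_ n) * y_ n ^+ 2) @[n --> \oo] --> - (expR l * y ^+ 2) by exact: cvgN.
have ck : (k (y_ n))^-1 @[n --> \oo] --> (k y)^-1.
  apply: cvgV; first by rewrite gt_eqF.
  have /continuous_cvg c2 : {for y, continuous k} by exact: k_cont.
  exact: c2.
have cE : expR (- (expR (l_ n) * y_ n ^+ 2)) @[n --> \oo] --> expR (- (expR l * y ^+ 2)).
  have /continuous_cvg c2 : {for (- (expR l * y ^+ 2)), continuous (@expR R)}.
    exact: continuous_expR.
  exact: c2.
split; first exact: cvgM.
by apply: cvgM => //; exact: cvgM.
Qed.

Let phi_cont l : continuous (phi l).
Proof.
move=> y; apply/(@cvg_nbhsP _ R^o) => u uy.
by have [] := phi_joint (cvg_cst l) uy.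
Qed.

Let phi1_cont l : continuous (phi1 l).
Proof.
move=> y; apply/(@cvg_nbhsP _ R^o) => u uy.
by have [] := phi_joint (cvg_cst l) uy.
Qed.

Let b (l r : R) : R := \int[P]_w (xi w * phi l (pval w r)).
Let b1 (l r : R) : R := \int[P]_w (xi w * phi1 l (pval w r)).

Let joint_expect (psi : R -> R -> R) (l_ r_ : nat -> R) l r :
  (forall l, continuous (psi l)) -> (forall l y, `|psi l y| <= 1) ->
  (forall (l_ y_ : nat -> R) l y, l_ n @[n --> \oo] --> l -> y_ n @[n --> \oo] --> y ->
     psi (l_ n) (y_ n) @[n --> \oo] --> psi l y) ->
  l_ n @[n --> \oo] --> l -> r_ n @[n --> \oo] --> r ->
  \int[P]_w (xi w * psi (l_ n) (pval w (r_ n))) @[n --> \oo] -->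
  \int[P]_w (xi w * psi l (pval w r)).
Proof.
move=> cpsi psi1 jpsi cl cr.
apply: (@bounded_cvg_Rintegral _ _ _ _ _ _ _ (Mx * 1)).
- exact: measurableT.
- exact: prob_fin.
- by move=> n; exact: measurable_xi_psi.
- by move=> n w _; exact: xi_psi_bound.
- move=> w _; apply: cvgM; first exact: cvg_cst.
  apply: jpsi => //.
  have /continuous_cvg c2 : {for r, continuous (pval w)} by exact: continuous_pval.
  exact: c2.
Qed.

Let b_joint (l_ r_ : nat -> R) l r :
  l_ n @[n --> \oo] --> l -> r_ n @[n --> \oo] --> r ->
  b (l_ n) (r_ n) @[n --> \oo] --> b l r.
Proof.
apply: joint_expect; [exact: phi_cont|exact: phi_le1|].
by move=> ? ? ? ? h1 h2; have [] := phi_joint h1 h2.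
Qed.

Let b1_joint (l_ r_ : nat -> R) l r :
  l_ n @[n --> \oo] --> l -> r_ n @[n --> \oo] --> r ->
  b1 (l_ n) (r_ n) @[n --> \oo] --> b1 l r.
Proof.
apply: joint_expect; [exact: phi1_cont|exact: phi1_le1|].
by move=> ? ? ? ? h1 h2; have [] := phi_joint h1 h2.
Qed.

Let der_b (l r : R) : is_derive l 1 (b^~ r) (b1 l r).
Proof.
pose f l w := xi w * phi l (pval w r).
have df (l' : R) (w : cpath R) : is_derive l' 1 (f^~ w) (xi w * phi1 l' (pval w r)).
  by apply: (der_eq (derM (der_cst (xi w) l') (der_phi l' (pval w r)))); ring.
have d1 (l' : R) (w : cpath R) : partial1of2 f l' w = xi w * phi1 l' (pval w r).
  exact: der_derive1 (df l' w).
have lI : (`]l - 1, l + 1[%classic : set R) l by rewrite /= in_itv/=; lra.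
have If x : (`]l - 1, l + 1[%classic : set R) x -> P.-integrable setT (EFin \o f x).
  by move=> _; exact: (integrable_xi_psi P xiM mxi r (@phi_cont x) (phi_le1 x)).
have dI x w : (`]l - 1, l + 1[%classic : set R) x -> setT w -> derivable (f^~ w) x 1.
  by move=> _ _; have [] := df x w.
have M0 (w : cpath R) : 0 <= Mx * 1 by rewrite mulr1; exact: (Mx_ge0 xiM).
have iM : P.-integrable setT (EFin \o (fun _ : cpath R => Mx * 1)).
  by apply: (@bounded_integrable _ _ _ _ _ _ `|Mx * 1|) => //; exact: prob_fin.
have bM x w : (`]l - 1, l + 1[%classic : set R) x -> setT w -> `|partial1of2 f x w| <= Mx * 1.
  by move=> _ _; rewrite d1; exact: xi_psi_bound.
have D := derivable_under_integral measurableT lI If dI M0 iM bM.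
have E := differentiation_under_integral measurableT lI If dI M0 iM bM.
apply: DeriveDef; first exact: D.
by rewrite -derive1E E; apply: eq_Rintegral => w _; exact: d1.
Qed.

(** The functions exp(mu^2 v / 2) (C - v)^(- delta / 2) exp(- x / (2 (C - v))) / h(x), where
    C = t + 1 / (2 theta), solve the backward equation. Their expectation is constant by the
    diagonal chain rule: the derivative in the rate cancels the derivative in time at a fixed
    rate, which is given by [exp_multiplier]. *)
Lemma one_step_laplace theta s t : 0 < theta -> 0 <= s -> s <= t ->
  measurable_fun setT (xi : filt s -> R) ->
  expR (mu ^+ 2 / 2 * t) *
    \int[P]_w (xi w * (expR (- (theta * pval w t ^+ 2)) / k (pval w t))) =
  expR (mu ^+ 2 / 2 * s) * expR (- (delta / 2 * ln (1 + 2 * theta * (t - s)))) *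
    \int[P]_w (xi w *
      (expR (- (theta / (1 + 2 * theta * (t - s)) * pval w s ^+ 2)) / k (pval w s))).
Proof.
move=> th0 s0 st mxis.
pose C := t + (2 * theta)^-1.
have tC : t < C by rewrite ltrDl invr_gt0 mulr_gt0.
pose el v := - ln (2 * (C - v)).
have pos v : v <= t -> 0 < 2 * (C - v) by move=> vt; rewrite mulr_gt0// subr_gt0 (le_lt_trans vt).
have elE v : v <= t -> expR (el v) = (2 * (C - v))^-1.
  by move=> vt; rewrite /el expRN lnK// posrE pos.
pose p v := expR (mu ^+ 2 / 2 * v - delta / 2 * ln (2 * (C - v))).
pose U v := p v * b (el v) v.
have dlin (v : R) : is_derive v 1 (fun v => 2 * (C - v)) (- 2).
  by apply: (der_eq (derM (der_cst 2 v) (derB (der_cst C v) (der_id v)))); ring.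
have dln (v : R) : v <= t -> is_derive v 1 (fun v => ln (2 * (C - v))) ((2 * (C - v))^-1 * - 2).
  by move=> vt; apply: der_ln (dlin v) _; exact: pos.
have dp (v : R) : v <= t -> is_derive v 1 p (p v * (mu ^+ 2 / 2 + delta / (2 * (C - v)))).
  move=> vt; apply: (der_eq (der_expR (derB (der_linear (mu ^+ 2 / 2) v)
    (derM (der_cst (delta / 2) v) (dln v vt))))).
  by congr (_ * _); field; rewrite gt_eqF// subr_gt0 (le_lt_trans vt).
have del (v : R) : v <= t -> is_derive v 1 el ((C - v)^-1).
  move=> vt; apply: (der_eq (derN (dln v vt))).
  by field; rewrite gt_eqF// subr_gt0 (le_lt_trans vt).
have cU (v : R) : s <= v <= t -> {for v, continuous U}.
  move=> /andP[_ vt]; apply: cvgM; first exact: der_continuous (dp v vt).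
  apply/(@cvg_nbhsP _ R^o) => u uv; apply: b_joint => //.
  have /continuous_cvg c2 : {for v, continuous el} by exact: der_continuous (del v vt).
  exact: c2.
have dU (v : R) : s < v < t -> is_derive v 1 U 0.
  move=> /andP[sv vt]; have vt' := ltW vt.
  pose lam := expR (el v).
  have lam0 : 0 < lam by exact: expR_gt0.
  have lamE : lam = (2 * (C - v))^-1 by exact: elE.
  pose gam r := \int[P]_w (xi w * (gen_exp delta mu lam (pval w r ^+ 2) / k (pval w r))).
  have gamE r : gam r = - (2 * lam) * b1 (el v) r - (delta * lam + mu ^+ 2 / 2) * b (el v) r.
    rewrite /gam /b1 /b.
    have i1 := integrable_xi_psi P xiM mxi r (@phi1_cont (el v)) (phi1_le1 (el v)).
    have i0 := integrable_xi_psi P xiM mxi r (@phi_cont (el v)) (phi_le1 (el v)).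
    rewrite -!RintegralZl// -RintegralB//; last 2 first.
    - exact: integrableRM.
    - exact: integrableRM.
    apply: eq_Rintegral => w _; rewrite /gen_exp /phi1 /phi -/lam.
    by ring.
  have cb1 : continuous (b1 (el v)) := continuous_expect xiM mxi (@phi1_cont (el v)) (phi1_le1 (el v)).
  have cb : continuous (b (el v)) := continuous_expect xiM mxi (@phi_cont (el v)) (phi_le1 (el v)).
  have cgam : continuous gam.
    rewrite (funext gamE) => r; apply: cvgB; apply: cvgM;
      [exact: cvg_cst|exact: cb1|exact: cvg_cst|exact: cb].
  have db : is_derive v 1 (b (el v)) (gam v).
    have [u vu] : exists u, v < u by exists (v + 1); rewrite ltrDl.
    have ig : leb.-integrable `[s, u] (EFin \o gam).
      apply: continuous_compact_integrable; first exact: segment_compact.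
      by apply: continuous_subspaceT => r; exact: cgam.
    have [Fd FE] := continuous_FTC1_closed vu ig sv (cgam v).
    have dF : is_derive v 1 (fun x => b (el v) s + \int[leb]_(r in `[s, x]) gam r) (gam v).
      apply: (der_eq (derD (der_cst _ v) (DeriveDef Fd _))); last by rewrite add0r.
      by rewrite -derive1E; exact: FE.
    apply: der_near dF; near=> x.
    have sx : s <= x by apply: ltW; near: x; exact: lt_nbhsr.
    have := exp_multiplier lam0 s0 sx mxis.
    rewrite -/(gam _) => E.
    by apply/esym/eqP; rewrite addrC -subr_eq; exact/eqP/E.
  have dd := @der_diag _ b b1 el v _ _ der_b db (del v vt') (fun x_ r_ => @b1_joint x_ r_ (el v) v).
  have dpd := derM (dp v vt') dd.
  apply: (der_eq dpd).
  rewrite gamE.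
  have -> : (C - v)^-1 = 2 * lam.
    by rewrite lamE; field; rewrite gt_eqF// subr_gt0 (lt_trans vt tC).
  have -> : delta / (2 * (C - v)) = delta * lam by rewrite lamE.
  by ring.
have := der0_cst st cU dU.
have th : expR (el t) = theta.
  by rewrite elE// /C addrC addKr; field; rewrite gt_eqF.
have q0 : 0 < 1 + 2 * theta * (t - s).
  by rewrite ltr_wpDr// mulr_ge0 ?subr_ge0// ltW// mulr_gt0.
have ths : expR (el s) = theta / (1 + 2 * theta * (t - s)).
  rewrite elE// /C; field.
  by rewrite (gt_eqF q0) (gt_eqF th0).
rewrite /U /b /phi th ths => E.
have pE v : p v = expR (mu ^+ 2 / 2 * v) * expR (delta / 2 * el v).
  by rewrite -expRD /el mulrN.
have elt : el t = ln theta by rewrite -th expRK.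
have els : el s = ln theta - ln (1 + 2 * theta * (t - s)).
  by rewrite -(ln_div th0 q0) -ths expRK.
have ps : p s = expR (mu ^+ 2 / 2 * s) * expR (- (delta / 2 * ln (1 + 2 * theta * (t - s)))) *
    expR (delta / 2 * ln theta).
  by rewrite pE els mulrBr addrC expRD mulrA.
have pt : p t = expR (mu ^+ 2 / 2 * t) * expR (delta / 2 * ln theta) by rewrite pE elt.
move: E; rewrite ps pt => E.
apply: (mulIf (lt0r_neq0 (expR_gt0 (delta / 2 * ln theta)))).
have swap (a c' e i j w : R) : a * c' * w * i = e * w * j -> e * j * w = a * c' * i * w.
  by move=> h; transitivity (e * w * j); [ring|rewrite -h; ring].
exact: swap E.
Unshelve. all: by end_near. Qed.

End one_step_laplace.

(** * Laplace functional at several times *)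

Section multi_step_laplace.
Context {R : realType}.
Implicit Types (s : seq (R * R)) (w : cpath R).

(** The entries of the list are pairs (time, weight). *)
Definition wsum s w : R := \sum_(p <- s) p.2 * pval w p.1 ^+ 2.

(** State (last time, a, b) of the linear system b' = 2 a with jumps a += weight * b;
    its component a is the inverse Laplace transform to the power 2 / dimension. *)
Definition ric_step (st : R * (R * R)) (p : R * R) : R * (R * R) :=
  let b := st.2.2 + 2 * (p.1 - st.1) * st.2.1 in (p.1, (st.2.1 + p.2 * b, b)).

Definition ric s := foldl ric_step (0, (1, 0)) s.

Definition times_sorted s := path <=%R 0 [seq p.1 | p <- s].
Definition weights_ge0 s := all (fun p : R * R => 0 <= p.2) s.

Lemma ric_rcons s p : ric (rcons s p) = ric_step (ric s) p.
Proof. by rewrite /ric foldl_rcons. Qed.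

Lemma wsum_rcons s p w : wsum (rcons s p) w = wsum s w + p.2 * pval w p.1 ^+ 2.
Proof. by rewrite /wsum big_rcons/= addrC. Qed.

Lemma wsum_nil : wsum [::] = cst 0.
Proof. by apply/funext => w; rewrite /wsum big_nil. Qed.

Lemma wsum_cons p s : wsum (p :: s) = (fun w => p.2 * pval w p.1 ^+ 2 + wsum s w).
Proof. by apply/funext => w; rewrite /wsum big_cons. Qed.

Lemma wsum_ge0 s w : weights_ge0 s -> 0 <= wsum s w.
Proof.
rewrite /wsum; elim: s => [|p s ih /andP[p0 s0]]; first by rewrite big_nil.
by rewrite big_cons addr_ge0 ?ih// mulr_ge0// sqr_ge0.
Qed.

Lemma times_sorted_rcons s p : times_sorted (rcons s p) ->
  times_sorted s /\ (last 0 [seq q.1 | q <- s] <= p.1).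
Proof. by rewrite /times_sorted map_rcons rcons_path => /andP[]. Qed.

Lemma ric_last s : (ric s).1 = last 0 [seq q.1 | q <- s].
Proof. by elim/last_ind: s => // s p _; rewrite ric_rcons map_rcons last_rcons. Qed.

Lemma times_sorted_last_ge0 s : times_sorted s -> 0 <= last 0 [seq q.1 | q <- s].
Proof.
elim/last_ind: s => [|s p ih]; first by rewrite lexx.
move=> /times_sorted_rcons[/ih h]; rewrite map_rcons last_rcons; exact: le_trans.
Qed.

Lemma ric_ge s : times_sorted s -> weights_ge0 s -> 1 <= (ric s).2.1 /\ 0 <= (ric s).2.2.
Proof.
elim/last_ind: s => [|s p ih]; first by rewrite /= lexx.
move=> /times_sorted_rcons[ss sp]; rewrite /weights_ge0 all_rcons => /andP[p0 ws].
have [a1 b0] := ih ss ws; rewrite ric_rcons /ric_step/=.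
have b'0 : 0 <= (ric s).2.2 + 2 * (p.1 - (ric s).1) * (ric s).2.1.
  by rewrite addr_ge0// mulr_ge0 ?(le_trans _ a1)// mulr_ge0// subr_ge0 ric_last.
by split => //; rewrite (le_trans a1)// lerDl mulr_ge0.
Qed.

Lemma times_sorted_le s t : times_sorted s -> last 0 [seq q.1 | q <- s] <= t ->
  forall p, p \in s -> p.1 <= t.
Proof.
elim/last_ind: s t => [//|s q ih] t /times_sorted_rcons[ss sq].
rewrite map_rcons last_rcons => qt p; rewrite mem_rcons inE => /predU1P[->//|ps].
by rewrite (le_trans (ih _ ss sq p ps)).
Qed.

Lemma measurable_wsum_filt s t : 0 <= t -> (forall p, p \in s -> p.1 <= t) ->
  measurable_fun setT (wsum s : filt t -> R).
Proof.
move=> t0; elim: s => [|p s ih] st; first by rewrite wsum_nil; exact: measurable_cst.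
rewrite wsum_cons; apply: measurable_funD.
  apply: measurable_funM => //; apply: measurable_funX.
  by apply: measurable_pval_filt => //; apply: st; rewrite mem_head.
by apply: ih => q qs; apply: st; rewrite inE qs orbT.
Qed.

Lemma measurable_wsum s : measurable_fun setT (wsum s).
Proof.
elim: s => [|p s ih]; first by rewrite wsum_nil; exact: measurable_cst.
rewrite wsum_cons; apply: measurable_funD => //; apply: measurable_funM => //; apply: measurable_funX.
exact: measurable_pval.
Qed.

Lemma measurable_exp_wsum s : measurable_fun setT (fun w => expR (- wsum s w)).
Proof. by apply: measurable_expR_comp; apply: measurable_funN; exact: measurable_wsum. Qed.

Lemma expR_wsum_bound s w : weights_ge0 s -> `|expR (- wsum s w)| <= 1.
Proof.
by move=> ws; rewrite ger0_norm ?expR_ge0// expR_le1 oppr_le0 wsum_ge0.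
Qed.

Variables (P : probability (cpath R) R) (delta mu : R).
Hypothesis d0 : 0 < delta.
Hypothesis mu0 : 0 <= mu.
Hypothesis lawP : bessel_law delta mu 0 P.

Let k y := sq_bessel_h delta mu (y ^+ 2).

Let k_cont : continuous k.
Proof. by move=> y; exact: der_continuous (der_of_sqr (der_sq_bessel_h mu _ d0)). Qed.

Let k_gt0 y : 0 < k y. Proof. by rewrite sq_bessel_h_gt0// sqr_ge0. Qed.

Lemma expect_at0 (psi : R -> R) : continuous psi ->
  \int[P]_w psi (pval w 0) = psi 0.
Proof.
move=> cpsi; have [P0 _ _] := lawP.
rewrite -[RHS](Rintegral_prob_cst P); congr fine; apply: ae_eq_integral.
- exact: measurableT.
- apply/measurable_EFinP; apply: (@measurableT_comp _ _ _ _ _ _ psi).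
    exact: continuous_measurable_fun.
  exact: measurable_pval.
- by apply/measurable_EFinP; exact: measurable_cst.
- by apply: filterS P0 => w w0 _; rewrite pvalE// w0.
Qed.

(** Induction from the last time backwards: one step replaces the last entry (t, theta) by a
    weight theta / (1 + 2 theta (t - r)) at the previous time r, where it adds to the weight
    already there. On the component a of the state this multiplies by 1 + 2 theta (t - r). *)
Lemma multi_step_laplace s t theta : 0 < theta ->
  times_sorted (rcons s (t, theta)) -> weights_ge0 s ->
  expR (mu ^+ 2 / 2 * t) *
    \int[P]_w (expR (- wsum (rcons s (t, theta)) w) / k (pval w t)) =
  expR (- (delta / 2 * ln (ric (rcons s (t, theta))).2.1)).
Proof.
elim/last_ind: s t theta => [|s [r lam] ih] t theta th0.
  rewrite /times_sorted/= andbT => t0 _.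
  have m1 : measurable_fun setT (fun _ : filt (0 : R) => 1 : R) by [].
  have n1 (w : cpath R) : `|(1 : R)| <= 1 by rewrite normr1.
  have m1' : measurable_fun setT (fun _ : cpath R => 1 : R) by [].
  have := one_step_laplace n1 m1' d0 mu0 lawP th0 (lexx _) t0 m1.
  under eq_Rintegral do rewrite mul1r.
  have E w : wsum [:: (t, theta)] w = theta * pval w t ^+ 2 by rewrite /wsum big_seq1.
  under [in X in _ -> X]eq_Rintegral do rewrite E.
  move=> ->; rewrite mulr0 expR0 mul1r subr0 add0r.
  under eq_Rintegral do rewrite mul1r.
  rewrite (@expect_at0 (fun y => expR (- (theta / (1 + 2 * theta * t) * y ^+ 2)) / k y)); last first.
    move=> y; apply: cvgM; last by apply: cvgV; [rewrite gt_eqF|exact: k_cont].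
    exact: der_continuous (der_of_sqr (der_expM (theta / (1 + 2 * theta * t)) (y ^+ 2))).
  rewrite expr0n/= mulr0 oppr0 expR0 /k expr0n/= sq_bessel_h0 divr1 mulr1.
  by congr (expR (- (_ * ln _))); ring.
move=> st; rewrite /weights_ge0 all_rcons => /andP[/= lam0 ws].
have [st1 rt] := times_sorted_rcons st; rewrite map_rcons last_rcons/= in rt.
have [st2 sr] := times_sorted_rcons st1; rewrite /= in sr.
have r0 : 0 <= r by rewrite (le_trans _ sr)// times_sorted_last_ge0.
have [a1 b0] := ric_ge st2 ws.
pose S := rcons s (r, lam).
have wS : weights_ge0 S by rewrite /weights_ge0 all_rcons/= lam0.
have xi1 w : `|expR (- wsum S w)| <= 1 by exact: expR_wsum_bound.
have mE (f : cpath R -> R) : measurable_fun setT f -> measurable_fun setT (fun w => expR (- f w)).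
  by move=> mf; apply: measurableT_comp => //; exact: measurable_funN.
have mxi := mE _ (measurable_wsum S).
have mxis : measurable_fun setT ((fun w => expR (- wsum S w)) : filt r -> R).
  apply: measurable_expR_comp.
  apply: measurable_funN; apply: measurable_wsum_filt => // p.
  by apply: (times_sorted_le st1); rewrite map_rcons last_rcons.
have := one_step_laplace xi1 mxi d0 mu0 lawP th0 r0 rt mxis.
set c := 1 + 2 * theta * (t - r).
have c0 : 0 < c by rewrite ltr_wpDr// mulr_ge0 ?subr_ge0// mulr_ge0// ltW.
have E1 w : expR (- wsum S w) * (expR (- (theta * pval w t ^+ 2)) / sq_bessel_h delta mu (pval w t ^+ 2)) =
    expR (- wsum (rcons S (t, theta)) w) / k (pval w t).
  by rewrite mulrA -expRD wsum_rcons/= opprD.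
under eq_Rintegral do rewrite E1.
have E2 w : expR (- wsum S w) * (expR (- (theta / c * pval w r ^+ 2)) / sq_bessel_h delta mu (pval w r ^+ 2)) =
    expR (- wsum (rcons s (r, lam + theta / c)) w) / k (pval w r).
  rewrite mulrA -expRD /S !wsum_rcons/=; congr (expR _ / _).
  by rewrite mulrDl; ring.
under [X in _ = _ * X -> _]eq_Rintegral do rewrite E2.
move=> ->.
have th'0 : 0 < lam + theta / c by rewrite ltr_wpDl// divr_gt0.
have st3 : times_sorted (rcons s (r, lam + theta / c)).
  by move: st1; rewrite /times_sorted !map_rcons.
rewrite mulrAC (ih _ _ th'0 st3 ws).
have w3 : weights_ge0 (rcons s (r, lam + theta / c)).
  by rewrite /weights_ge0 all_rcons/= (ltW th'0).
have [A1 _] := ric_ge st3 w3.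
rewrite -expRD -opprD -mulrDr -lnM ?posrE//; last exact: lt_le_trans A1.
congr (expR (- (_ * ln _))).
rewrite !ric_rcons /ric_step/= -/c.
have -> : c = 1 + 2 * theta * (t - r) by [].
field; rewrite -/c; exact: lt0r_neq0.
Qed.

End multi_step_laplace.

(** * Gamma moments *)

Section gamma_moments.
Context {R : realType} d (T : measurableType d).
Variables (P : probability T R) (D W : T -> R) (nu C a b : R).
Hypothesis mD : measurable_fun setT D.
Hypothesis mW : measurable_fun setT W.
Hypothesis D01 : forall w, 0 <= D w <= 1.
Hypothesis W0 : forall w, 0 <= W w.
Hypothesis nu0 : 0 < nu.
Hypothesis a0 : 0 < a.
Hypothesis b0 : 0 <= b.
Hypothesis lap : forall eta, 0 < eta ->
  \int[P]_w (D w * expR (- (eta * W w))) = C * expR (- (nu * ln (a + b * eta))).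

Lemma pow_exp_le (c x : R) n : 0 < c -> 0 <= x -> x ^+ n * expR (- (c * x)) <= n`!%:R / c ^+ n.
Proof.
move=> c0 x0; have cx0 : 0 <= c * x by rewrite mulr_ge0// ltW.
have h : (c * x) ^+ n <= n`!%:R * expR (c * x).
  case: n => [|n]; first by rewrite expr0 fact0 mul1r -expR0 ler_expR.
  rewrite [leRHS]mulrC -ler_pdivrMr ?ltr0n ?fact_gt0//.
  by rewrite (le_trans _ (expR_ge1Dxn n cx0))// lerDr.
rewrite expRN ler_pdivrMr ?expR_gt0// mulrAC ler_pdivlMr ?exprn_gt0//.
by rewrite -exprMn [x * c]mulrC.
Qed.

Let f j (eta : R) w := D w * (W w ^+ j * expR (- (eta * W w))).

Let f_bound j (c eta : R) w : 0 < c -> c <= eta -> `|f j eta w| <= j`!%:R / c ^+ j.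
Proof.
move=> c0 ce; have /andP[D0 D1] := D01 w.
have w0 : 0 <= W w ^+ j * expR (- (c * W w)) by rewrite mulr_ge0 ?expR_ge0// exprn_ge0.
have we0 : 0 <= W w ^+ j * expR (- (eta * W w)) by rewrite mulr_ge0 ?expR_ge0// exprn_ge0.
rewrite (ger0_norm (mulr_ge0 D0 we0)); apply: (le_trans _ (pow_exp_le j c0 (W0 w))).
rewrite (@le_trans _ _ (1 * (W w ^+ j * expR (- (eta * W w)))))// ?ler_wpM2r//.
by rewrite mul1r ler_wpM2l ?exprn_ge0// ler_expR lerN2 ler_wpM2r.
Qed.

Let mf j eta : measurable_fun setT (f j eta).
Proof.
apply: measurable_funM => //; apply: measurable_funM; first exact: measurable_funX.
apply: measurable_expR_comp.
by apply: measurable_funN; exact: measurable_funM.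
Qed.

Let intf j eta : 0 < eta -> P.-integrable setT (EFin \o f j eta).
Proof.
move=> e0; apply: (@bounded_integrable _ _ _ _ _ _ (j`!%:R / eta ^+ j)).
- exact: measurableT.
- exact: prob_fin.
- exact: mf.
- by move=> w _; exact: f_bound.
Qed.

Let der_f j (eta : R) w : is_derive eta 1 (fun eta => f j eta w) (- f j.+1 eta w).
Proof.
apply: (der_eq (derM (der_cst (D w) eta) (derM (der_cst (W w ^+ j) eta)
  (der_expR (derN (derM (der_id eta) (der_cst (W w) eta))))))).
by rewrite /f exprS; ring.
Qed.

Let F j (eta : R) := \int[P]_w f j eta w.

Let der_F j (eta : R) : 0 < eta -> is_derive eta 1 (F j) (- F j.+1 eta).
Proof.
move=> e0; have e2 : 0 < eta / 2 by rewrite divr_gt0.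
(* the derivatives are dominated on the neighbourhood ]eta / 2, eta + 1[ *)
pose M := j.+1`!%:R / (eta / 2) ^+ j.+1.
have d1 x w : partial1of2 (f j) x w = - f j.+1 x w by exact: der_derive1 (der_f j x w).
have lI : (`]eta / 2, eta + 1[%classic : set R) eta by rewrite /= in_itv/=; lra.
have xI x : (`]eta / 2, eta + 1[%classic : set R) x -> eta / 2 < x.
  by rewrite /= in_itv/= => /andP[].
have If x : (`]eta / 2, eta + 1[%classic : set R) x -> P.-integrable setT (EFin \o f j x).
  by move=> /xI h; apply: intf; exact: lt_trans h.
have dI x w : (`]eta / 2, eta + 1[%classic : set R) x -> setT w -> derivable (f j ^~ w) x 1.
  by move=> _ _; have [] := der_f j x w.
have M0 (w : T) : 0 <= M by rewrite /M divr_ge0// exprn_ge0// ltW.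
have iM : P.-integrable setT (EFin \o (fun _ : T => M)).
  by apply: (@bounded_integrable _ _ _ _ _ _ `|M|) => //; exact: prob_fin.
have bM x w : (`]eta / 2, eta + 1[%classic : set R) x -> setT w -> `|partial1of2 (f j) x w| <= M.
  by move=> /xI h _; rewrite d1 normrN; apply: f_bound => //; exact: ltW.
have Dd := derivable_under_integral measurableT lI If dI M0 iM bM.
have E := differentiation_under_integral measurableT lI If dI M0 iM bM.
apply: DeriveDef; first exact: Dd.
rewrite -derive1E E; transitivity (\int[P]_w (-1 * f j.+1 eta w)).
  by apply: eq_Rintegral => w _; rewrite mulN1r; exact: d1.
by rewrite RintegralZl ?mulN1r//; exact: intf.
Qed.

Let G j (eta : R) := C / (hyp01_coef nu j * j`!%:R) * (b / (a + b * eta)) ^+ j *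
  expR (- (nu * ln (a + b * eta))).

Let q0 (eta : R) : 0 < eta -> 0 < a + b * eta.
Proof. by move=> e0; rewrite ltr_wpDr// mulr_ge0// ltW. Qed.

Let der_G j (eta : R) : 0 < eta -> is_derive eta 1 (G j) (- G j.+1 eta).
Proof.
move=> e0; have h := q0 e0.
have dl : is_derive eta 1 (fun eta => a + b * eta) b.
  by apply: (der_eq (derD (der_cst a eta) (der_linear b eta))); rewrite add0r.
have dinv : is_derive eta 1 (fun eta => b / (a + b * eta)) (- (b / (a + b * eta)) ^+ 2).
  apply: (der_eq (derM (der_cst b eta) (derV dl (lt0r_neq0 h)))).
  by field; exact: lt0r_neq0.
have dexp : is_derive eta 1 (fun eta => expR (- (nu * ln (a + b * eta))))
   (expR (- (nu * ln (a + b * eta))) * - (nu * (b / (a + b * eta)))).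
  apply: (der_eq (der_expR (derN (derM (der_cst nu eta) (der_ln dl h))))).
  by ring.
have dpow : is_derive eta 1 (fun eta => (b / (a + b * eta)) ^+ j)
    (- (j%:R * (b / (a + b * eta)) ^+ j.+1)).
  case: j => [|j].
    have -> : (fun eta => (b / (a + b * eta)) ^+ 0) = fun=> 1 by apply/funext => x; rewrite expr0.
    by apply: (der_eq (der_cst 1 eta)); rewrite mul0r oppr0.
  by apply: (der_eq (derX j dinv)); rewrite !exprS; ring.
apply: (der_eq (derM (derM (der_cst _ eta) dpow) dexp)).
rewrite /G factS natrM/= exprS.
have c0 : hyp01_coef nu j != 0 by rewrite gt_eqF// hyp01_coef_gt0.
have j0 : j`!%:R != 0 :> R by rewrite pnatr_eq0 -lt0n fact_gt0.
have n0 : nu + j%:R != 0 by rewrite gt_eqF// ltr_wpDr.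
have j1 : j.+1%:R != 0 :> R by [].
move: (hyp01_coef nu j) (j`!%:R) (j.+1%:R) c0 j0 j1 (b / _) (_ ^+ j) (expR _) => u v s u0 v0 s0 z y x.
by field; rewrite s0 v0 u0 n0.
Qed.

(** Differentiating the Laplace transform j times in eta under the integral sign; the right-hand
    side reproduces itself with the coefficient nu (nu + 1) ... (nu + j - 1), written
    1 / (hyp01_coef nu j * j!). *)
Let gamma_moment j eta : 0 < eta -> F j eta = G j eta.
Proof.
elim: j eta => [|j ih] eta e0.
  rewrite /F /G /f/= fact0 !mul1r ?invr1 expr0 !mulr1 -lap//.
  by apply: eq_Rintegral => w _; rewrite expr0 mul1r.
have FG : \forall x \near eta, F j x = G j x.
  by near=> x; apply: ih; near: x; exact: near_gt0.
apply: oppr_inj; rewrite -(der_derive1 (der_F j e0)) -(der_derive1 (der_G j e0)).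
by rewrite !derive1E; exact: near_eq_derive.
Unshelve. all: by end_near. Qed.

(** The rising factorials in the moments cancel those in the coefficients of 0F1, and the series
    collapses to an exponential. Monotone convergence justifies the summation. *)
Lemma gamma_moment_series c eta : 0 <= c -> 0 < eta ->
  (\int[P]_w (D w * expR (- (eta * W w)) * hyp01 nu (c * W w))%:E =
   (C * expR (- (nu * ln (a + b * eta))) * expR (c * (b / (a + b * eta))))%:E)%E.
Proof.
move=> c0 e0.
pose g (n : nat) (w : T) : R := D w * expR (- (eta * W w)) * pseries (hyp01_coef nu) (c * W w) n.
have gE n w : g n w = \sum_(0 <= j < n) (hyp01_coef nu j * c ^+ j) * f j eta w.
  rewrite /g /pseries /series/= mulr_sumr; apply: eq_bigr => j _.
  by rewrite /f exprMn; ring.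
have ig n : P.-integrable setT (EFin \o g n) /\
    \int[P]_w g n w = \sum_(0 <= j < n) (hyp01_coef nu j * c ^+ j) * G j eta.
  rewrite (funext (gE n)); elim: n => [|n [ih1 ih2]].
    under [X in EFin \o X]eq_fun do rewrite big_nil.
    under eq_Rintegral do rewrite big_nil.
    by rewrite big_nil; split; [exact: integrable0|exact: Rintegral_prob_cst].
  have E : (fun w => \sum_(0 <= j < n.+1) (hyp01_coef nu j * c ^+ j) * f j eta w) =
     (fun w => \sum_(0 <= j < n) (hyp01_coef nu j * c ^+ j) * f j eta w +
        (hyp01_coef nu n * c ^+ n) * f n eta w).
    by apply/funext => w; rewrite big_nat_recr.
  have i2 := integrableRM (hyp01_coef nu n * c ^+ n) measurableT (intf n e0).
  rewrite E; split; first exact: integrableRD.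
  rewrite RintegralD// ih2 big_nat_recr//= RintegralZl//; last exact: intf.
  by rewrite -gamma_moment.
have SE n : \sum_(0 <= j < n) (hyp01_coef nu j * c ^+ j) * G j eta =
    C * expR (- (nu * ln (a + b * eta))) * series (exp_coeff (c * (b / (a + b * eta)))) n.
  rewrite /series/= mulr_sumr; apply: eq_bigr => j _; rewrite /exp_coeff/= exprMn /G.
  have h1 : hyp01_coef nu j != 0 by rewrite gt_eqF// hyp01_coef_gt0.
  have h2 : j`!%:R != 0 :> R by rewrite pnatr_eq0 -lt0n fact_gt0.
  move: (expR _) (_ ^+ j) (_ ^+ j) (hyp01_coef nu j) (j`!%:R) h1 h2 => x y z u v u0 v0.
  by field; rewrite u0 v0.
have lim1 : (\int[P]_w (g n w)%:E @[n --> \oo] -->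
    (C * expR (- (nu * ln (a + b * eta))) * expR (c * (b / (a + b * eta))))%:E)%E.
  have E n : (\int[P]_w (g n w)%:E = (C * expR (- (nu * ln (a + b * eta))) *
      series (exp_coeff (c * (b / (a + b * eta)))) n)%:E)%E.
    by rewrite -SE -(ig n).2 fineK//; apply: integrable_fin_num => //; exact: (ig n).1.
  under eq_cvg do rewrite E.
  apply: cvg_EFin; first exact: nearW.
  by apply: cvgM; [exact: cvg_cst|exact: is_cvg_series_exp_coeff].
have cW0 w : 0 <= c * W w by rewrite mulr_ge0.
have De0 w : 0 <= D w * expR (- (eta * W w)).
  by have /andP[h _] := D01 w; rewrite mulr_ge0 ?expR_ge0.
have mg n : measurable_fun setT (EFin \o g n) := measurable_int P (ig n).1.
have g0 n w : setT w -> (0 <= (g n w)%:E)%E.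
  move=> _; rewrite lee_fin mulr_ge0// /pseries /series/=.
  by apply: sumr_ge0 => j _; rewrite mulr_ge0 ?exprn_ge0// ltW// hyp01_coef_gt0.
have gnd w : setT w -> nondecreasing_seq (fun n => (g n w)%:E).
  move=> _; apply/nondecreasing_seqP => n; rewrite lee_fin ler_wpM2l//.
  rewrite /pseries /series/= big_nat_recr//= lerDl.
  by rewrite mulr_ge0 ?exprn_ge0// ltW// hyp01_coef_gt0.
have lim2 := cvg_monotone_convergence measurableT mg g0 gnd.
have E : (fun w => limn (fun n => (g n w)%:E)) =
    (fun w => (D w * expR (- (eta * W w)) * hyp01 nu (c * W w))%:E).
  apply/funext => w; apply/cvg_lim => //; apply: cvg_EFin; first exact: nearW.
  by apply: cvgM; [exact: cvg_cst|exact: is_cvg_hyp01].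
rewrite E in lim2.
by rewrite -(cvg_lim _ (lim2 P))// (cvg_lim _ lim1).
Qed.

End gamma_moments.

(** * Laplace functionals with drift *)

Section laplace_functional.
Context {R : realType}.
Variables (P : probability (cpath R) R) (delta mu : R).
Hypothesis d0 : 0 < delta.
Hypothesis mu0 : 0 <= mu.
Hypothesis lawP : bessel_law delta mu 0 P.

(** The last weight is split off: the remaining weights and 1 / h(x_t) make up a bounded factor D,
    for which [multi_step_laplace] is the hypothesis of [gamma_moment_series]. *)
Lemma laplace_functional_hyp01 (c : R) s t theta : 0 <= c -> 0 < theta ->
  times_sorted (rcons s (t, theta)) -> weights_ge0 s ->
  let st := ric (rcons s (t, theta)) in
  (\int[P]_w (expR (- wsum (rcons s (t, theta)) w) / sq_bessel_h delta mu (pval w t ^+ 2) *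
     hyp01 (delta / 2) (c * pval w t ^+ 2))%:E =
   (expR (- (mu ^+ 2 / 2 * t)) * expR (- (delta / 2 * ln st.2.1)) *
     expR (c * (st.2.2 / st.2.1)))%:E)%E.
Proof.
move=> c0 th0 st0 ws st.
pose k w := sq_bessel_h delta mu (pval w t ^+ 2).
have k1 w : 1 <= k w by apply: sq_bessel_h_ge1 => //; exact: sqr_ge0.
pose D w := expR (- wsum s w) / k w.
have [sts stt] := times_sorted_rcons st0.
have [a1 _] := ric_ge sts ws.
have [_ b0] : 1 <= (ric (rcons s (t, theta))).2.1 /\ 0 <= (ric (rcons s (t, theta))).2.2.
  by apply: ric_ge => //; rewrite /weights_ge0 all_rcons/= (ltW th0).
have stE th : ric (rcons s (t, th)) = (t, ((ric s).2.1 + th * st.2.2, st.2.2)).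
  by rewrite /st !ric_rcons.
have mk : measurable_fun setT k.
  apply: (@measurableT_comp _ _ _ _ _ _ (sq_bessel_h delta mu)).
    apply: continuous_measurable_fun; exact: sq_bessel_h_continuous.
  by apply: measurable_funX; exact: measurable_pval.
have mW : measurable_fun setT (fun w : cpath R => pval w t ^+ 2).
  by apply: measurable_funX; exact: measurable_pval.
have mD : measurable_fun setT D.
  apply: measurable_funM.
    exact: measurable_exp_wsum.
  apply: (@measurableT_comp _ _ _ _ _ _ (fun y : R => (sq_bessel_h delta mu (y ^+ 2))^-1)).
    apply: continuous_measurable_fun => y; apply: cvgV.
      by rewrite gt_eqF// sq_bessel_h_gt0// sqr_ge0.
    apply: (@continuous_comp _ _ _ (fun y : R => y ^+ 2) (sq_bessel_h delta mu)).
      exact: exprn_continuous.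
    exact: sq_bessel_h_continuous.
  exact: measurable_pval.
have D01 w : 0 <= D w <= 1.
  have k0 : 0 < k w by exact: lt_le_trans (k1 w).
  rewrite /D divr_ge0 ?expR_ge0 ?(ltW k0)//= ler_pdivrMr// mul1r (le_trans _ (k1 w))//.
  by rewrite -[leRHS]expR0 ler_expR oppr_le0 wsum_ge0.
have lap eta : 0 < eta -> \int[P]_w (D w * expR (- (eta * pval w t ^+ 2))) =
    expR (- (mu ^+ 2 / 2 * t)) * expR (- (delta / 2 * ln ((ric s).2.1 + st.2.2 * eta))).
  move=> e0; have st1 : times_sorted (rcons s (t, eta)).
    by move: st0; rewrite /times_sorted !map_rcons.
  have h := multi_step_laplace d0 mu0 lawP e0 st1 ws.
  rewrite stE /= [eta * _]mulrC in h; rewrite -h mulrA -expRD addNr expR0 mul1r.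
  by apply: eq_Rintegral => w _; rewrite wsum_rcons /D /k/= opprD expRD mulrAC.
have a0 : 0 < (ric s).2.1 by exact: lt_le_trans a1.
have n0 : 0 < delta / 2 by rewrite divr_gt0.
have := gamma_moment_series mD mW D01 (fun w => sqr_ge0 _) n0 a0 b0 lap c0 th0.
rewrite [st.2.2 * theta]mulrC.
have -> : (ric s).2.1 + theta * st.2.2 = st.2.1 by rewrite {2}/st stE.
move=> <-; apply: eq_integral => w _; congr EFin.
by rewrite wsum_rcons /D /k/= opprD expRD; congr (_ * _); rewrite mulrAC.
Qed.

(** For c = mu^2 / 4 the series is h(x_t) itself and cancels the denominator. *)
Lemma laplace_functional s t theta : 0 < theta ->
  times_sorted (rcons s (t, theta)) -> weights_ge0 s ->
  let st := ric (rcons s (t, theta)) in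
  (\int[P]_w (expR (- wsum (rcons s (t, theta)) w))%:E =
   (expR (- (mu ^+ 2 / 2 * t)) * expR (- (delta / 2 * ln st.2.1)) *
     expR (mu ^+ 2 / 4 * (st.2.2 / st.2.1)))%:E)%E.
Proof.
move=> th0 st0 ws st.
have c0 : 0 <= mu ^+ 2 / 4 by rewrite divr_ge0// sqr_ge0.
rewrite -(laplace_functional_hyp01 c0 th0 st0 ws); apply: eq_integral => w _; congr EFin.
rewrite /sq_bessel_h divfK// gt_eqF//.
exact: (sq_bessel_h_gt0 mu d0 (sqr_ge0 (pval w t))).
Qed.

End laplace_functional.

(** The same moments, now those of the drift-free law, integrated against the Doob function of the
    drift mu. *)
Lemma laplace_functional_density {R : realType} (P : probability (cpath R) R) (delta mu : R)
    s t theta : 0 < delta -> bessel_law delta 0 0 P -> 0 < theta ->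
  times_sorted (rcons s (t, theta)) -> weights_ge0 s ->
  let st := ric (rcons s (t, theta)) in
  (\int[P]_w (expR (- wsum (rcons s (t, theta)) w) * sq_bessel_h delta mu (pval w t ^+ 2))%:E =
   (expR (- (delta / 2 * ln st.2.1)) * expR (mu ^+ 2 / 4 * (st.2.2 / st.2.1)))%:E)%E.
Proof.
move=> d0 lawP th0 st0 ws st.
have c0 : 0 <= mu ^+ 2 / 4 by rewrite divr_ge0// sqr_ge0.
have := laplace_functional_hyp01 d0 (lexx 0) lawP c0 th0 st0 ws.
rewrite expr0n/= !mul0r oppr0 expR0 mul1r => <-.
apply: eq_integral => w _; congr EFin.
by rewrite sq_bessel_h_nodrift divr1.
Qed.

(** * Laplace functionals determine laws *)

Section exponential_step.
Context {R : realType}.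
Implicit Types (q y : R) (N j : nat).

Lemma bernoulli_le q N : 0 <= q <= 1 -> 1 - N%:R * q <= (1 - q) ^+ N.
Proof.
move=> /andP[q0 q1]; elim: N => [|N ih]; first by rewrite mul0r subr0 expr0.
have q2 : 0 <= 1 - q by rewrite subr_ge0.
rewrite exprS (le_trans _ (ler_wpM2l q2 ih))// -natr1.
have : 0 <= N%:R * q * q by rewrite mulr_ge0// mulr_ge0.
by lra.
Qed.

Lemma bernoulli_ge q N : 0 <= q <= 1 -> (1 - q) ^+ N * (1 + N%:R * q) <= 1.
Proof.
move=> /andP[q0 q1]; elim: N => [|N ih]; first by rewrite mul0r addr0 expr0 mul1r.
have q2 : 0 <= 1 - q by rewrite subr_ge0.
apply: le_trans ih; rewrite exprS mulrAC mulrC ler_wpM2l ?exprn_ge0//.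
rewrite -natr1; have : 0 <= N%:R * q * q by rewrite mulr_ge0// mulr_ge0.
have : 0 <= q * q by rewrite mulr_ge0.
by lra.
Qed.

Definition step_rate j : R := (j ^ 2)%:R * ln 2 + j%:R.

(** With q = exp(- (j^2 ln 2 + j) y), a polynomial in q that tends to the indicator of y < 1: the
    exponent is chosen so that 2^(j^2) q = exp(j^2 ln 2 (1 - y) - j y) tends to infinity if
    y < 1 and to 0 otherwise, the value y = 1 included. *)
Definition expstep j y : R := 1 - (1 - expR (- (step_rate j * y))) ^+ (2 ^ (j ^ 2)).

Lemma ln2_gt0 : 0 < ln 2 :> R.
Proof. by rewrite ln_gt0// ltr1n. Qed.

Lemma step_rate_ge0 j : 0 <= step_rate j.
Proof. by rewrite /step_rate addr_ge0// mulr_ge0// ltW// ln2_gt0. Qed.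

Lemma expstep_bound j y : 0 <= y -> 0 <= expstep j y <= 1.
Proof.
move=> y0; have q0 : 0 <= 1 - expR (- (step_rate j * y)) <= 1.
  rewrite subr_ge0 -[X in _ <= X]expR0 ler_expR oppr_le0 (mulr_ge0 (step_rate_ge0 j) y0)/=.
  by rewrite gerBl expR_ge0.
have /andP[q1 q2] := q0.
by rewrite /expstep subr_ge0 exprn_ile1//= gerBl exprn_ge0.
Qed.

(** Bernoulli inequalities bound the distance to the limit by 1 / (j + 1) in both cases. *)
Lemma cvg_expstep y : 0 <= y -> expstep j y @[j --> \oo] --> ((y < 1)%R%:R : R).
Proof.
move=> y0; pose q j := expR (- (step_rate j * y)).
have q01 j : 0 <= q j <= 1.
  by rewrite expR_ge0/= -[leRHS]expR0 ler_expR oppr_le0 (mulr_ge0 (step_rate_ge0 j) y0).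
have Nq j : (2 ^ (j ^ 2))%:R * q j = expR ((j ^ 2)%:R * ln 2 - step_rate j * y).
  by rewrite expRD expRM_natl lnK ?posrE// natrX.
have harm : (j.+1%:R)^-1 @[j --> \oo] --> (0 : R) by exact: cvg_harmonic.
suff H : \forall j \near \oo, `|expstep j y - (y < 1)%R%:R| <= (j.+1%:R)^-1.
  apply: (@cvg_sub0 _ _ _ _ _ _ (cst ((y < 1)%R%:R : R))); last exact: cvg_cst.
  apply/cvgr0Pnorm_le => e e0.
  have /cvgr0Pnorm_le/(_ _ e0) harm' := harm.
  near=> j; rewrite (@le_trans _ _ ((j.+1%:R)^-1))//; first by near: j; exact: H.
  by near: j; apply: filterS harm' => j; apply: le_trans; exact: ler_norm.
case: (ltP y 1) => y1/=.
  (* for j >= (y + 1) / c the exponent j (j c - y) exceeds j *)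
  pose c := ln 2 * (1 - y).
  have c0 : 0 < c by rewrite mulr_gt0 ?ln2_gt0// subr_gt0.
  near=> j; have jc : (y + 1) / c <= j%:R by near: j; exact: nbhs_infty_ger.
  have hj : j.+1%:R <= 1 + (2 ^ (j ^ 2))%:R * q j.
    rewrite -natr1 addrC lerD2l Nq (@le_trans _ _ (expR j%:R))//.
      by apply: le_trans (expR_ge1Dx _); rewrite lerDr.
    rewrite ler_expR /step_rate natrX.
    have : (y + 1) <= j%:R * c by rewrite -ler_pdivrMr.
    move=> /(ler_wpM2l (ler0n R j)); rewrite /c; lra.
  have [/andP[e0 e1] b] := (expstep_bound j y0, bernoulli_ge (2 ^ (j ^ 2)) (q01 j)).
  rewrite distrC ger0_norm ?subr_ge0// /expstep opprB addrC subrK -/(q j).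
  rewrite -[leRHS]mul1r ler_pdivlMr ?ltr0n// (le_trans _ b)// ler_wpM2l// exprn_ge0// subr_ge0.
  by have /andP[] := q01 j.
near=> j; have /andP[e0 e1] := expstep_bound j y0.
rewrite subr0 ger0_norm// /expstep -/(q j) lerBlDr -lerBlDl.
apply: le_trans (bernoulli_le (2 ^ (j ^ 2)) (q01 j)); rewrite lerD2l lerN2 Nq.
rewrite (@le_trans _ _ (expR (- j%:R)))//.
  have s0 := step_rate_ge0 j; rewrite ler_expR.
  have : step_rate j * 1 <= step_rate j * y by rewrite ler_wpM2l.
  by rewrite {1}/step_rate; lra.
by rewrite expRN lef_pV2 ?posrE ?expR_gt0// (le_trans _ (expR_ge1Dx _))// -natr1 addrC.
Unshelve. all: by end_near. Qed.

End exponential_step.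

Section laplace_uniqueness.
Context {R : realType}.
Variables (t : R).
Implicit Types (s : seq (R * R)).

Definition times_within s := all (fun p : R * R => 0 <= p.1 <= t) s.

(** Functionals whose integrals are determined by Laplace functionals. They form an algebra, as
    the product of two exponentials is the exponential of the concatenated lists. *)
Inductive exp_algebra : (cpath R -> R) -> Prop :=
| exp_algebra_exp s : weights_ge0 s -> times_within s ->
    exp_algebra (fun w : cpath R => expR (- wsum s w))
| exp_algebra_lin c xi eta : exp_algebra xi -> exp_algebra eta ->
    exp_algebra (fun w : cpath R => xi w + c * eta w).

Lemma exp_algebra_cst c : exp_algebra (fun=> c).
Proof.
have h1 : exp_algebra ((fun=> 1) : cpath R -> R).
  suff -> : ((fun=> 1) : cpath R -> R) = (fun w : cpath R => expR (- wsum [::] w)) by exact: exp_algebra_exp.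
  by apply/funext => w; rewrite wsum_nil /cst oppr0 expR0.
suff -> : ((fun=> c) : cpath R -> R) = (fun w : cpath R => 1 + (c - 1) * 1) by exact: exp_algebra_lin.
by apply/funext => w; rewrite mulr1 addrC subrK.
Qed.

Lemma exp_algebraM xi eta : exp_algebra xi -> exp_algebra eta ->
  exp_algebra (fun w : cpath R => xi w * eta w).
Proof.
move=> hx; elim: hx eta => [s ws st|c xi1 xi2 _ ih1 _ ih2] eta he.
  elim: he => [s' ws' st'|c e1 e2 _ ih1 _ ih2].
    suff -> : (fun w : cpath R => expR (- wsum s w) * expR (- wsum s' w)) =
       (fun w : cpath R => expR (- wsum (s ++ s') w)).
      by apply: exp_algebra_exp; rewrite /weights_ge0 /times_within all_cat; apply/andP.
    by apply/funext => w; rewrite -expRD /wsum big_cat/= opprD.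
  suff -> : (fun w : cpath R => expR (- wsum s w) * (e1 w + c * e2 w)) =
     (fun w : cpath R => expR (- wsum s w) * e1 w + c * (expR (- wsum s w) * e2 w)).
    exact: exp_algebra_lin.
  by apply/funext => w; ring.
suff -> : (fun w : cpath R => (xi1 w + c * xi2 w) * eta w) = (fun w : cpath R => xi1 w * eta w + c * (xi2 w * eta w)).
  by apply: exp_algebra_lin; [exact: ih1|exact: ih2].
by apply/funext => w; ring.
Qed.

Lemma exp_algebraX xi n : exp_algebra xi -> exp_algebra (fun w : cpath R => xi w ^+ n).
Proof.
move=> h; elim: n => [|n ih]; first exact: (exp_algebra_cst 1).
suff -> : (fun w : cpath R => xi w ^+ n.+1) = (fun w : cpath R => xi w * xi w ^+ n) by exact: exp_algebraM.
by apply/funext => w; rewrite exprS.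
Qed.

Lemma exp_algebra_compl xi : exp_algebra xi -> exp_algebra (fun w : cpath R => 1 - xi w).
Proof.
move=> h; suff -> : (fun w : cpath R => 1 - xi w) = (fun w : cpath R => 1 + (-1) * xi w).
  by apply: exp_algebra_lin => //; exact: (exp_algebra_cst 1).
by apply/funext => w; rewrite mulN1r.
Qed.

Definition box s : set (cpath R) := [set w | all (fun p => w p.1 < p.2) s].

Definition smooth_box j s (w : cpath R) : R :=
  \prod_(p <- s) (if 0 < p.2 then expstep j (pval w p.1 ^+ 2 / p.2 ^+ 2) else 0).

(** On nonnegative paths, w r < a can hold only if 0 < a, and then reads x_r / a^2 < 1. *)
Definition box_indic s (w : cpath R) : R :=
  \prod_(p <- s) (if 0 < p.2 then (pval w p.1 ^+ 2 / p.2 ^+ 2 < 1)%R%:R else 0).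

Lemma exp_algebra_smooth_box j s : times_within s -> exp_algebra (smooth_box j s).
Proof.
elim: s => [_|p s ih /andP[p0 st]].
  suff -> : smooth_box j [::] = (fun=> 1) by exact: exp_algebra_cst.
  by apply/funext => w; rewrite /smooth_box big_nil.
have -> : smooth_box j (p :: s) = (fun w : cpath R =>
    (if 0 < p.2 then expstep j (pval w p.1 ^+ 2 / p.2 ^+ 2) else 0) * smooth_box j s w).
  by apply/funext => w; rewrite /smooth_box big_cons.
apply: exp_algebraM; last exact: ih.
case: (boolP (0 < p.2)) => p2; last exact: exp_algebra_cst.
apply/exp_algebra_compl/exp_algebraX/exp_algebra_compl.
suff -> : (fun w : cpath R => expR (- (step_rate j * (pval w p.1 ^+ 2 / p.2 ^+ 2)))) =
    (fun w : cpath R => expR (- wsum [:: (p.1, step_rate j / p.2 ^+ 2)] w)).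
  apply: exp_algebra_exp; rewrite /weights_ge0 /times_within/= andbT//.
  by rewrite divr_ge0 ?step_rate_ge0// sqr_ge0.
by apply/funext => w; rewrite wsum_cons wsum_nil /cst addr0/= mulrA mulrAC.
Qed.

Lemma cvg_smooth_box s w : smooth_box j s w @[j --> \oo] --> box_indic s w.
Proof.
elim: s => [|p s ih].
  by rewrite /smooth_box /box_indic big_nil; under eq_fun do rewrite big_nil; exact: cvg_cst.
rewrite /box_indic big_cons; under eq_fun do rewrite /smooth_box big_cons.
apply: cvgM; last exact: ih.
case: ifPn => p2; last exact: cvg_cst.
by apply: cvg_expstep; rewrite divr_ge0 ?sqr_ge0.
Qed.

Lemma smooth_box_bound j s w : `|smooth_box j s w| <= 1.
Proof.
rewrite /smooth_box; elim: s => [|p s ih]; first by rewrite big_nil normr1.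
rewrite big_cons normrM -[leRHS]mulr1 ler_pM//.
case: ifPn => p2; last by rewrite normr0.
have /andP[h1 h2] := @expstep_bound R j (pval w p.1 ^+ 2 / p.2 ^+ 2) (divr_ge0 (sqr_ge0 _) (sqr_ge0 _)).
by rewrite ger0_norm.
Qed.

Lemma box_indicE s (w : cpath R) : times_within s -> (forall r : R, 0 <= r -> 0 <= w r) ->
  box_indic s w = \1_(box s) w.
Proof.
move=> + w0; rewrite indicE; elim: s => [_|p s ih /andP[/andP[p0 _] st]].
  by rewrite /box_indic big_nil mem_set.
rewrite /box_indic big_cons -/(box_indic s w) (ih st).
have -> : (w \in box (p :: s)) = (w p.1 < p.2) && (w \in box s).
  apply/idP/idP => [/set_mem/= /andP[-> h]/=|/andP[h1 /set_mem h2]].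
    exact: mem_set.
  by apply: mem_set; rewrite /box/= h1.
have hw := w0 _ p0.
case: ifPn => p2; last first.
  rewrite -leNgt in p2; rewrite mul0r ltNge (le_trans p2 hw)//.
rewrite -natrM mulnb; congr ((nat_of_bool (_ && _))%:R).
rewrite pvalE// ltr_pdivrMr ?exprn_gt0// mul1r ltr_sqr//.
by rewrite nnegrE ltW.
Qed.

End laplace_uniqueness.

Section density_measure.
Context d (T : measurableType d) {R : realType}.
Variables (m : measure T R) (f : T -> R).
Hypothesis f0 : forall x, 0 <= f x.
Hypothesis mf : measurable_fun setT f.

Definition density_measure of (forall x, 0 <= f x) & measurable_fun setT f :=
  fun A : set T => (\int[m]_(x in A) (f x)%:E)%E.

Local Notation nu := (density_measure f0 mf).

Let nu0 : nu set0 = 0%E. Proof. exact: integral_set0. Qed.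

Let nu_ge0 A : (0 <= nu A)%E.
Proof. by apply: integral_ge0 => x _; rewrite lee_fin. Qed.

Let nu_sigma_additive : semi_sigma_additive nu.
Proof.
move=> F mF tF mUF; rewrite /density_measure ge0_integral_bigcup//; last 2 first.
- by apply/measurable_EFinP; exact: measurable_funTS.
- by move=> x _; rewrite lee_fin.
by apply: is_cvg_nneseries => n _ _; exact: nu_ge0.
Qed.

HB.instance Definition _ := isMeasure.Build _ _ _ nu nu0 nu_ge0 nu_sigma_additive.

End density_measure.

Section laplace_determines_density.
Context {R : realType}.
Variables (t : R).

Lemma exp_algebra_integrable (P : probability (cpath R) R) (f xi : cpath R -> R) :
  P.-integrable setT (EFin \o f) -> exp_algebra t xi ->
  [/\ measurable_fun setT xi, exists M, forall w, `|xi w| <= M &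
    P.-integrable setT (EFin \o (fun w => xi w * f w))].
Proof.
move=> fi h; have [m1 b1] : measurable_fun setT xi /\ exists M, forall w, `|xi w| <= M.
  elim: h => [s ws st|c x1 x2 _ [m1 [M1 b1]] _ [m2 [M2 b2]]].
    split; last by exists 1 => w; exact: expR_wsum_bound.
    exact: measurable_exp_wsum.
  split; first by apply: measurable_funD => //; exact: measurable_funM.
  exists (M1 + `|c| * M2) => w; rewrite (le_trans (ler_normD _ _))// normrM lerD//.
  by rewrite ler_wpM2l.
split => //; have [M bM] := b1; apply: (@integrable_boundedM _ _ _ _ _ _ _ M) => //.
Qed.

Variables (P1 P2 : probability (cpath R) R) (f1 f2 : cpath R -> R).
Hypothesis f10 : forall w, 0 <= f1 w.
Hypothesis f20 : forall w, 0 <= f2 w.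
Hypothesis mf1 : measurable_fun setT f1.
Hypothesis mf2 : measurable_fun setT f2.
Hypothesis if1 : P1.-integrable setT (EFin \o f1).
Hypothesis if2 : P2.-integrable setT (EFin \o f2).
Hypothesis ae1 : {ae P1, forall w : cpath R, forall r : R, 0 <= r -> 0 <= w r}.
Hypothesis ae2 : {ae P2, forall w : cpath R, forall r : R, 0 <= r -> 0 <= w r}.
Hypothesis laplace_eq : forall s, weights_ge0 s -> times_within t s ->
  \int[P1]_w (expR (- wsum s w) * f1 w) = \int[P2]_w (expR (- wsum s w) * f2 w).

Let alg_eq xi : exp_algebra t xi -> \int[P1]_w (xi w * f1 w) = \int[P2]_w (xi w * f2 w).
Proof.
elim => [s ws st|c x1 x2 h1 e1 h2 e2]; first exact: laplace_eq.
have lin (P : probability (cpath R) R) f : P.-integrable setT (EFin \o f) ->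
    \int[P]_w ((x1 w + c * x2 w) * f w) = \int[P]_w (x1 w * f w) + c * \int[P]_w (x2 w * f w).
  move=> fi; have [[_ _ i1] [_ _ i2]] := (exp_algebra_integrable fi h1, exp_algebra_integrable fi h2).
  rewrite -RintegralZl// -RintegralD//; last exact: integrableRM.
  by apply: eq_Rintegral => w _; ring.
by rewrite !lin// e1 e2.
Qed.

Let cvg_box (P : probability (cpath R) R) f s : P.-integrable setT (EFin \o f) ->
  measurable_fun setT f -> (forall w, 0 <= f w) -> times_within t s ->
  \int[P]_w (smooth_box j s w * f w) @[j --> \oo] --> \int[P]_w (box_indic s w * f w).
Proof.
move=> fi mf f0 st; apply: (@dominated_cvg_Rintegral _ _ _ _ _ _ _ f) => //.
- move=> j; apply: measurable_funM => //.
  by have [] := exp_algebra_integrable fi (exp_algebra_smooth_box j st).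
- by move=> j w _; rewrite normrM (ger0_norm (f0 w)) -[leRHS]mul1r ler_wpM2r// smooth_box_bound.
- by move=> w _; apply: cvgM; [exact: cvg_smooth_box|exact: cvg_cst].
Qed.

Let measurable_box_indic s : times_within t s -> measurable_fun setT (@box_indic R s).
Proof.
move=> st; apply: (@measurable_fun_cvg _ _ _ _ (fun j => smooth_box j s)).
  by move=> j; have [] := exp_algebra_integrable if1 (exp_algebra_smooth_box j st).
by move=> w _; exact: cvg_smooth_box.
Qed.

Let measurable_box s : times_within t s -> measurable (@box R s).
Proof.
elim: s => [_|p s ih /andP[/andP[p0 pt] st]].
  rewrite (_ : box [::] = setT)//; by apply/seteqP; split.
rewrite (_ : box (p :: s) = [set w : cpath R | w p.1 < p.2] `&` box s); last first.
  apply/seteqP; split => [w /andP[h1 h2]|w [h1 h2]]; first by split.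
  by apply/andP; split.
apply: measurableI; last exact: ih.
have mp := measurable_pval p.1.
have := mp measurableT `]-oo, p.2[%classic (measurable_itv _).
congr (measurable _); apply/seteqP; split => w /=; rewrite in_itv/= pvalE//; first by case.
Qed.

Let integral_box (P : probability (cpath R) R) f s : measurable_fun setT f ->
  {ae P, forall w : cpath R, forall r : R, 0 <= r -> 0 <= w r} -> times_within t s ->
  P.-integrable setT (EFin \o f) ->
  (\int[P]_(w in box s) (f w)%:E = (\int[P]_w (box_indic s w * f w))%:E)%E.
Proof.
move=> mf ae st fi; rewrite fineK; last first.
  apply: integrable_fin_num => //; apply: (@integrable_boundedM _ _ _ _ _ _ _ 1) => //.
    exact: measurable_box_indic.
  move=> w _; have c : `|smooth_box j s w| @[j --> \oo] --> `|box_indic s w|.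
    by apply: cvg_norm; exact: cvg_smooth_box.
  rewrite -(cvg_lim (@Rhausdorff R) c); apply: limr_le; first exact: cvgP c.
  by apply: nearW => n; exact: smooth_box_bound.
rewrite [LHS]integral_mkcond; apply: (@ae_eq_integral _ _ _ P setT) => //.
- apply/(measurable_restrictT _ (measurable_box st)).
  by apply/measurable_EFinP; exact: measurable_funTS.
- by apply/measurable_EFinP; apply: measurable_funM => //; exact: measurable_box_indic.
apply: filterS ae => w w0 _; rewrite (box_indicE st w0) /patch indicE.
by case: ifPn => _; rewrite ?mul1r ?mul0r.
Qed.

(** The boxes form a pi-system generating the events up to time t, and their indicators are
    bounded limits of elements of [exp_algebra]. *)
Lemma laplace_determines_density A : 0 <= t -> canonical_filtration t A ->
  (\int[P1]_(w in A) (f1 w)%:E = \int[P2]_(w in A) (f2 w)%:E)%E.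
Proof.
move=> t0; pose G : set (set (cpath R)) := [set B | exists2 s, times_within t s & B = box s].
pose m1 := density_measure P1 f10 mf1; pose m2 := density_measure P2 f20 mf2.
have GT : G setT.
  by exists [::] => //; apply/seteqP; split.
suff GA : canonical_filtration t `<=` <<s G>>.
  move=> /GA; apply: (@g_sigma_algebra_measure_unique _ R _ G _ (fun=> setT) _ _ m1 m2) => //.
  - by move=> _ [s st ->]; exact: measurable_box.
  - by apply/seteqP; split => // w _; exists 0%N.
  - move=> _ _ [s st ->] [s' st' ->]; exists (s ++ s').
      by rewrite /times_within all_cat; apply/andP.
    by apply/seteqP; split => w; rewrite /box/= all_cat => /andP.
  - move=> _ [s st ->]; rewrite /= /m1 /m2 /density_measure !integral_box//; congr EFin.
    have c1 := cvg_box if1 mf1 f10 st; have c2 := cvg_box if2 mf2 f20 st.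
    apply: (@cvg_unique _ (@Rhausdorff R) _ _ _ _ c1).
    by rewrite /= (funext (fun j => alg_eq (exp_algebra_smooth_box j st))).
  - move=> k; rewrite /= /m1 /density_measure.
    by have := integrable_fin_num measurableT if1; rewrite fin_numE ltey => /andP[_].
apply: smallest_sub; first exact: smallest_sigma_algebra.
move=> B [r r0 [C mC <-]]; rewrite setTI.
have rt : 0 <= r <= t by move: r0; rewrite /= in_itv.
have : measurable_fun setT ((fun w => w r) : g_sigma_algebraType G -> R).
  apply: (measurability (@RGenInftyO.G R) (RGenInftyO.measurableE R)).
  move=> _ [_ [a ->] <-]; rewrite setTI; apply: sub_gen_smallest.
  exists [:: (r, a)]; first by rewrite /times_within/= rt.
  by apply/seteqP; split => w; rewrite /box/= in_itv/= andbT.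
by move=> /(_ measurableT _ mC); rewrite setTI.
Qed.

End laplace_determines_density.

(** * Averaging over the delay *)

Section delayed_times.
Context {R : realType}.
Implicit Types (s : seq (R * R)) (e : R).

(** The times at which the second process is seen when it starts with delay e. *)
Definition delay e s : seq (R * R) := [seq (Num.max 0 (p.1 - e), p.2) | p <- s].

Lemma weights_delay e s : weights_ge0 (delay e s) = weights_ge0 s.
Proof. by rewrite /weights_ge0 /delay all_map. Qed.

Lemma path_delay e u s : path <=%R u [seq p.1 | p <- s] ->
  path <=%R (Num.max 0 (u - e)) [seq p.1 | p <- delay e s].
Proof.
elim: s u => //= p s ih u /andP[up sp]; rewrite ih// andbT.
by rewrite ge_max le_max lexx/= le_max; apply/orP; right; rewrite lerD2r.
Qed.

Lemma times_sorted_delay e s : times_sorted s -> times_sorted (delay e s).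
Proof.
move=> /(path_delay e); apply: path_le; first exact: le_trans.
by rewrite le_max lexx.
Qed.

Lemma foldl_ric_linear s tau (al be : R) : (foldl ric_step (tau, (al, be)) s).2 =
  (al * (foldl ric_step (tau, (1, 0)) s).2.1 + be * (foldl ric_step (tau, (0, 1)) s).2.1,
   al * (foldl ric_step (tau, (1, 0)) s).2.2 + be * (foldl ric_step (tau, (0, 1)) s).2.2).
Proof.
elim: s tau al be => [|p s ih] tau al be; first by rewrite /= !mulr1 !mulr0 addr0 add0r.
rewrite /= /ric_step/= !(ih p.1 (_ + _ * _) _)/=.
by move: (foldl _ _ _) (foldl _ _ _) => [? [P1 P2]] [? [Q1 Q2]]/=; congr pair; ring.
Qed.

Lemma foldl_ric_wronskian s tau :
  let P := (foldl ric_step (tau, (1, 0)) s).2 in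
  let Q := (foldl ric_step (tau, (0, 1)) s).2 in P.1 * Q.2 - P.2 * Q.1 = 1 :> R.
Proof.
elim: s tau => [|p s ih] tau /=; first by rewrite mulr1 mulr0 subr0.
rewrite /ric_step/= !(foldl_ric_linear s p.1 (_ + _ * _) _)/=.
have /= := ih p.1; move: (foldl _ _ _) (foldl _ _ _) => [? [P1 P2]] [? [Q1 Q2]]/= h.
by rewrite -[RHS]h; ring.
Qed.

Lemma foldl_ric_shift s e tau v : all (fun p : R * R => e <= p.1) s ->
  (foldl ric_step (tau - e, v) (delay e s)).2 = (foldl ric_step (tau, v) s).2.
Proof.
elim: s tau v => //= p s ih tau v /andP[ep es].
have -> : Num.max 0 (p.1 - e) = p.1 - e by apply/max_idPr; rewrite subr_ge0.
by rewrite /ric_step/= opprB addrA subrK -ih.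
Qed.

Lemma path_all u s : path <=%R u [seq p.1 | p <- s] -> all (fun p : R * R => u <= p.1) s.
Proof.
rewrite path_sortedE; last exact: le_trans.
by move=> /andP[+ _]; rewrite all_map.
Qed.

Lemma all_times_le u v s : u <= v -> all (fun p : R * R => v <= p.1) s ->
  all (fun p : R * R => u <= p.1) s.
Proof. by move=> uv; apply: sub_all => p; exact: le_trans. Qed.

(** Until the first time r, delaying by e only changes the value b = 2 (r - e) found there. *)
Lemma ric_delay_before e p s : path <=%R p.1 [seq q.1 | q <- s] -> e <= p.1 ->
  (ric (delay e (p :: s))).2 = (foldl ric_step (p.1, (1, 2 * (p.1 - e))) (p :: s)).2.
Proof.
move=> ps ep; have es := all_times_le ep (path_all ps).
rewrite /ric/=.
have -> : Num.max 0 (p.1 - e) = p.1 - e by apply/max_idPr; rewrite subr_ge0.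
rewrite {1}/ric_step/= -(foldl_ric_shift _ _ es) /ric_step/= subr0 add0r subrr.
by rewrite mulr0 mul0r addr0 mulr1.
Qed.

Lemma ric_delay_after e p s : p.1 <= e -> ric (delay e (p :: s)) = ric (delay e s).
Proof.
move=> ep; rewrite /ric/=.
have -> : Num.max 0 (p.1 - e) = 0 by apply/max_idPl; rewrite subr_le0.
by rewrite /ric_step/= subr0 mulr0 mul0r addr0 mulr0 addr0.
Qed.

Lemma measurable_ric_delay s :
  measurable_fun setT (fun e => (ric (delay e s)).2.1) /\
  measurable_fun setT (fun e => (ric (delay e s)).2.2).
Proof.
suff H (st : R -> R * (R * R)) : measurable_fun setT (fun e => (st e).1) ->
   measurable_fun setT (fun e => (st e).2.1) -> measurable_fun setT (fun e => (st e).2.2) ->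
   measurable_fun setT (fun e => (foldl ric_step (st e) (delay e s)).2.1) /\
   measurable_fun setT (fun e => (foldl ric_step (st e) (delay e s)).2.2).
  by apply: (H (fun=> (0, (1, 0)))) => /=; exact: measurable_cst.
elim: s st => //= p s ih st m1 m2 m3.
have mt : measurable_fun setT (fun e => Num.max 0 (p.1 - e)).
  by apply: measurable_maxr => //; apply: measurable_funB.
have mb : measurable_fun setT (fun e => (st e).2.2 + 2 * (Num.max 0 (p.1 - e) - (st e).1) * (st e).2.1).
  apply: measurable_funD => //; apply: measurable_funM => //; apply: measurable_funM => //.
  exact: measurable_funB.
apply: (ih (fun e => ric_step (st e) (Num.max 0 (p.1 - e), p.2))) => //=.
by apply: measurable_funD => //; exact: measurable_funM.
Qed.

End delayed_times.

Section delayed_laplace.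
Context {R : realType}.
Variable nu : R.
Hypothesis nu0 : 0 < nu.
Implicit Types (s : seq (R * R)) (e t u : R).

(** Exponential density of rate nu at e, times the Laplace functional at the delayed times
    of the dimension 4 process with drift mu, where nu = mu^2 / 2. *)
Definition delay_density s t e : R :=
  nu * expR (- (nu * e)) * (expR (- (nu * Num.max 0 (t - e))) *
    expR (- (4 / 2 * ln (ric (delay e s)).2.1)) *
    expR (nu / 2 * ((ric (delay e s)).2.2 / (ric (delay e s)).2.1))).

Lemma delay_density_ge0 s t e : 0 <= delay_density s t e.
Proof. by rewrite /delay_density !mulr_ge0 ?expR_ge0// ltW. Qed.

Lemma delay_ge1 s e : times_sorted s -> weights_ge0 s -> 1 <= (ric (delay e s)).2.1.
Proof.
move=> ss ws; have sd := times_sorted_delay e ss.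
have wd : weights_ge0 (delay e s) by rewrite weights_delay.
by have [] := ric_ge sd wd.
Qed.

Lemma measurable_delay_density s t : times_sorted s -> weights_ge0 s ->
  measurable_fun setT (delay_density s t).
Proof.
move=> ss ws.
have mE (f : R -> R) : measurable_fun setT f -> measurable_fun setT (fun e => expR (f e)).
  by move=> mf; apply: (@measurableT_comp _ _ _ _ _ _ (@expR R)) => //; exact: measurable_expR.
have [ma mb] := measurable_ric_delay s.
have ml : measurable_fun setT (fun e => ln (ric (delay e s)).2.1).
  by apply: (@measurableT_comp _ _ _ _ _ _ (@ln R)) => //; exact: measurable_ln.
have mi : measurable_fun setT (fun e => ((ric (delay e s)).2.1)^-1).
  rewrite (_ : (fun e => _) = (fun e => expR (- ln (ric (delay e s)).2.1))).
    by apply: mE; exact: measurable_funN.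
  apply/funext => e; rewrite expRN lnK// posrE.
  by apply: lt_le_trans (delay_ge1 e ss ws).
apply: measurable_funM.
  by apply: measurable_funM => //; apply: mE; apply: measurable_funN; apply: measurable_funM.
apply: measurable_funM; last first.
  by apply: mE; apply: measurable_funM => //; apply: measurable_funM.
apply: measurable_funM; apply: mE; apply: measurable_funN; apply: measurable_funM => //.
by apply: measurable_maxr => //; apply: measurable_funB.
Qed.

Lemma exp_tail u : (\int[lebesgue_measure]_(e in `]u, +oo[) (nu * expR (- (nu * e)))%:E =
  (expR (- (nu * u)))%:E)%E.
Proof.
have dF (x : R) : is_derive x 1 (fun e : R => - expR (- (nu * e))) (nu * expR (- (nu * x))).
  apply: (der_eq (derN (der_expR (derN (der_linear nu x))))).
  by rewrite mulrN opprK mulrC.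
have cE : continuous (fun e : R => expR (- (nu * e))).
  by move=> x; exact: der_continuous (der_expR (derN (der_linear nu x))).
have cf : continuous (fun e : R => nu * expR (- (nu * e))).
  by move=> x; apply: cvgM; [exact: cvg_cst|exact: cE].
rewrite integral_itv_obnd_cbnd; last first.
  apply/measurable_EFinP; apply: measurable_funTS; exact: continuous_measurable_fun.
rewrite (@ge0_continuous_FTC2y _ _ (fun e => - expR (- (nu * e))) u 0).
- by rewrite EFinN oppeK add0e.
- by move=> x _; rewrite mulr_ge0 ?expR_ge0// ltW.
- exact: continuous_subspaceT.
- rewrite -oppr0; apply: cvgN.
  apply: (@cvg_comp _ _ _ (fun z => nu * z) (fun z => expR (- z)) _ (pinfty_nbhs R)); last exact: cvgr_expR.
  exact: gt0_cvgMry.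
- by move=> x _; have [] := dF x.
- by apply: cvgN; apply: cvg_at_right_filter; exact: cE.
- by move=> x _; exact: der_derive1 (dF x).
Qed.

(** The determinant of the linear system is 1, so that the derivative of b / a with respect to
    the delay is - 2 / a^2 between two times of the list. *)
Lemma integral_delay_density_before p s t u : u <= p.1 -> p.1 <= t -> 0 <= u ->
    path <=%R p.1 [seq q.1 | q <- s] -> weights_ge0 (p :: s) ->
  let v e := expR (nu / 2 * ((ric (delay e (p :: s))).2.2 / (ric (delay e (p :: s))).2.1)) in
  (\int[lebesgue_measure]_(e in `]u, p.1]) (delay_density (p :: s) t e)%:E =
   (expR (- (nu * t)) * v u - expR (- (nu * t)) * v p.1)%:E)%E.
Proof.
move=> up pt u0 ps ws v.
have ss : times_sorted (p :: s) by rewrite /times_sorted/= (le_trans u0 up) ps.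
have [<-|up'] := eqVneq u p.1.
  by rewrite subrr (_ : [set` _] = set0) ?integral_set0// set_itvoc0.
have {up'}up' : u < p.1 by rewrite lt_neqAle up'.
set P := (foldl ric_step (p.1, (1, 0)) (p :: s)).2.
set Q := (foldl ric_step (p.1, (0, 1)) (p :: s)).2.
have W : P.1 * Q.2 - P.2 * Q.1 = 1 by exact: foldl_ric_wronskian.
have ricE e : e <= p.1 -> (ric (delay e (p :: s))).2 =
    (P.1 + 2 * (p.1 - e) * Q.1, P.2 + 2 * (p.1 - e) * Q.2).
  by move=> ep; rewrite ric_delay_before// foldl_ric_linear !mul1r.
pose A e := P.1 + 2 * (p.1 - e) * Q.1; pose B e := P.2 + 2 * (p.1 - e) * Q.2.
pose F e := - (expR (- (nu * t)) * expR (nu / 2 * (B e / A e))).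
pose f e := expR (- (nu * t)) * (nu * (expR (nu / 2 * (B e / A e)) / A e ^+ 2)).
have A1 e : e <= p.1 -> 1 <= A e.
  by move=> ep; have := delay_ge1 e ss ws; rewrite ricE.
have A0 e : e <= p.1 -> A e != 0 by move=> /A1 h; rewrite gt_eqF// (lt_le_trans _ h).
have dlin c (e : R) : is_derive e 1 (fun e : R => 2 * (p.1 - e) * c) (- (2 * c)).
  apply: (der_eq (derM (derM (der_cst 2 e) (derB (der_cst p.1 e) (der_id e))) (der_cst c e))).
  by ring.
have dA (e : R) : is_derive e 1 A (- (2 * Q.1)).
  by apply: (der_eq (derD (der_cst P.1 e) (dlin Q.1 e))); rewrite add0r.
have dB (e : R) : is_derive e 1 B (- (2 * Q.2)).
  by apply: (der_eq (derD (der_cst P.2 e) (dlin Q.2 e))); rewrite add0r.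
have dF (e : R) : e <= p.1 -> is_derive e 1 F (f e).
  move=> ep; have a0 := A0 e ep.
  apply: (der_eq (derN (derM (der_cst (expR (- (nu * t))) e)
    (der_expR (derM (der_cst (nu / 2) e) (derM (dB e) (derV (dA e) a0))))))).
  (* the numerator of the derivative of B / A is - 2 times the determinant *)
  have H : - (2 * Q.2) * A e + B e * (2 * Q.1) = - 2.
    transitivity (- (2 * (P.1 * Q.2 - P.2 * Q.1))); first by rewrite /A /B; ring.
    by rewrite W mulr1.
  rewrite /f; move: (expR (- (nu * t))) (expR (nu / 2 * (B e / A e))) => x y.
  transitivity (- (x * (y * (nu / 2 * ((- (2 * Q.2) * A e + B e * (2 * Q.1)) / A e ^+ 2))))).
    by field.
  by rewrite H; field.
have cF (e : R) : e <= p.1 -> {for e, continuous F}.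
  by move=> ep; exact: der_continuous (dF e ep).
have cf (e : R) : e <= p.1 -> {for e, continuous f}.
  move=> ep; have a0 := A0 e ep.
  have cA := der_continuous (dA e); have cB := der_continuous (dB e).
  apply: cvgM; first exact: cvg_cst.
  apply: cvgM; first exact: cvg_cst.
  apply: cvgM.
    apply: (@continuous_comp _ _ _ (fun e => nu / 2 * (B e / A e)) (@expR R)); last exact: continuous_expR.
    by apply: cvgM; [exact: cvg_cst|apply: cvgM; [exact: cB|apply: cvgV]].
  by apply: cvgV; [rewrite expf_neq0|apply: (@continuous_comp _ _ _ A (fun y => y ^+ 2)) => //; exact: exprn_continuous].
have m1 : measurable_fun `]u, p.1] (fun e => (delay_density (p :: s) t e)%:E).
  by apply/measurable_EFinP; apply: measurable_funTS; exact: measurable_delay_density.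
rewrite integral_itv_obnd_cbnd//.
have -> : (\int[lebesgue_measure]_(e in `[u, p.1]) (delay_density (p :: s) t e)%:E)%E =
    (\int[lebesgue_measure]_(e in `[u, p.1]) (f e)%:E)%E.
  apply: eq_integral => e; rewrite inE/= in_itv/= => /andP[ue ep]; congr EFin.
  rewrite /delay_density (ricE e ep)/= -/(A e) -/(B e).
  have -> : Num.max 0 (t - e) = t - e by apply/max_idPr; rewrite subr_ge0 (le_trans ep).
  have -> : expR (- (4 / 2 * ln (A e))) = (A e ^+ 2)^-1.
    rewrite (_ : 4 / 2 = 2%:R :> R); last by field.
    by rewrite expRN expRM_natl lnK// posrE (lt_le_trans _ (A1 e ep)).
  by rewrite /f (_ : expR (- (nu * t)) = expR (- (nu * e)) * expR (- (nu * (t - e))));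
    [ring|rewrite -expRD; congr expR; ring].
have itvle e : e \in `]u, p.1[ -> e <= p.1 by rewrite in_itv/= => /andP[_ /ltW].
rewrite (@continuous_FTC2 _ f F u p.1 up').
- by rewrite -EFinB /F /v !ricE//= opprK addrC.
- apply: continuous_in_subspaceT => e; rewrite inE/= in_itv/= => /andP[_]; exact: cf.
- split.
  + by move=> e /itvle h; have [] := dF e h.
  + by apply: cvg_at_right_filter; exact: cF.
  + by apply: cvg_at_left_filter; exact: cF.
- by move=> e /itvle h; exact: der_derive1 (dF e h).
Qed.

(** Induction on the list, cutting the integral at the first time r: for e > r this time is
    delayed to 0 and disappears from the list, since b = 0 there. *)
Lemma integral_delay_density s u : 0 <= u -> path <=%R u [seq q.1 | q <- s] ->
    weights_ge0 s ->
  let t := last u [seq q.1 | q <- s] in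
  (\int[lebesgue_measure]_(e in `]u, +oo[) (delay_density s t e)%:E =
   (expR (- (nu * t)) * expR (nu / 2 * ((ric (delay u s)).2.2 / (ric (delay u s)).2.1)))%:E)%E.
Proof.
elim: s u => [|p s ih] u u0.
  move=> _ _ /=; rewrite divr1 mulr0 expR0 mulr1 -exp_tail; apply: eq_integral => e.
  rewrite inE/= in_itv/= andbT => /ltW ue; congr EFin.
  rewrite /delay_density/= ln1 mulr0 oppr0 expR0 divr1 mulr0 expR0 !mulr1.
  have -> : Num.max 0 (u - e) = 0 by apply/max_idPl; rewrite subr_le0.
  by rewrite mulr0 oppr0 expR0 mulr1.
rewrite map_cons [path _ _ _]/= => /andP[up ps] ws t.
have pt : p.1 <= t.
  have := ps; rewrite path_sortedE; last exact: le_trans.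
  by move=> /andP[/allP h _]; have := mem_last p.1 [seq q.1 | q <- s]; rewrite inE => /predU1P[h'|/h//]; rewrite /t/= h'.
have p0 : 0 <= p.1 by exact: le_trans up.
have ss : times_sorted (p :: s) by rewrite /times_sorted/= p0 ps.
have -> : `]u, +oo[%classic = `]u, p.1] `|` `]p.1, +oo[ :> set R by apply: itv_bndbnd_setU.
have mf D : measurable_fun D (fun e => (delay_density (p :: s) t e)%:E).
  by apply/measurable_EFinP; apply: measurable_funTS; exact: measurable_delay_density.
rewrite ge0_integral_setU//; last 3 first.
- exact: mf.
- by move=> x _; rewrite lee_fin delay_density_ge0.
- apply/disj_setPS => x [/=]; rewrite !in_itv/= andbT => /andP[_ h1] h2.
  by have := lt_le_trans h2 h1; rewrite ltxx.
rewrite integral_delay_density_before//.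
have -> : (\int[lebesgue_measure]_(e in `]p.1, +oo[) (delay_density (p :: s) t e)%:E)%E =
    (\int[lebesgue_measure]_(e in `]p.1, +oo[) (delay_density s t e)%:E)%E.
  apply: eq_integral => e; rewrite inE/= in_itv/= andbT => /ltW pe.
  by rewrite /delay_density ric_delay_after.
have /andP[_ ws'] := ws.
by rewrite (ih _ p0 ps ws') -EFinD (ric_delay_after s (lexx p.1)) subrK.
Qed.

End delayed_laplace.

(** * Integrals with respect to laws; independence *)

Section law_integrals.
Context {R : realType} d d' (T : measurableType d) (T' : measurableType d').

Lemma law_integral (m : {measure set T -> \bar R}) (Q : {measure set T' -> \bar R})
    (Z : T -> T') (f : T' -> \bar R) : measurable_fun setT Z ->
  (forall A, measurable A -> Q A = m (Z @^-1` A)) ->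
  measurable_fun setT f -> (forall x, 0 <= f x)%E ->
  (\int[Q]_x f x = \int[m]_x f (Z x))%E.
Proof.
move=> mZ QZ mf f0.
rewrite (@eq_measure_integral _ _ _ _ (pushforward m Z)).
  by rewrite ge0_integral_pushforward.
by move=> A mA _; rewrite QZ.
Qed.

Lemma image_measure (m : {measure set T -> \bar R}) (Z : T -> T') : measurable_fun setT Z ->
  exists m' : {measure set T' -> \bar R}, forall A, m' A = m (Z @^-1` A).
Proof. by move=> mZ; unshelve eexists (pushforward m Z : {measure set T' -> \bar R}). Qed.

Lemma image_law (P : probability T R) (Z : T -> T') : measurable_fun setT Z ->
  exists Q : probability T' R, forall A, Q A = P (Z @^-1` A).
Proof.
move=> mZ; have mZ' : Z \in mfun by rewrite inE.
by exists (distribution P (mfun_Sub mZ')) => A; rewrite /distribution /pushforward.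
Qed.

Import HBNNSimple.

(** Approximation of h by simple functions. *)
Lemma density_integral (m Q : {measure set T -> \bar R}) (f : T -> R) (h : T -> \bar R) :
  (forall x, 0 <= f x) -> measurable_fun setT f ->
  (forall A, measurable A -> Q A = (\int[m]_(x in A) (f x)%:E)%E) ->
  measurable_fun setT h -> (forall x, 0 <= h x)%E ->
  (\int[Q]_x h x = \int[m]_x (h x * (f x)%:E))%E.
Proof.
move=> f0 mf Qf mh h0.
have mEf : measurable_fun setT (fun x => (f x)%:E) by exact/measurable_EFinP.
pose h_ := nnsfun_approx measurableT mh.
have ch x : ((h_ n x)%:E @[n --> \oo] --> h x)%E by exact: cvg_nnsfun_approx.
have mh_ n : measurable_fun setT (fun x => (h_ n x)%:E) by exact/measurable_EFinP.
have h_0 n x : (0 <= (h_ n x)%:E)%E by rewrite lee_fin.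
have nd x : {homo (fun n => (h_ n x)%:E) : a b / (a <= b)%N >-> (a <= b)%E}.
  by move=> a b ab; rewrite lee_fin; exact/lefP/nd_nnsfun_approx.
have c1 := @cvg_monotone_convergence _ _ R Q setT measurableT _ mh_ (fun n x _ => h_0 n x)
  (fun x _ => nd x).
have mhf n : measurable_fun setT (fun x => ((h_ n x)%:E * (f x)%:E)%E).
  exact: emeasurable_funM.
have Ef0 x : (0 <= (f x)%:E)%E by rewrite lee_fin.
have c2 := @cvg_monotone_convergence _ _ R m setT measurableT _ mhf
  (fun n x _ => mule_ge0 (h_0 n x) (Ef0 x))
  (fun x _ a b ab => lee_wpmul2r (Ef0 x) (nd x a b ab)).
have E1 : (fun x => limn (fun n => (h_ n x)%:E)) = h.
  by apply/funext => x; apply/cvg_lim => //; exact: ch.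
have E2 : (fun x => limn (fun n => ((h_ n x)%:E * (f x)%:E)%E)) = (fun x => (h x * (f x)%:E)%E).
  by apply/funext => x; apply/cvg_lim => //; apply: cvgeZr => //; exact: ch.
rewrite E1 in c1; rewrite E2 in c2.
have E n : (\int[Q]_x (h_ n x)%:E = \int[m]_x ((h_ n x)%:E * (f x)%:E))%E.
  pose A r := (h_ n) @^-1` [set r].
  have mA r : measurable (A r) by exact: measurable_sfunP.
  have pos r x : (0 <= (r * \1_(A r) x)%:E)%E by rewrite EFinM nnfun_muleindic_ge0.
  have mi r : measurable_fun setT (fun x => (r * \1_(A r) x)%:E).
    by apply/measurable_EFinP; apply: measurable_funM.
  under [LHS]eq_integral do rewrite fimfunE -fsumEFin//.
  rewrite [LHS]ge0_integral_fsum//.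
  under [RHS]eq_integral.
    move=> x _; rewrite fimfunE -fsumEFin// ge0_mule_fsuml; last by move=> r; exact: pos.
    over.
  rewrite [RHS]ge0_integral_fsum//; last 2 first.
  - by move=> r; apply: emeasurable_funM => //; exact: mi.
  - by move=> r x _; rewrite mule_ge0// ?pos// lee_fin.
  apply: eq_fsbigr => r _.
  have [r0|r0] := ltP r 0.
    have A0 : A r = set0.
      by apply/seteqP; split => // x /= hx; move: r0; rewrite -hx ltNge fun_ge0.
    rewrite !integral0_eq//.
      by move=> x _; rewrite -/(A r) A0 indic0 mulr0 mul0e.
    by move=> x _; rewrite -/(A r) A0 indic0 mulr0.
  under eq_integral do rewrite EFinM.
  under [RHS]eq_integral do rewrite EFinM -muleA.
  rewrite !ge0_integralZl//; last 3 first.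
  - by apply: emeasurable_funM => //; exact/measurable_EFinP.
  - by move=> x _; rewrite mule_ge0// lee_fin.
  - exact/measurable_EFinP.
  congr (_ * _)%E; rewrite integral_indic// setIT Qf//.
  rewrite [LHS]integral_mkcond; apply: eq_integral => x _.
  by rewrite patchE indicE -/(A r); case: ifPn => _; rewrite ?mul1e ?mul0e.
rewrite (funext E) in c1.
by rewrite -(cvg_lim _ c1)// (cvg_lim _ c2).
Qed.

End law_integrals.

Section independence.
Context {R : realType}.

Lemma eq_measure_rectangles d1 d2 (T1 : measurableType d1) (T2 : measurableType d2)
    (m1 m2 : {measure set (T1 * T2) -> \bar R}) : (m1 setT < +oo)%E ->
  (forall A B, measurable A -> measurable B -> m1 (A `*` B) = m2 (A `*` B)) ->
  forall D, measurable D -> m1 D = m2 D.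
Proof.
move=> fin12 eq12 D mD.
apply: (@g_sigma_algebra_measure_unique _ R _
   [set A `*` B | A in measurable & B in measurable] _ (fun=> setT)) => //.
- by move=> _ [A mA [B mB <-]]; exact: measurableX.
- by move=> _; exists setT => //; exists setT => //; rewrite setXTT.
- by apply/seteqP; split => // w _; exists 0%N.
- move=> _ _ [A mA [B mB <-]] [A' mA' [B' mB' <-]].
  exists (A `&` A'); first exact: measurableI.
  exists (B `&` B'); first exact: measurableI.
  by rewrite setXI.
- by move=> _ [A mA [B mB <-]]; exact: eq12.
- by rewrite -measurable_prod_measurableType.
Qed.

Definition prob_prod d1 d2 (T1 : measurableType d1) (T2 : measurableType d2)
  (P1 : probability T1 R) (P2 : probability T2 R) : probability (T1 * T2)%type R := (P1 \x P2)%E.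

Lemma prob_prodE d1 d2 (T1 : measurableType d1) (T2 : measurableType d2)
    (P1 : probability T1 R) (P2 : probability T2 R) A B : measurable A -> measurable B ->
  prob_prod P1 P2 (A `*` B) = (P1 A * P2 B)%E.
Proof. by move=> mA mB; rewrite [LHS]product_measure1E. Qed.

Lemma prob_prod_integral d1 d2 (T1 : measurableType d1) (T2 : measurableType d2)
    (P1 : probability T1 R) (P2 : probability T2 R) (f : T1 * T2 -> \bar R) :
  measurable_fun setT f -> (forall x, 0 <= f x)%E ->
  (\int[prob_prod P1 P2]_z f z = \int[P1]_x \int[P2]_y f (x, y))%E.
Proof. by move=> mf f0; rewrite [LHS]fubini_tonelli1. Qed.

(** Two applications of the uniqueness on rectangles, first with the event of the first variable
    fixed. The last two variables are swapped for the integration in the path to be the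
    innermost one. *)
Lemma independent3_law d d1 d2 d3 (Omega : measurableType d) (T1 : measurableType d1)
    (T2 : measurableType d2) (T3 : measurableType d3) (P : probability Omega R)
    (X : Omega -> T1) (Y : Omega -> T2) (Z : Omega -> T3)
    (Q1 : probability T1 R) (Q2 : probability T2 R) (Q3 : probability T3 R) :
  independent3 P X Y Z -> has_law P X Q1 -> has_law P Y Q2 -> has_law P Z Q3 ->
  forall D, measurable D ->
    P ((fun w => (X w, (Z w, Y w))) @^-1` D) = prob_prod Q1 (prob_prod Q3 Q2) D.
Proof.
move=> ind [mX QX] [mY QY] [mZ QZ].
have mZY : measurable_fun setT ((fun w => (Z w, Y w)) : Omega -> (T3 * T2)%type).
  exact/measurable_fun_pairP.
have mXZY : measurable_fun setT ((fun w => (X w, (Z w, Y w))) : Omega -> (T1 * (T3 * T2))%type).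
  exact/measurable_fun_pairP.
have [m mE] := image_measure P mXZY.
move=> D mD; rewrite -mE; move: D mD.
apply: eq_measure_rectangles => [|A B mA mB].
  rewrite mE; apply: (le_lt_trans (probability_le1 P _)); last exact: ltry.
  by rewrite preimage_setT; exact: measurableT.
rewrite mE [RHS]prob_prodE//.
have mXA : measurable (X @^-1` A) by rewrite -[X in measurable X]setTI; exact: mX.
have QA0 : 0 <= fine (Q1 A) by rewrite fine_ge0.
have [m1 m1E] := image_measure (mrestr P mXA) mZY.
have H : m1 B = mscale (NngNum QA0) (prob_prod Q3 Q2) B.
  move: B mB; apply: eq_measure_rectangles => [|C D mC mD].
    rewrite m1E /mrestr; apply: (le_lt_trans (probability_le1 P _)); last exact: ltry.
    by rewrite preimage_setT; apply: measurableI => //; exact: measurableT.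
  transitivity ((fine (Q1 A))%:E * prob_prod Q3 Q2 (C `*` D))%E; last by [].
  rewrite prob_prodE// fineK ?fin_num_measure// m1E /mrestr -QX// -QY// -QZ//.
  rewrite [X in (_ * X)%E]muleC muleA -ind//; congr (P _).
  by apply/seteqP; split => w /=; tauto.
transitivity (m1 B).
  by rewrite m1E /mrestr; congr (P _); rewrite setIC.
rewrite H; transitivity ((fine (Q1 A))%:E * prob_prod Q3 Q2 B)%E; first by [].
by rewrite fineK ?fin_num_measure.
Qed.

End independence.

(** * Measurability on path space *)

Section path_measurability.
Context {R : realType}.
Implicit Types w : cpath R.

Lemma measurable_to_cpath d (T : measurableType d) (f : T -> cpath R) :
  (forall r, 0 <= r -> measurable_fun setT (fun x => f x r)) -> measurable_fun setT f.
Proof.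
move=> mf; apply: (measurability (@coordinates R `[0, +oo[)) => //.
move=> _ [_ [r r0 [B mB <-]] <-]; rewrite !setTI.
have r0' : 0 <= r by move: r0; rewrite /= in_itv/= andbT.
by have := mf r r0' measurableT B mB; rewrite setTI.
Qed.

Lemma sqrt_path_continuous w : {within `[0, +oo[, continuous (fun t => Num.sqrt (w t))}.
Proof.
apply: (@within_continuous_comp _ _ _ _ w (@Num.sqrt R)).
  by move=> y _; exact: sqrt_continuous.
exact: cpath_continuous.
Qed.

Definition sqrt_path w : cpath R := CPath (@sqrt_path_continuous w).

Lemma measurable_coord r : 0 <= r -> measurable_fun setT (fun w : cpath R => w r).
Proof.
move=> r0; have := measurable_pval r; congr measurable_fun.
by apply/funext => w; rewrite pvalE.
Qed.

Lemma measurable_sqr_path : measurable_fun setT (@sqr_path R).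
Proof.
apply: measurable_to_cpath => r r0.
by apply: (@measurable_funX _ _ _ _ (fun w : cpath R => w r)); exact: measurable_coord.
Qed.

Lemma measurable_sqrt_path : measurable_fun setT sqrt_path.
Proof.
apply: measurable_to_cpath => r r0.
apply: (@measurableT_comp _ _ _ _ _ _ (@Num.sqrt R)); last exact: measurable_coord.
by apply: continuous_measurable_fun; exact: sqrt_continuous.
Qed.

(** The sigma-algebra is generated by the coordinates at nonnegative times. *)
Lemma measurable_path_ext A w w' : measurable A -> (forall r, 0 <= r -> w r = w' r) ->
  A w <-> A w'.
Proof.
move=> mA ww'; pose C := [set B : set (cpath R) | B w <-> B w'].
suff : measurable `<=` C by apply.
apply: smallest_sub.
  split=> [|B CB|F CF].
  - by split.
  - by rewrite /C/= /setD/=; split=> -[_ h]; split=> // /CB.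
  - by split=> -[n _ /CF h]; exists n.
move=> _ [r r0 [B mB <-]]; rewrite /C/= ww'//.
by move: r0; rewrite /= in_itv/= andbT.
Qed.

Definition nonneg_paths : set (cpath R) := [set w | forall r, 0 <= r -> 0 <= w r].

(** By continuity it suffices to look at rational times. *)
Lemma measurable_nonneg_paths : measurable nonneg_paths.
Proof.
rewrite (_ : nonneg_paths = \bigcap_n \bigcap_k
    [set w : cpath R | 0 <= pval w ((k%:R : R) / n.+1%:R)]).
  apply: bigcapT_measurable => n; apply: bigcapT_measurable => k.
  have := measurable_pval (k%:R / n.+1%:R : R) measurableT (measurable_itv `[0, +oo[).
  by rewrite setTI; congr measurable; apply/seteqP; split => w /=; rewrite in_itv/= andbT.
apply/seteqP; split => [w w0 n _ k _ /=|w w0 r r0].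
  by apply: w0; rewrite le_max lexx.
have c : pval w ((Num.truncn (n.+1%:R * r))%:R / n.+1%:R) @[n --> \oo] --> pval w r.
  exact: (continuous_cvg _ (@continuous_pval R w r) (cvg_truncn_grid r0)).
rewrite -(pvalE w r0) -(cvg_lim _ c)//; apply: limr_ge; first exact: cvgP c.
by apply: nearW => n; exact: (w0 n I _ I).
Qed.

Lemma measurable_delayed_sum : measurable_fun setT
  (fun z : cpath R * (R * cpath R) => delayed_sum z.1 z.2.2 z.2.1).
Proof.
apply: measurable_to_cpath => r r0 /=; apply: measurable_funD.
  by apply: (measurableT_comp (measurable_coord r0)).
have := @measurable_joint R.
move=> /(@measurableT_comp _ _ _ _ _ _ _ _ (fun z : cpath R * (R * cpath R) => (z.2.2, r - z.2.1))).
apply; apply/measurable_fun_pairP; split => /=.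
  exact: (measurableT_comp measurable_snd measurable_snd).
apply: measurable_funB; first exact: measurable_cst.
exact: (measurableT_comp measurable_fst measurable_snd).
Qed.

End path_measurability.

Section linear_sum.
Context {R : realType}.
Implicit Types (w : cpath R) (s : seq (R * R)).

Definition lsum s w : R := \sum_(p <- s) p.2 * pval w p.1.

Lemma lsum_delayed s w w' e : times_sorted s ->
  lsum s (delayed_sum w w' e) = lsum s w + lsum (delay e s) w'.
Proof.
move=> /path_all; rewrite /lsum; elim: s => [_|p s ih /andP[p0 ps]].
  by rewrite !big_nil addr0.
rewrite (_ : delay e (p :: s) = (Num.max 0 (p.1 - e), p.2) :: delay e s)// !big_cons ih//.
rewrite {1}/pval/= (max_r p0) mulrDr [pval w _]pvalE// [pval w' (Num.max 0 _)]pvalE ?le_max ?lexx//.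
by ring.
Qed.

Lemma wsum_sqrt s w : nonneg_paths w -> wsum s (sqrt_path w) = lsum s w.
Proof.
move=> w0; apply: eq_bigr => p _; congr (_ * _).
by rewrite /pval/= sqr_sqrtr// w0// le_max lexx.
Qed.

Lemma measurable_lsum s : measurable_fun setT (lsum s).
Proof.
elim: s => [|p s ih].
  by rewrite (_ : lsum [::] = cst 0)//; apply/funext => w; rewrite /lsum big_nil.
rewrite (_ : lsum (p :: s) = (fun w => p.2 * pval w p.1 + lsum s w)); last first.
  by apply/funext => w; rewrite /lsum big_cons.
by apply: measurable_funD => //; apply: measurable_funM => //; exact: measurable_pval.
Qed.

Lemma measurable_exp_lsum s : measurable_fun setT (fun w => (expR (- lsum s w))%:E).
Proof.
apply/measurable_EFinP; apply: measurable_expR_comp.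
by apply: measurable_funN; exact: measurable_lsum.
Qed.

Lemma delay0 s : times_sorted s -> delay 0 s = s.
Proof.
move=> /path_all; elim: s => //= -[r th] s ih /andP[/= p0 ps].
by rewrite ih// subr0 max_r.
Qed.

End linear_sum.

(** * Law of the sum *)

Section density_integrability.
Context {R : realType}.
Variables (PY : probability (cpath R) R) (delta mu : R).
Hypothesis d0 : 0 < delta.
Hypothesis lawY : bessel_law delta 0 0 PY.

Lemma measurable_density t : measurable_fun setT
  (fun w : cpath R => sq_bessel_h delta mu (pval w t ^+ 2)).
Proof.
apply: (@measurableT_comp _ _ _ _ _ _ (sq_bessel_h delta mu)).
  by apply: continuous_measurable_fun; exact: sq_bessel_h_continuous.
by apply: measurable_funX; exact: measurable_pval.
Qed.

(** The functionals of [laplace_functional_density] with the single weight 1 / (n + 1) at time t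
    stay below exp(mu^2 t / 2); they increase to the integral of h(x_t). *)
Lemma integrable_density t : 0 <= t ->
  PY.-integrable setT (EFin \o (fun w => sq_bessel_h delta mu (pval w t ^+ 2))).
Proof.
move=> t0; pose k w := sq_bessel_h delta mu (pval w t ^+ 2).
have k0 w : 0 <= k w by rewrite ltW// sq_bessel_h_gt0// sqr_ge0.
pose th n : R := n.+1%:R^-1.
have th0 n : 0 < th n by rewrite invr_gt0.
have cth : th n @[n --> \oo] --> 0 by exact: cvg_harmonic.
pose g n w := expR (- wsum [:: (t, th n)] w) * k w.
have gE n w : g n w = expR (- (th n * pval w t ^+ 2)) * k w.
  by rewrite /g wsum_cons wsum_nil /cst addr0.
have bound n : (\int[PY]_w (g n w)%:E <= (expR (mu ^+ 2 / 4 * (2 * t)))%:E)%E.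
  have st : times_sorted (rcons [::] (t, th n)) by rewrite /times_sorted/= t0.
  have -> := @laplace_functional_density R PY delta mu [::] t (th n) d0 lawY (th0 n) st isT.
  have a1 : 1 <= 1 + th n * (0 + 2 * (t - 0) * 1).
    by rewrite lerDl mulr_ge0 ?(ltW (th0 n))// addr_ge0// mulr_ge0// mulr_ge0// subr_ge0.
  have a0 := lt_le_trans ltr01 a1.
  rewrite lee_fin /= -[leRHS]mul1r ler_pM ?expR_ge0//.
    rewrite -[leRHS]expR0 ler_expR oppr_le0 mulr_ge0 ?divr_ge0 ?(ltW d0)//.
    exact: ln_ge0.
  rewrite ler_expR ler_wpM2l ?divr_ge0 ?sqr_ge0// ler_pdivrMr// add0r subr0 mulr1.
  by rewrite ler_peMr// ?mulr_ge0// -[2 * t]mulr1 -[t in 2 * t]subr0 -[2 * _ * 1]add0r.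
have mg n : measurable_fun setT (EFin \o g n).
  apply/measurable_EFinP; apply: measurable_funM; last exact: measurable_density.
  exact: measurable_exp_wsum.
have g0 n w : setT w -> (0 <= (g n w)%:E)%E.
  by move=> _; rewrite lee_fin mulr_ge0 ?expR_ge0.
have nd w : setT w -> nondecreasing_seq (fun n => (g n w)%:E).
  move=> _ a b ab; rewrite lee_fin !gE ler_wpM2r// ler_expR lerN2 ler_wpM2r ?sqr_ge0//.
  by rewrite lef_pV2 ?posrE// ler_nat.
have := @cvg_monotone_convergence _ _ R PY setT measurableT _ mg g0 nd.
have -> : (fun w => limn (fun n => (g n w)%:E)) = (fun w => (k w)%:E).
  apply/funext => w; apply/cvg_lim => //; apply: cvg_EFin; first exact: nearW.
  rewrite /comp/= (funext (fun n => gE n w)) -[X in _ --> X]mul1r; apply: cvgM; last exact: cvg_cst.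
  rewrite -expR0 -oppr0 -(mul0r (pval w t ^+ 2)).
  apply: (continuous_cvg _ (@continuous_expR R _)); apply: cvgN; apply: cvgM => //.
  exact: cvg_cst.
move=> c; apply/integrableP; split.
  by apply/measurable_EFinP; exact: measurable_density.
rewrite (eq_integral (fun w => (k w)%:E)); last first.
  by move=> w _; rewrite /= ger0_norm// k0.
rewrite -(cvg_lim _ c)// (le_lt_trans _ (ltry (expR (mu ^+ 2 / 4 * (2 * t)))))//.
by apply: lime_le; [exact: cvgP c|exact: nearW].
Qed.

End density_integrability.

Section laplace_extension.
Context {R : realType}.
Variables (P : probability (cpath R) R) (f : cpath R -> R) (t : R).
Hypothesis fi : P.-integrable setT (EFin \o f).
Hypothesis mf : measurable_fun setT f.
Hypothesis f0 : forall w, 0 <= f w.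

(** The explicit formulas need a positive weight at the last time t; it is removed in the limit. *)
Lemma laplace_last_weight0 s : weights_ge0 s ->
  \int[P]_w (expR (- wsum (rcons s (t, n.+1%:R^-1)) w) * f w) @[n --> \oo] -->
  \int[P]_w (expR (- wsum s w) * f w).
Proof.
move=> ws; have ths n : weights_ge0 (rcons s (t, n.+1%:R^-1)).
  by rewrite /weights_ge0 all_rcons /= invr_ge0 ler0n.
apply: (@dominated_cvg_Rintegral _ _ _ _ _ _ _ f) => //.
- move=> n; apply: measurable_funM => //.
  exact: measurable_exp_wsum.
- move=> n w _; rewrite normrM (ger0_norm (f0 w)) -[leRHS]mul1r ler_wpM2r//.
  exact: expR_wsum_bound.
- move=> w _; apply: cvgM; last exact: cvg_cst.
  apply: (continuous_cvg _ (@continuous_expR R _)); apply: cvgN.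
  rewrite (funext (fun n => wsum_rcons s (t, n.+1%:R^-1) w)) -[X in _ --> X]addr0.
  apply: cvgD; first exact: cvg_cst.
  rewrite /= -[X in _ --> X](mul0r (pval w t ^+ 2)); apply: cvgM; last exact: cvg_cst.
  exact: cvg_harmonic.
Qed.

End laplace_extension.

Lemma sort_times {R : realType} (s : seq (R * R)) t : 0 <= t -> weights_ge0 s -> times_within t s ->
  exists s', [/\ weights_ge0 s', forall theta, times_sorted (rcons s' (t, theta)) &
    wsum s = wsum s'].
Proof.
move=> t0 ws st.
pose s' := sort (fun p q : R * R => p.1 <= q.1) s.
have ps : perm_eq s' s by rewrite perm_sort.
exists s'; split.
- by rewrite /weights_ge0 (perm_all _ ps).
- move=> theta; rewrite /times_sorted map_rcons rcons_path.
  have /allP H : times_within t s' by rewrite /times_within (perm_all _ ps).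
  apply/andP; split.
    rewrite path_min_sorted; last first.
      by apply/allP => _ /mapP[p /H /andP[p0 _] ->].
    rewrite sorted_map; apply: sort_sorted => p q; exact: le_total.
  have := mem_last 0 [seq p.1 | p <- s']; rewrite inE => /predU1P[->//|].
  by move=> /mapP[p /H /andP[_ pt] ->].
- by apply/funext => w; rewrite /wsum (perm_big _ ps).
Qed.

Section sum_of_processes.
Context {R : realType} d (Omega : measurableType d).
Variables (P : probability Omega R) (X X' : Omega -> cpath R) (E : Omega -> R).
Variables (QX QX' PY PY' : probability (cpath R) R) (delta mu : R).
Hypothesis d0 : 0 < delta.
Hypothesis mu0 : 0 < mu.
Hypothesis ind : independent3 P X X' E.
Hypothesis lawY : bessel_law delta 0 0 PY.
Hypothesis lawY' : bessel_law 4 mu 0 PY'.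
Hypothesis sqY : has_law PY sqr_path QX.
Hypothesis sqY' : has_law PY' sqr_path QX'.
Hypothesis hX : has_law P X QX.
Hypothesis hX' : has_law P X' QX'.
Hypothesis hE : has_law P E (exponential_prob (mu ^+ 2 / 2)).

Let nu := mu ^+ 2 / 2.
Let nu0 : 0 < nu. Proof. by rewrite divr_gt0// exprn_gt0. Qed.
Let Z w := delayed_sum (X w) (X' w) (E w).

Let mTuple : measurable_fun setT ((fun w => (X w, (E w, X' w))) : Omega -> (cpath R * (R * cpath R))%type).
Proof.
have [mX _] := hX; have [mX' _] := hX'; have [mE _] := hE.
by apply/measurable_fun_pairP; split => //; exact/measurable_fun_pairP.
Qed.

Lemma measurable_sum : measurable_fun setT Z.
Proof. exact: (measurableT_comp measurable_delayed_sum mTuple). Qed.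

Let V s t e : R := expR (- (mu ^+ 2 / 2 * Num.max 0 (t - e))) *
  expR (- (4 / 2 * ln (ric (delay e s)).2.1)) *
  expR (mu ^+ 2 / 4 * ((ric (delay e s)).2.2 / (ric (delay e s)).2.1)).

Let delayed_part s t theta e : 0 < theta -> times_sorted (rcons s (t, theta)) -> weights_ge0 s ->
  (\int[QX']_w (expR (- lsum (delay e (rcons s (t, theta))) w))%:E =
   (V (rcons s (t, theta)) t e)%:E)%E.
Proof.
move=> th0 st ws; have [mS QS] := sqY'.
rewrite (@law_integral _ _ _ _ _ PY' QX' sqr_path _ mS); last 3 first.
- by move=> A mA; exact: esym (QS A mA).
- exact: measurable_exp_lsum.
- by move=> w; rewrite lee_fin expR_ge0.
rewrite /V; have := times_sorted_delay e st.
rewrite /delay map_rcons/= -/(delay e s) => st'.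
rewrite -(laplace_functional _ (ltW mu0) lawY' th0 st') ?weights_delay//.
Qed.

Let nuE : mu ^+ 2 / 4 = nu / 2. Proof. by rewrite /nu; field. Qed.

Let dE S t e : delay_density nu S t e = nu * expR (- (nu * e)) * V S t e.
Proof. by rewrite /delay_density /V nuE. Qed.

Let mV S t : times_sorted S -> weights_ge0 S -> measurable_fun setT (fun e => (V S t e)%:E).
Proof.
move=> st wS.
rewrite (_ : (fun e => _) = (fun e => (delay_density nu S t e * (nu^-1 * expR (nu * e)))%:E)).
  apply/measurable_EFinP; apply: measurable_funM; first exact: measurable_delay_density.
  apply: measurable_funM => //.
  apply: measurable_expR_comp.
  exact: measurable_funM.
apply/funext => e; congr EFin; rewrite dE expRN.
by field; rewrite (lt0r_neq0 nu0) gt_eqF// expR_gt0.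
Qed.

Let exponential_part s t theta : 0 < theta -> times_sorted (rcons s (t, theta)) ->
    weights_ge0 s -> let S := rcons s (t, theta) in
  forall QE : probability R R, (forall A, measurable A -> QE A = exponential_prob nu A) ->
  (\int[QE]_e (V S t e)%:E =
   (expR (- (nu * t)) * expR (mu ^+ 2 / 4 * ((ric S).2.2 / (ric S).2.1)))%:E)%E.
Proof.
move=> th0 st ws S QE QEE.
have wS : weights_ge0 S by rewrite /weights_ge0 all_rcons/= (ltW th0).
have V0 e : (0 <= (V S t e)%:E)%E by rewrite lee_fin !mulr_ge0 ?expR_ge0.
have mid : measurable_fun setT (idfun : R -> measurableTypeR R) by move=> _ B mB; rewrite setTI.
have [QL QLE] := image_measure QE mid.
have mVL : measurable_fun setT ((fun e => (V S t e)%:E) : measurableTypeR R -> \bar R).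
  exact: (mV t st wS).
have QLE' A : measurable A -> QL A = (\int[lebesgue_measure]_(x in A) (exponential_pdf nu x)%:E)%E.
  by move=> mA; rewrite QLE; exact: QEE.
rewrite -(law_integral mid (fun A _ => QLE A) mVL V0).
have DI := @density_integral R _ (measurableTypeR R) lebesgue_measure QL (exponential_pdf nu) _
  (exponential_pdf_ge0 (ltW nu0)) (measurable_exponential_pdf nu) QLE' mVL V0.
rewrite DI {DI}.
have lS : t = last 0 [seq q.1 | q <- S] by rewrite map_rcons last_rcons.
have := integral_delay_density nu0 (lexx 0) st wS; rewrite -/S -lS delay0// nuE => <-.
rewrite (_ : `]0, +oo[%classic = `]0, +oo[%classic `&` setT) ?setIT//.
rewrite integral_itv_obnd_cbnd; last first.
  by apply/measurable_EFinP; apply: measurable_funTS; exact: measurable_delay_density.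
rewrite [RHS]integral_mkcond; apply: eq_integral => e _; rewrite patchE.
case: ifPn => [|]; last first.
  by move=> h; rewrite /exponential_pdf patchE (negbTE h) mule0.
rewrite inE/= in_itv/= andbT => e0.
by rewrite -EFinM exponential_pdfE// dE mulrC mulNr.
Qed.

(** Tonelli under the product law: for a given delay e the functional of the sum factors into
    the drift-free functional and the one at the delayed times, whose average over e is
    [integral_delay_density]. *)
Lemma sum_laplace s t theta : 0 < theta -> times_sorted (rcons s (t, theta)) ->
    weights_ge0 s -> let S := rcons s (t, theta) in
  (\int[P]_w (expR (- lsum S (Z w)))%:E =
   (expR (- (nu * t)) * expR (- (delta / 2 * ln (ric S).2.1)) *
    expR (mu ^+ 2 / 4 * ((ric S).2.2 / (ric S).2.1)))%:E)%E.
Proof.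
move=> th0 st ws S; have [mE QE0] := hE.
have [QE QEP] := image_law P mE.
have QEE A : measurable A -> QE A = exponential_prob nu A by move=> mA; rewrite QEP QE0.
have hE' : has_law P E QE by split => // A _; rewrite QEP.
pose F (z : cpath R * (R * cpath R)) : \bar R := (expR (- lsum S (delayed_sum z.1 z.2.2 z.2.1)))%:E.
have mF : measurable_fun setT F.
  exact: (measurableT_comp (measurable_exp_lsum S) measurable_delayed_sum).
have F0 z : (0 <= F z)%E by rewrite lee_fin expR_ge0.
have ER w : (0 <= (expR w)%:E)%E by rewrite lee_fin expR_ge0.
transitivity (\int[prob_prod QX (prob_prod QE QX')]_z F z)%E.
  rewrite (@law_integral _ _ _ _ _ P _ _ F mTuple)//.
  by move=> A mA; exact: esym (independent3_law ind hX hX' hE' mA).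
rewrite prob_prod_integral//.
pose K := expR (- (nu * t)) * expR (mu ^+ 2 / 4 * ((ric S).2.2 / (ric S).2.1)).
have inner x : (\int[prob_prod QE QX']_y F (x, y) = (expR (- lsum S x))%:E * K%:E)%E.
  have mFx : measurable_fun setT (fun y : R * cpath R => F (x, y)).
    exact: (measurableT_comp mF (measurable_pair1 x)).
  rewrite prob_prod_integral//.
  have E1 e : (\int[QX']_w F (x, (e, w)) = (expR (- lsum S x))%:E * (V S t e)%:E)%E.
    rewrite -(delayed_part e th0 st ws) -ge0_integralZl//; last exact: measurable_exp_lsum.
    by apply: eq_integral => w _; rewrite /F/= lsum_delayed// opprD expRD EFinM.
  under eq_integral do rewrite E1.
  rewrite ge0_integralZl//.
  - by rewrite (exponential_part th0 st ws QEE).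
  - by apply: mV => //; rewrite /weights_ge0 all_rcons/= (ltW th0).
  - by move=> e _; rewrite lee_fin !mulr_ge0 ?expR_ge0.
under eq_integral do rewrite inner.
have K0 : (0 <= K%:E)%E by rewrite lee_fin mulr_ge0 ?expR_ge0.
rewrite ge0_integralZr//; last exact: measurable_exp_lsum.
have [mS QS] := sqY.
rewrite (@law_integral _ _ _ _ _ PY QX sqr_path _ mS); last 3 first.
- by move=> A mA; exact: esym (QS A mA).
- exact: measurable_exp_lsum.
- by move=> w; rewrite lee_fin expR_ge0.
have /= -> := laplace_functional d0 (lexx 0) lawY th0 st ws.
rewrite -EFinM expr0n/= !mul0r oppr0 expR0 mul1r mulr1 /K; congr EFin.
by rewrite mulrCA mulrA.
Qed.

Let h w t := sq_bessel_h delta mu (pval w t ^+ 2).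

(** By [sum_laplace] and [laplace_functional_density] both sides have the same Laplace
    functionals. The law of the square root is taken as that of the Bessel process, and squaring
    gives back the sum since the latter is nonnegative almost surely. *)
Lemma sum_law : exists2 Q : probability (cpath R) R, has_law P Z Q &
  exists2 P' : probability (cpath R) R, has_law P' sqr_path Q &
    {ae P', forall w : cpath R, forall r : R, 0 <= r -> 0 <= w r} /\
    forall t A, 0 <= t -> canonical_filtration t A ->
      (P' A = \int[PY]_(w in A) (expR (- (nu * t)) * h w t)%:E)%E.
Proof.
have [Q QE] := image_law P measurable_sum.
have [P' P'E] := image_law Q (@measurable_sqrt_path R).
have mN := measurable_nonneg_paths (R := R).
(* the components are laws of squares, so that paths with negative values are negligible *)
have QN : Q (~` nonneg_paths) = 0%E.
  have null (PP QQ : probability (cpath R) R) (XX : Omega -> cpath R) :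
      has_law PP sqr_path QQ -> has_law P XX QQ -> P (XX @^-1` (~` nonneg_paths)) = 0%E.
    move=> [_ e1] [_ e2]; rewrite e2; last exact: measurableC.
    rewrite -e1; last exact: measurableC.
    rewrite (_ : _ @^-1` _ = set0) ?measure0//; apply/seteqP; split => // w; apply => r r0.
    exact: sqr_ge0.
  have [[mX _] [mX' _]] := (hX, hX').
  have mpre (XX : Omega -> cpath R) B : measurable_fun setT XX -> measurable B -> measurable (XX @^-1` B).
    by move=> mXX mB; rewrite -[X in measurable X]setTI; exact: mXX.
  have mNc := measurableC mN.
  apply/eqP; rewrite eq_le measure_ge0 andbT QE.
  rewrite (@le_trans _ _ (P (X @^-1` (~` nonneg_paths) `|` X' @^-1` (~` nonneg_paths))))//.
    apply: le_measure; rewrite ?inE; [exact: mpre measurable_sum _|by apply: measurableU; exact: mpre|].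
    move=> w /= hw; apply: contrapT => /not_orP[/contrapT h1 /contrapT h2]; apply: hw => r r0 /=.
    by rewrite addr_ge0// ?h1// h2// le_max lexx.
  rewrite (le_trans (measureU2 _ _ _))//; [exact: mpre|exact: mpre|].
  rewrite -[leRHS]adde0; apply: leeD; rewrite le_eqVlt; apply/orP; left; apply/eqP.
    exact: null sqY hX.
  exact: null sqY' hX'.
have aeN : {ae Q, forall w, nonneg_paths w}.
  by exists (~` nonneg_paths); split => //; exact: measurableC.
exists Q; first by split; [exact: measurable_sum|move=> A _; rewrite QE].
exists P'.
  split; first exact: measurable_sqr_path.
  move=> A mA; have mB : measurable (@sqr_path R @^-1` A).
    by rewrite -[X in measurable X]setTI; exact: measurable_sqr_path.
  have mC : measurable (@sqrt_path R @^-1` (@sqr_path R @^-1` A)).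
    by rewrite -[X in measurable X]setTI; exact: measurable_sqrt_path.
  have sqrtK (w : cpath R) : nonneg_paths w -> forall r : R, 0 <= r -> sqr_path (sqrt_path w) r = w r.
    by move=> wN r r0 /=; rewrite sqr_sqrtr// wN.
  have split_N B : measurable B -> Q B = Q (B `&` nonneg_paths).
    move=> mB'; have mBN : measurable (B `&` nonneg_paths) by exact: measurableI.
    have mBC : measurable (B `&` ~` nonneg_paths) by apply: measurableI => //; exact: measurableC.
    rewrite -[in LHS](setIT B) -(setUv nonneg_paths) setIUr measureU//; last first.
      by apply/seteqP; split => // w [[_ wN] [_ wNc]]; exact: wNc.
    rewrite [X in (_ + X)%E](_ : _ = 0%E) ?adde0//; apply/eqP; rewrite eq_le measure_ge0 andbT.
    by rewrite -QN; apply: le_measure; rewrite ?inE//; exact: measurableC.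
  rewrite P'E (split_N _ mA) (split_N _ mC); congr (Q _); apply/seteqP; split => w [hw wN]; split => //.
    by have [h1 _] := measurable_path_ext mA (sqrtK w wN); exact: h1.
  by have [_ h2] := measurable_path_ext mA (sqrtK w wN); exact: h2.
split.
  exists (~` nonneg_paths); split => //; first exact: measurableC.
  rewrite P'E (_ : _ @^-1` _ = set0) ?measure0//; apply/seteqP; split => // w.
  by apply => r r0; exact: sqrtr_ge0.
move=> t A t0 FA.
have mA := canonical_filtration_measurable FA.
pose f2 w := expR (- (nu * t)) * h w t.
have f20 w : 0 <= f2 w.
  by rewrite mulr_ge0 ?expR_ge0// ltW// sq_bessel_h_gt0// sqr_ge0.
have if2 : PY.-integrable setT (EFin \o f2).
  by apply: integrableRM => //; exact: integrable_density.
have mf2 : measurable_fun setT f2.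
  by apply: measurable_funM => //; exact: measurable_density.
have if1 : P'.-integrable setT (EFin \o (fun=> 1)).
  by apply: (@bounded_integrable _ _ _ _ _ _ 1) => //; [exact: prob_fin|rewrite normr1].
rewrite -[LHS]mul1e -(integral_cst P' mA 1).
have [_ aeY _] := lawY.
apply: (@laplace_determines_density _ t P' PY (fun=> 1) f2) => //.
  exists (~` nonneg_paths); split => //; first exact: measurableC.
  rewrite P'E (_ : _ @^-1` _ = set0) ?measure0//; apply/seteqP; split => // w.
  by apply => r r0; exact: sqrtr_ge0.
move=> s ws sw; have [s' [ws' st' ->]] := sort_times t0 ws sw.
have m1 : measurable_fun setT ((fun=> 1) : cpath R -> R) by exact: measurable_cst.
have c1 := @laplace_last_weight0 _ P' (fun=> 1) t if1 m1 (fun=> ler01) s' ws'.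
have c2 := @laplace_last_weight0 _ PY f2 t if2 mf2 f20 s' ws'.
apply: (@cvg_unique _ (@Rhausdorff R) _ _ _ _ c1).
have -> // : (fun n => \int[P']_w (expR (- wsum (rcons s' (t, n.+1%:R^-1)) w) * 1)) =
  (fun n => \int[PY]_w (expR (- wsum (rcons s' (t, n.+1%:R^-1)) w) * f2 w)).
apply/funext => n; have th0 : 0 < n.+1%:R^-1 :> R by rewrite invr_gt0.
set S := rcons _ _.
have stS := st' (n.+1%:R^-1); rewrite -/S in stS.
congr fine; transitivity ((expR (- (nu * t)) * expR (- (delta / 2 * ln (ric S).2.1)) *
    expR (mu ^+ 2 / 4 * ((ric S).2.2 / (ric S).2.1)))%:E)%E.
  rewrite -(sum_laplace th0 stS ws').
  transitivity (\int[Q]_z (expR (- wsum S (sqrt_path z)))%:E)%E.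
    rewrite -(@law_integral _ _ _ _ _ Q P' (@sqrt_path R) (fun w => (expR (- wsum S w))%:E)).
    - by apply: eq_integral => w _; rewrite mulr1.
    - exact: measurable_sqrt_path.
    - by move=> B _; exact: P'E.
    - apply/measurable_EFinP; exact: measurable_exp_wsum.
    - by move=> w; rewrite lee_fin expR_ge0.
  rewrite -(@law_integral _ _ _ _ _ P Q Z (fun w => (expR (- lsum S w))%:E)); last 4 first.
  - exact: measurable_sum.
  - by move=> B _; exact: QE.
  - exact: measurable_exp_lsum.
  - by move=> w; rewrite lee_fin expR_ge0.
  apply: ae_eq_integral => //.
  - apply/measurable_EFinP; apply: measurable_expR_comp.
    apply: measurable_funN; apply: (measurableT_comp (measurable_wsum S)).
    exact: measurable_sqrt_path.
  - exact: measurable_exp_lsum.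
  - by apply: filterS aeN => w wN _; rewrite wsum_sqrt.
have e1 := @laplace_functional_density R PY delta mu s' t _ d0 lawY th0 stS ws'.
rewrite -/S in e1; rewrite -mulrA EFinM -e1 -ge0_integralZl//.
- by apply: eq_integral => w _; rewrite -EFinM /f2 mulrCA.
- apply/measurable_EFinP; apply: measurable_funM; last exact: measurable_density.
  exact: measurable_exp_wsum.
- by move=> w _; rewrite lee_fin mulr_ge0 ?expR_ge0// ltW// sq_bessel_h_gt0// sqr_ge0.
Qed.

End sum_of_processes.

(** * Change of law *)

Section generator_extension.
Context {R : realType}.
Variables (delta mu : R).

(** Only the values on the half-line matter, so that the pair may be taken even. *)
Lemma bessel_generator_abs (f g : R -> R) : bessel_generator delta mu f g ->
  bessel_generator delta mu (fun y : R => f `|y|) (fun y : R => g `|y|).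
Proof.
move=> [[cf cg] [K fK] df gE f0].
have cabs (u : R -> R) : continuous u -> continuous (fun y : R => u `|y|).
  move=> cu y; apply: (@continuous_comp _ _ _ (fun y : R => `|y|) u); last exact: cu.
  exact: norm_continuous.
have nfE (u : R -> R) (x : R) : 0 < x -> \forall y \near x, u y = u `|y : R|.
  by move=> x0; near=> y; rewrite gtr0_norm//; near: y; exact: near_gt0.
have d1 (x : R) : 0 < x -> is_derive x 1 (fun y : R => f `|y|) (derive1 f x).
  by move=> x0; apply: der_near (nfE f x x0) _; apply: derivable_der; have [] := df x x0.
have d1E (x : R) : 0 < x -> derive1 (fun y : R => f `|y|) x = derive1 f x.
  by move=> x0; exact: der_derive1 (d1 x x0).
have d2 (x : R) : 0 < x -> is_derive x 1 (derive1 (fun y : R => f `|y|)) (derive1 (derive1 f) x).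
  move=> x0; apply: (@der_near _ (derive1 f)); last by apply: derivable_der; have [] := df x x0.
  by near=> y; rewrite d1E//; near: y; exact: near_gt0.
split; first by split; exact: cabs.
- exists K => x Kx; apply: fK; exact: le_trans Kx (ler_norm x).
- by move=> x x0; split; [have [] := d1 x x0|have [] := d2 x x0].
- by move=> x x0; rewrite d1E// (der_derive1 (d2 x x0)) gtr0_norm// gE.
- apply: cvg_trans f0; apply: near_eq_cvg.
  by apply: filterS (@nbhs_right_gt R 0) => x x0; rewrite d1E.
Unshelve. all: by end_near. Qed.

(** Test functions are only bounded on the half-line, whence the absolute value. *)
Lemma bounded_compact_support (u : R -> R) K : continuous u -> (forall x, K < x -> u x = 0) ->
  exists M, forall y : R, `|u `|y| | <= M.
Proof.
move=> cu uK; pose L := Num.max 0 K.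
have L0 : 0 <= L by rewrite le_max lexx.
have cn : {within `[0, L], continuous (fun y : R => `|u y|)}.
  apply: continuous_subspaceT => y; apply: (@continuous_comp _ _ _ u (fun z : R => `|z|)).
    exact: cu.
  exact: norm_continuous.
have [c _ H] := EVT_max L0 cn.
exists `|u c| => y; have [yL|Ly] := leP `|y| L.
  by apply: H; rewrite in_itv/= normr_ge0.
by rewrite uK ?normr0// (le_lt_trans _ Ly)// le_max lexx orbT.
Qed.

Lemma bessel_generator_bounded (f g : R -> R) : bessel_generator delta mu f g ->
  (exists M, forall y : R, `|f `|y| | <= M) /\ (exists M, forall y : R, `|g `|y| | <= M).
Proof.
move=> [[cf cg] [K fK] df gE f0]; split.
  by apply: (@bounded_compact_support _ K) => // x Kx; exact: fK (ltW Kx).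
apply: (@bounded_compact_support _ (Num.max 0 K)) => // x.
rewrite gt_max => /andP[x0 Kx].
have near0 (z : R) : K < z -> \forall y \near z, 0 = f y.
  move=> Kz; near=> y; rewrite fK// ltW//; near: y; exact: lt_nbhsr.
have d1 (z : R) : K < z -> is_derive z 1 f 0.
  by move=> Kz; exact: der_near (near0 z Kz) (der_cst 0 z).
have d2 : is_derive x 1 (derive1 f) 0.
  have n1 : \forall y \near x, 0 = derive1 f y.
    by near=> y; rewrite (der_derive1 (d1 y _))//; near: y; exact: lt_nbhsr.
  exact: der_near n1 (der_cst 0 x).
by rewrite gE// (der_derive1 (d1 x Kx)) (der_derive1 d2) mul0r mulr0 addr0.
Unshelve. all: by end_near. Qed.

End generator_extension.

Section change_of_law.
Context {R : realType}.
Variables (PY P' : probability (cpath R) R) (delta mu : R).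
Hypothesis d0 : 0 < delta.
Hypothesis mu0 : 0 < mu.
Hypothesis lawY : bessel_law delta 0 0 PY.
Hypothesis nonneg : {ae P', forall w : cpath R, forall r : R, 0 <= r -> 0 <= w r}.
Let nu := mu ^+ 2 / 2.
Let k (y : R) := sq_bessel_h delta mu (y ^+ 2).
Hypothesis dens : forall t A, 0 <= t -> canonical_filtration t A ->
  (P' A = \int[PY]_(w in A) (expR (- (nu * t)) * k (pval w t))%:E)%E.

Let k0 y : 0 <= k y. Proof. by rewrite ltW// sq_bessel_h_gt0// sqr_ge0. Qed.

Let ck : continuous k.
Proof.
move=> y; apply: (@continuous_comp _ _ _ (fun y : R => y ^+ 2) (sq_bessel_h delta mu)).
  exact: exprn_continuous.
exact: sq_bessel_h_continuous.
Qed.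

Let dty t (w : cpath R) := expR (- (nu * t)) * k (pval w t).

Let dty0 t w : 0 <= dty t w. Proof. by rewrite mulr_ge0 ?expR_ge0. Qed.

Let mdty t : 0 <= t -> measurable_fun setT (dty t : filt t -> R).
Proof.
move=> t0; apply: measurable_funM => //.
apply: (@measurableT_comp _ _ _ _ _ _ k); first exact: continuous_measurable_fun.
exact: measurable_pval_filt.
Qed.

Let idty t : 0 <= t -> PY.-integrable setT (EFin \o dty t).
Proof. by move=> t0; apply: integrableRM => //; exact: integrable_density. Qed.

(** The density is only known on the events up to time t, so that both laws are first restricted
    to this sigma-algebra. *)
Lemma change_of_law_ge0 t (phi : cpath R -> R) : 0 <= t ->
  measurable_fun setT (phi : filt t -> R) -> (forall w, 0 <= phi w) ->
  (\int[P']_w (phi w)%:E = \int[PY]_w (phi w * dty t w)%:E)%E.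
Proof.
move=> t0 mphi phi0.
have [m1 m1E] := image_measure P' (@measurable_filt_id R t).
have [m2 m2E] := image_measure PY (@measurable_filt_id R t).
have mE : measurable_fun setT ((fun w => (phi w)%:E) : filt t -> \bar R).
  exact/measurable_EFinP.
have md : measurable_fun setT ((fun w => (dty t w)%:E) : filt t -> \bar R).
  by apply/measurable_EFinP; exact: mdty.
have mEd : measurable_fun setT ((fun w => (phi w * dty t w)%:E) : filt t -> \bar R).
  by apply/measurable_EFinP; apply: measurable_funM => //; exact: mdty.
have E12 (A : set (filt t)) : measurable A -> m1 A = (\int[m2]_(w in A) (dty t w)%:E)%E.
  move=> mA; transitivity (P' (A : set (cpath R))); first exact: m1E.
  rewrite (dens t0 (mA : canonical_filtration t (A : set (cpath R)))).
  rewrite [LHS]integral_mkcond [RHS]integral_mkcond.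
  rewrite (@law_integral _ _ _ _ _ PY m2 idfun _ (@measurable_filt_id R t) (fun A _ => m2E A))//.
    by apply/(measurable_restrictT _ mA); exact: measurable_funTS.
  by move=> w; rewrite patchE; case: ifP => // _; rewrite lee_fin.
have phi0' w : (0 <= (phi w)%:E)%E by rewrite lee_fin.
have pd0 w : (0 <= (phi w * dty t w)%:E)%E by rewrite lee_fin mulr_ge0.
rewrite -(@law_integral _ _ _ _ _ P' m1 idfun _ (@measurable_filt_id R t) (fun A _ => m1E A) mE phi0').
have DI := @density_integral R _ (filt t) m2 m1 (dty t) _ (@dty0 t) (mdty t0) E12 mE phi0'.
rewrite DI {DI}.
by rewrite (@law_integral _ _ _ _ _ PY m2 idfun _ (@measurable_filt_id R t) (fun A _ => m2E A) mEd pd0).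
Qed.

Lemma change_of_law t (phi : cpath R -> R) M : 0 <= t ->
  measurable_fun setT (phi : filt t -> R) -> (forall w, `|phi w| <= M) ->
  \int[P']_w (phi w) = \int[PY]_w (phi w * dty t w).
Proof.
move=> t0 mphi phiM.
have M0 w : 0 <= phi w + M by rewrite -lerBlDr sub0r; have := phiM w; rewrite ler_norml => /andP[].
have mp : measurable_fun setT ((fun w => phi w + M) : filt t -> R) by exact: measurable_funD.
have M0' : 0 <= M by exact: le_trans (normr_ge0 _) (phiM point).
have e1 := congr1 fine (change_of_law_ge0 t0 mp M0).
have e2 := congr1 fine (@change_of_law_ge0 t (fun=> M) t0 (@measurable_cst _ _ _ _ _ M) (fun=> M0')).
have mphi' := measurable_filtW mphi.
have i1 : P'.-integrable setT (EFin \o phi).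
  by apply: (@bounded_integrable _ _ _ _ _ _ M) => //; exact: prob_fin.
have i2 : P'.-integrable setT (EFin \o (fun=> M)).
  by apply: (@bounded_integrable _ _ _ _ _ _ `|M|) => //; exact: prob_fin.
have i3 : PY.-integrable setT (EFin \o (fun w => phi w * dty t w)).
  by apply: (@integrable_boundedM _ _ _ _ _ _ _ M) => //; exact: idty.
have i4 : PY.-integrable setT (EFin \o (fun w => M * dty t w)).
  by apply: integrableRM => //; exact: idty.
have f1 : \int[P']_w (phi w + M) = \int[P']_w (phi w) + \int[P']_w M by rewrite RintegralD.
have f2 : \int[PY]_w ((phi w + M) * dty t w) =
    \int[PY]_w (phi w * dty t w) + \int[PY]_w (M * dty t w).
  by rewrite -RintegralD//; apply: eq_Rintegral => w _; rewrite mulrDl.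
apply: (addIr (\int[P']_w M)).
transitivity (\int[P']_w (phi w + M)); first by rewrite f1.
transitivity (\int[PY]_w ((phi w + M) * dty t w)); first exact: e1.
rewrite f2; congr (_ + _); exact: esym e2.
Qed.

Variables (f g : R -> R).
Hypothesis gen : bessel_generator delta mu f g.
Let fa (y : R) := f `|y|.
Let ga (y : R) := g `|y|.

Let gena : bessel_generator delta mu fa ga. Proof. exact: bessel_generator_abs. Qed.
Let cfa : continuous fa. Proof. by have [[]] := gena. Qed.
Let cga : continuous ga. Proof. by have [[]] := gena. Qed.

(** Dynkin formula under the new law: by the product rule for the h-transform, the time
    derivative of exp(- nu r) E[1_A (f h)(Y_r)] is exp(- nu r) E[1_A (g h)(Y_r)]. *)
Lemma change_of_law_dynkin s t (A : set (cpath R)) : 0 <= s -> s <= t -> canonical_filtration s A ->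
  \int[P']_w (\1_A w * fa (pval w t)) - \int[P']_w (\1_A w * fa (pval w s)) =
  \int[lebesgue_measure]_(r in `[s, t]) \int[P']_w (\1_A w * ga (pval w r)).
Proof.
move=> s0; rewrite le_eqVlt => /predU1P[<- FA|st FA].
  rewrite subrr /Rintegral (_ : `[s, s]%classic = [set s]) ?set_itv1//.
  by rewrite integral_set1.
have [[Mf fM] [Mg gM]] := bessel_generator_bounded gen.
pose xi (w : cpath R) : R := \1_A w.
have xi1 w : `|xi w| <= 1.
  by rewrite /xi indicE; case: (_ \in _); rewrite ?normr1 ?normr0.
have mxis : measurable_fun setT (xi : filt s -> R).
  by apply: (@measurable_indic _ (filt s)).
have mxi : measurable_fun setT xi by exact: measurable_filtW mxis.
pose F y := fa y * k y; pose G y := (ga y + nu * fa y) * k y.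
have genF : bessel_generator delta 0 F G by exact: bessel_generator_mul (ltW mu0) gena.
have [[cF cG] [KF FK] _ _ _] := genF.
have Fabs y : F `|y| = F y by rewrite /F /fa normr_id /k real_normK// num_real.
have Gabs y : G `|y| = G y by rewrite /G /fa /ga normr_id /k real_normK// num_real.
have [[MF FM] [MG GM]] := bessel_generator_bounded genF.
have FM' y : `|F y| <= MF by rewrite -Fabs.
have GM' y : `|G y| <= MG by rewrite -Gabs.
pose H y := ga y * k y.
have cH : continuous H by move=> y; apply: cvgM; [exact: cga|exact: ck].
have HE y : H y = G y - nu * F y by rewrite /H /G /F; ring.
have HM y : `|H y| <= MG + nu * MF.
  rewrite HE (le_trans (ler_normB _ _))// lerD// normrM.
  by rewrite ger0_norm ?ler_wpM2l// /nu divr_ge0// sqr_ge0.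
pose Phi r := \int[PY]_w (xi w * F (pval w r)).
pose Gam r := \int[PY]_w (xi w * G (pval w r)).
pose Psi r := \int[PY]_w (xi w * H (pval w r)).
have cPhi : continuous Phi := continuous_expect xi1 mxi cF FM'.
have cGam : continuous Gam := continuous_expect xi1 mxi cG GM'.
have cPsi : continuous Psi := continuous_expect xi1 mxi cH HM.
have PsiE r : Psi r = Gam r - nu * Phi r.
  have i1 := integrable_xi_psi PY xi1 mxi r cF FM'.
  have i2 := integrable_xi_psi PY xi1 mxi r cG GM'.
  rewrite /Psi /Gam /Phi -RintegralZl// -RintegralB//; last exact: integrableRM.
  by apply: eq_Rintegral => w _; rewrite HE; ring.
have tr (u : R -> R) M r : continuous u -> (forall y, `|u y| <= M) -> s <= r ->
    \int[P']_w (xi w * u (pval w r)) = expR (- (nu * r)) * \int[PY]_w (xi w * (u (pval w r) * k (pval w r))).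
  move=> cu uM sr; have r0 := le_trans s0 sr.
  rewrite (@change_of_law r (fun w => xi w * u (pval w r)) (1 * M) r0).
  - rewrite -RintegralZl//.
      by apply: eq_Rintegral => w _; rewrite /dty; ring.
    apply: (@integrable_boundedM _ _ _ _ _ _ _ 1) => //.
    apply: (@integrable_boundedM _ _ _ _ _ _ _ M) => //.
      apply: (@measurableT_comp _ _ _ _ _ _ u); first exact: continuous_measurable_fun.
      exact: measurable_pval.
    exact: integrable_density.
  - apply: measurable_funM; first exact: measurable_filt_leW mxis.
    apply: (@measurableT_comp _ _ _ _ _ _ u); first exact: continuous_measurable_fun.
    exact: measurable_pval_filt.
  - by move=> w; rewrite normrM ler_pM.
have dPhi (r : R) : s < r -> is_derive r 1 Phi (Gam r).
  move=> sr; have [u ru] : exists u, r < u by exists (r + 1); rewrite ltrDl.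
  have ig : (@lebesgue_measure R).-integrable `[s, u] (EFin \o Gam).
    apply: continuous_compact_integrable; first exact: segment_compact.
    by apply: continuous_subspaceT => v; exact: cGam.
  have [Fd FE] := continuous_FTC1_closed ru ig sr (cGam r).
  have dF : is_derive r 1 (fun x => Phi s + \int[lebesgue_measure]_(v in `[s, x]) Gam v) (Gam r).
    apply: (der_eq (derD (der_cst _ r) (DeriveDef Fd _))); last by rewrite add0r.
    by rewrite -derive1E; exact: FE.
  apply: der_near dF; near=> x.
  have sx : s <= x by apply: ltW; near: x; exact: lt_nbhsr.
  have := martingale_multiplier xi1 mxi lawY genF FM' GM' s0 sx mxis.
  by move=> E; apply/esym/eqP; rewrite addrC -subr_eq; exact/eqP/E.
(* by tr these are the expectations of f and g under the new law, times the indicator of A *)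
pose phi r := expR (- (nu * r)) * Phi r.
pose gam r := expR (- (nu * r)) * Psi r.
have dphi (r : R) : s < r -> is_derive r 1 phi (gam r).
  move=> sr; apply: (der_eq (derM (der_expR (derN (der_linear nu r))) (dPhi r sr))).
  by rewrite /gam PsiE; ring.
have cE : continuous (fun r : R => expR (- (nu * r))).
  by move=> r; exact: der_continuous (der_expR (derN (der_linear nu r))).
have cphi : continuous phi by move=> r; apply: cvgM; [exact: cE|exact: cPhi].
have cgam : continuous gam by move=> r; apply: cvgM; [exact: cE|exact: cPsi].
rewrite (tr fa Mf)// ?(ltW st)// (tr fa Mf)//.
have -> : \int[lebesgue_measure]_(r in `[s, t]) \int[P']_w (xi w * ga (pval w r)) =
    \int[lebesgue_measure]_(r in `[s, t]) gam r.
  apply: eq_Rintegral => r; rewrite inE/= in_itv/= => /andP[sr _].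
  by rewrite (tr ga Mg).
rewrite /Rintegral (@continuous_FTC2 _ gam phi s t st)//.
- exact: continuous_subspaceT.
- split.
  + by move=> r; rewrite in_itv/= => /andP[sr _]; have [] := dphi r sr.
  + by apply: cvg_at_right_filter; exact: cphi.
  + by apply: cvg_at_left_filter; exact: cphi.
- by move=> r; rewrite in_itv/= => /andP[sr _]; exact: der_derive1 (dphi r sr).
Unshelve. all: by end_near. Qed.

End change_of_law.

(** * The law with drift *)

Lemma eq_integral_indic {R : realType} d (T : measurableType d) (m : {measure set T -> \bar R})
    (A : set T) (u v : T -> R) : measurable A ->
  m.-integrable A (EFin \o u) -> m.-integrable A (EFin \o v) ->
  \int[m]_w (\1_A w * (u w - v w)) = 0 ->
  (\int[m]_(w in A) (u w)%:E = \int[m]_(w in A) (v w)%:E)%E.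
Proof.
move=> mA iu iv uv; rewrite -[LHS]fineK ?integrable_fin_num// -[RHS]fineK ?integrable_fin_num//.
congr EFin; apply/eqP; rewrite -subr_eq0 -RintegralB//; apply/eqP.
rewrite Rintegral_mkcond -[RHS]uv; apply: eq_Rintegral => w _; rewrite patchE indicE.
by case: ifP => _; rewrite ?mul1r ?mul0r.
Qed.

Section bessel_law_with_drift.
Context {R : realType}.
Notation leb := (@lebesgue_measure R).
Variables (PY P' : probability (cpath R) R) (delta mu : R).
Hypothesis d0 : 0 < delta.
Hypothesis mu0 : 0 < mu.
Hypothesis lawY : bessel_law delta 0 0 PY.
Hypothesis nonneg : {ae P', forall w : cpath R, forall r : R, 0 <= r -> 0 <= w r}.
Hypothesis dens : forall t A, 0 <= t -> canonical_filtration t A ->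
  (P' A = \int[PY]_(w in A)
    (expR (- (mu ^+ 2 / 2 * t)) * sq_bessel_h delta mu (pval w t ^+ 2))%:E)%E.

Let start0 : {ae P', forall w : cpath R, w 0 = 0}.
Proof.
pose A : set (cpath R) := [set w | w 0 != 0].
have FA : canonical_filtration 0 A.
  have := @measurable_coord_filt R 0 0 (lexx 0) (lexx 0) measurableT (~` [set 0]) (measurableC (measurable_set1 0)).
  rewrite setTI; congr canonical_filtration; apply/seteqP; split => w /=; first by move=> /eqP.
  by move=> /eqP.
have mA := canonical_filtration_measurable FA.
exists A; split => //; last by move=> w /eqP.
have [[N [mN N0 AN]] _ _] := lawY.
have PA : PY A = 0%E.
  by apply: subset_measure0 N0 => // w /eqP wA; exact: AN.
transitivity (\int[PY]_(w in A)
  (expR (- (mu ^+ 2 / 2 * 0)) * sq_bessel_h delta mu (pval w 0 ^+ 2))%:E)%E.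
  exact: dens.
apply: null_set_integral => //; apply/measurable_EFinP; apply: measurable_funTS.
by apply: measurable_funM => //; exact: measurable_density.
Qed.

Section martingale.
Variables (f g : R -> R).
Hypothesis gen : bessel_generator delta mu f g.

Let cf : continuous f. Proof. by have [[]] := gen. Qed.
Let cg : continuous g. Proof. by have [[]] := gen. Qed.
Let fa (y : R) := f `|y|.
Let ga (y : R) := g `|y|.
Let gena : bessel_generator delta mu fa ga. Proof. exact: bessel_generator_abs. Qed.
Let cfa : continuous fa. Proof. by have [[]] := gena. Qed.
Let cga : continuous ga. Proof. by have [[]] := gena. Qed.

Let M (u v : R -> R) t (w : cpath R) : R :=
  u (w t) - u (w 0) - \int[leb]_(r in `[0, t]) v (w r).

Let adapted u v t : continuous u -> continuous v -> 0 <= t ->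
  measurable_fun setT (M u v t : filt t -> R).
Proof.
move=> cu cv t0; have mu_ r : 0 <= r -> r <= t -> measurable_fun setT ((fun w => u (w r)) : filt t -> R).
  move=> r0 rt; apply: (@measurableT_comp _ _ _ _ _ _ u); first exact: continuous_measurable_fun.
  exact: measurable_coord_filt.
by apply: measurable_funB; [apply: measurable_funB; exact: mu_|exact: measurable_time_integral].
Qed.

Let cgaw w : continuous (fun r => ga (pval w r)).
Proof.
move=> r; apply: (@continuous_comp _ _ _ (pval w) ga); last exact: cga.
exact: continuous_pval.
Qed.

Let igaw w a b : leb.-integrable `[a, b] (EFin \o (fun r => ga (pval w r))).
Proof.
apply: continuous_compact_integrable; first exact: segment_compact.
by apply: continuous_subspaceT => r; exact: cgaw.
Qed.

Let gaE (w : cpath R) u : \int[leb]_(r in `[0, u]) ga (w r) = \int[leb]_(r in `[0, u]) ga (pval w r).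
Proof. by apply: eq_Rintegral => r; rewrite inE/= in_itv/= => /andP[r0 _]; rewrite pvalE. Qed.

Let ME t w : 0 <= t -> nonneg_paths w -> M f g t w = M fa ga t w.
Proof.
move=> t0 wN; rewrite /M /fa !ger0_norm ?wN//; congr (_ - _ - _).
apply: eq_Rintegral => r; rewrite inE/= in_itv/= => /andP[r0 _].
by rewrite /ga ger0_norm// wN.
Qed.

Let bounded_Ma t : 0 <= t -> exists K, forall w, `|M fa ga t w| <= K.
Proof.
move=> t0; have [[Mf fM] [Mg gM]] := bessel_generator_bounded gen.
exists (Mf + Mf + Mg * t) => w; rewrite /M (le_trans (ler_normB _ _))// lerD//.
  by rewrite (le_trans (ler_normB _ _))//; apply: lerD; exact: fM.
rewrite gaE; apply: (le_trans (le_normr_Rintegral _ (igaw w 0 t))); first exact: measurable_itv.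
have -> : Mg * t = \int[leb]_(r in `[0, t]) Mg.
  rewrite Rintegral_cst//; congr (_ * _); transitivity (fine (leb (`[0, t]%classic : set R))); last by [].
  rewrite lebesgue_measure_itv/= lte_fin.
  by case: ifPn => [_|]; rewrite /= ?subr0// -leNgt => tle0; apply/eqP; rewrite eq_le t0 tle0.
have ic (c : R) : leb.-integrable `[0, t] (EFin \o (fun=> c)).
  by apply: (@bounded_integrable _ _ _ _ _ _ `|c|) => //; exact: itv_fin.
apply: le_Rintegral => //; first exact: integrable_norm (igaw w 0 t).
by move=> r _; exact: gM.
Qed.

Let integrable_Ma t : 0 <= t -> P'.-integrable setT (EFin \o M fa ga t).
Proof.
move=> t0; have [K bK] := bounded_Ma t0.
apply: (@bounded_integrable _ _ _ _ _ _ K) => //; first exact: prob_fin.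
by apply: (@measurable_filtW _ t); exact: adapted.
Qed.

Let measurable_M u v t : continuous u -> continuous v -> 0 <= t -> measurable_fun setT (M u v t).
Proof. by move=> cu cv t0; apply: (@measurable_filtW _ t); exact: adapted. Qed.

Let integral_ME (A : set (cpath R)) t : measurable A -> 0 <= t ->
  (\int[P']_(w in A) (M f g t w)%:E = \int[P']_(w in A) (M fa ga t w)%:E)%E.
Proof.
move=> mA t0; apply: ae_eq_integral => //.
- by apply/measurable_EFinP; apply: measurable_funTS; exact: measurable_M.
- by apply/measurable_EFinP; apply: measurable_funTS; exact: measurable_M.
- by apply: filterS nonneg => w wN _; rewrite ME.
Qed.

Let increment s t (A : set (cpath R)) : 0 <= s -> s <= t -> canonical_filtration s A ->
  \int[P']_w (\1_A w * (M fa ga t w - M fa ga s w)) = 0.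
Proof.
move=> s0 st FA; have t0 := le_trans s0 st.
have [[Mf fM] [Mg gM]] := bessel_generator_bounded gen.
have mA := canonical_filtration_measurable FA.
pose xi (w : cpath R) : R := \1_A w.
have xi1 w : `|xi w| <= 1.
  by rewrite /xi indicE; case: (_ \in _); rewrite ?normr1 ?normr0.
have mxi : measurable_fun setT xi by exact: measurable_indic.
pose D w := M fa ga t w - M fa ga s w.
have DE w : D w = fa (pval w t) - fa (pval w s) - \int[leb]_(r in `[s, t]) ga (pval w r).
  rewrite /D /M !gaE !(pvalE _ s0, pvalE _ t0).
  have := @Rintegral_itvB R (fun r => ga (pval w r)) (BLeft 0) (BRight t) s (igaw _ _ _).
  rewrite !bnd_simp => /(_ s0 st).
  rewrite Rintegral_itv_obnd_cbnd; first by move=> <-; ring.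
  apply: integrableS (igaw w s t) => //.
  by apply: subset_itvr; rewrite bnd_simp.
have E w : \int[leb]_(r in `[s, t]) (xi w * ga (pval w r)) =
    xi w * fa (pval w t) - xi w * fa (pval w s) - xi w * D w.
  by rewrite RintegralZl// DE; ring.
have dyn := change_of_law_dynkin d0 mu0 lawY dens gen s0 st FA.
have fub := @Fubini_bounded R _ _ P' (fun w r => xi w * ga (pval w r)) s t (1 * Mg).
have i1 u := integrable_xi_psi P' xi1 mxi u cfa fM.
have iD : P'.-integrable setT (EFin \o D) by apply: integrableRB => //; exact: integrable_Ma.
have ixD : P'.-integrable setT (EFin \o (fun w => xi w * D w)).
  by apply: (@integrable_boundedM _ _ _ _ _ _ _ 1).
have key : \int[P']_w (xi w * fa (pval w t)) - \int[P']_w (xi w * fa (pval w s)) -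
    \int[P']_w (xi w * D w) =
    \int[P']_w (xi w * fa (pval w t)) - \int[P']_w (xi w * fa (pval w s)).
  rewrite [RHS]dyn -fub.
  - under [RHS]eq_Rintegral do rewrite E.
    by rewrite RintegralB//; [rewrite RintegralB|exact: integrableRB].
  - apply: measurable_funM; first exact: (@measurableT_comp _ _ _ _ _ _ xi _ fst).
    apply: (@measurableT_comp _ _ _ _ _ _ ga); first exact: continuous_measurable_fun.
    exact: measurable_joint.
  - by move=> w r; rewrite normrM; apply: ler_pM => //; exact: gM.
by move: key; rewrite -[X in _ = X]subr0 => /addrI/oppr_inj.
Qed.

(** Paths being nonnegative almost surely, f and g may be replaced by their bounded even
    versions, for which the increments are controlled by [change_of_law_dynkin]. *)
Lemma change_of_law_martingale : martingale P' (fun t w =>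
  f (w t) - f (w 0) - \int[lebesgue_measure]_(r in `[0, t]) g (w r)).
Proof.
change (martingale P' (M f g)).
split.
- move=> t t0; apply/integrableP; split.
    by apply/measurable_EFinP; exact: measurable_M.
  have /integrableP[_] := integrable_Ma t0; apply: le_lt_trans.
  rewrite le_eqVlt; apply/orP; left; apply/eqP; apply: ae_eq_integral => //.
  + apply: measurableT_comp => //; apply/measurable_EFinP; exact: measurable_M.
  + apply: measurableT_comp => //; apply/measurable_EFinP; exact: measurable_M.
  + by apply: filterS nonneg => w wN _; rewrite /= ME.
- move=> t B t0 mB; have := adapted cf cg t0 measurableT mB.
  by rewrite setTI.
- move=> s t A s0 st FA; have t0 := le_trans s0 st.
  have mA := canonical_filtration_measurable FA.
  suff H : (\int[P']_(w in A) (M fa ga t w)%:E = \int[P']_(w in A) (M fa ga s w)%:E)%E.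
    exact: etrans (integral_ME mA t0) (etrans H (esym (integral_ME mA s0))).
  have iA u (u0 : 0 <= u) := integrableS measurableT mA (@subsetT _ A) (integrable_Ma u0).
  exact: (eq_integral_indic mA (iA t t0) (iA s s0) (increment s0 st FA)).
Qed.

End martingale.

Lemma change_of_law_bessel : bessel_law delta mu 0 P'.
Proof.
split; [exact: start0|exact: nonneg|].
by move=> f g gen; exact: (change_of_law_martingale gen).
Qed.

End bessel_law_with_drift.

Theorem theorem1 (R : realType) (delta mu : R) (hdelta : 0 < delta) (hmu : 0 < mu)
    (d : measure_display) (Omega : measurableType d) (P : probability Omega R)
    (X X' : Omega -> cpath R) (E : Omega -> R)
    (QX QX' : probability (cpath R) R) :
  independent3 P X X' E ->
  sqbessel_law delta 0 0 QX -> has_law P X QX ->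
  sqbessel_law 4 mu 0 QX' -> has_law P X' QX' ->
  has_law P E (exponential_prob (mu ^+ 2 / 2)) ->
  exists2 Q : probability (cpath R) R,
    sqbessel_law delta mu 0 Q &
    has_law P (fun w => delayed_sum (X w) (X' w) (E w)) Q.
Proof.
move=> ind [PY lawY sqY] hX [PY' lawY' sqY'] hX' hE.
rewrite sqrtr0 in lawY; rewrite sqrtr0 in lawY'.
have [Q hQ [P' sqP' [nonneg dens]]] := sum_law hdelta hmu ind lawY lawY' sqY sqY' hX hX' hE.
have lawP' := change_of_law_bessel hdelta hmu lawY nonneg dens.
exists Q; last exact: hQ.
by exists P'; [rewrite sqrtr0; exact: lawP'|exact: sqP'].
Qed.
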